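(* Let $S$ be a disk with finitely many marked points on its boundary. The map $\mathbb{I}_{\mathcal A}^q:\mathcal A_0(\mathbb{Z}^t)\to\mathcal X^q$ satisfies the following properties (for any ideal triangulation $T$ with internal edges $J=\{1,\dots,n\}$ and $X_j=X_{j;T}$): 1. Each $\mathbb I^q_{\mathcal A}(l)$ is a Laurent polynomial in the variables $X_i$ with coefficients in $\mathbb{Z}_{\ge0}[q,q^{-1}]$. 2. The expression $\mathbb I^q_{\mathcal A}(l)$ agrees with the Laurent polynomial $\mathbb I_{\mathcal A}(l)$ when $q=1$. 3. Let $*$ be the canonical involutive antiautomorphism of $\mathcal X^q$ that fixes each $X_i$ and sends $q$ to $q^{-1}$. Then $*\mathbb I^q_{\mathcal A}(l)=\mathbb I^q_{\mathcal A}(l)$. 4. The highest term of $\mathbb I^q_{\mathcal A}(l)$ is $q^{-\sum_{i<j}\varepsilon_{ij}a_ia_j}X_1^{a_1}\cdots X_n^{a_n}$, where $X_1^{a_1}\cdots X_n^{a_n}$ is the highest term of the classical expression $\mathbb I_{\mathcal A}(l)$. 5. For any $l,l'\in\mathcal A_0(\mathbb{Z}^t)$ we have $\mathbb I^q_{\mathcal A}(l)\,\mathbb I^q_{\mathcal A}(l')=\sum_{l''\in\mathcal A_0(\mathbb{Z}^t)}c^q(l,l';l'')\,\mathbb I^q_{\mathcal A}(l'')$, where $c^q(l,l';l'')\in\mathbb{Z}[q,q^{-1}]$ and only finitely many terms are nonzero.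
   Context: **Combinatorics.** $S$ is a disk with finitely many marked points (at least three) on its boundary. An ideal triangulation $T$ is a triangulation of $S$ with vertices the marked points; $I$ is its set of edges (including boundary edges), $J$ the internal edges. For $i,j\in I$, $\varepsilon_{ij}$ is the sum over triangles $t$ of $T$ of $+1$ if $i,j$ are sides of $t$ and $i$ immediately follows $j$ counterclockwise about their common vertex in $t$, $-1$ if $j$ so follows $i$, $0$ otherwise. $\lambda_{ij}=\Lambda_T(\mathbf e_i,\mathbf e_j)$ is $1$ if $i,j$ share a vertex and $i$ is clockwise to $j$ there, $-1$ if $j$ is clockwise to $i$, $0$ otherwise; $\Lambda_T$ is extended to a skew bilinear form on $\mathbb{Z}^I$. **Toric frames.** Let $\omega$ be a formal variable, $q=\omega^4$. There is a skew-field $\mathcal F$ (the fraction field of the skein algebra of $S$) and, for each $T$, a map $M_T:\mathbb{Z}^I\to\mathcal F\setminus\{0\}$ with $M_T(0)=1$, $M_T(u)M_T(v)=\omega^{-\Lambda_T(u,v)}M_T(u+v)$, such that the elements $M_T(v)$ form a $\mathbb{Z}[\omega^{\pm1}]$-basis of a quantum torus whose skew-field of fractions is $\mathcal F$; and if $T'$ is obtained from $T$ by flipping $k$, then $M_{T'}(\mathbf e_i)=M_T(\mathbf e_i)$ for $i\ne k$ and $M_{T'}(\mathbf e_k)=M_T\big(-\mathbf e_k+\sum_i[\varepsilon_{ki}]_+\mathbf e_i\big)+M_T\big(-\mathbf e_k+\sum_i[-\varepsilon_{ki}]_+\mathbf e_i\big)$, $[a]_+=\max(a,0)$. These properties determine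 all $M_T$ from one of them. **Quantum Poisson variety.** For $j\in J$, $X_{j;T}=M_T(\sum_s\varepsilon_{js}\mathbf e_s)$. They satisfy $X_iX_j=q^{2\varepsilon_{ij}}X_jX_i$ and transform under flips by the quantum mutation maps, so $\mathcal X^q$, the gluing by quantum mutations of the skew-fields of fractions of the quantum tori over $\mathbb{Z}[q^{\pm1}]$ with generators $X_j^{\pm1}$ ($j\in J$) and these relations, is identified with the subfield of $\mathcal F$ generated by the $X_{j;T}$. **Laminations.** $\mathcal{A}_0(\mathbb{Z}^t)$ is the set of homotopy classes of finite collections of pairwise disjoint simple noncontractible arcs in $S$ with endpoints in the interiors of boundary edges, with rational weights, nonnegative except possibly for special arcs (those cutting off exactly one marked point), such that the total weight of ends on each boundary edge is $0$ and the numbers $\frac12(\text{total weight of curves crossing edge } i\text{, minimally})$ are integers for all edges $i$ of a (any) $T$; arcs of weight 0 are discarded and homotopic arcs merged by adding weights. **The map.** Drag the endpoints of the arcs of $l$ counterclockwise along the boundary until they hit marked points; choose an ideal triangulation $T_l$ such that each resulting curve is an edge of it; let $\mathbf w$ be the integral vector with $w_i$ the weight of the curve at edge $i$. Then $\mathbb I^q_{\mathcal A}(l)=M_{T_l}(\mathbf w)$, independent of the choice of $T_l$. **Classical map.** With marked points numbered counterclockwise, choose vectors $v_p\in\mathbb{C}^2$ at the marked points; for an arc $pr$, $p<r$, let $A_{pr}=\det(v_p,v_r)$; then $\mathbb I_{\mathcal A}(l)=\prod_iA_i^{w_i}$ over edges $i$ of $T_l$, a Laurent polynomial in the coordinates $X_j=\prod_sA_s^{\varepsilon_{js}}$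 ($j\in J$). The highest term of a Laurent polynomial in $X_1,\dots,X_n$ is the term whose exponent vector is componentwise at least every other exponent vector that occurs; in the noncommutative case monomials are written in the order $X_1^{i_1}\cdots X_n^{i_n}$. *)

(* Defs.v *)
From HB Require Import structures.
From mathcomp Require Import all_boot all_order all_algebra finmap.
From mathcomp Require Import complex reals zify.

Set Implicit Arguments.
Unset Strict Implicit.
Unset Printing Implicit Defensive.

Import Order.TTheory GRing.Theory Num.Theory.
Local Open Scope ring_scope.

(* The marked points v_0, ..., v_(m-1) of the disk are numbered
   counterclockwise by 'I_m, and b_i denotes the boundary edge that runs
   counterclockwise from v_i to v_(i+1).  An edge joining two marked points
   is the two-element set of its ends. *)

(* number of counterclockwise steps from p to r *)
Definition ccw_dist m (p r : 'I_m) : nat := (r + (m - p)) %% m.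

(* With four distinct labels placed on a circle in the order a, b, c, d, the
   segments ac and bd cross. *)
Definition crosses m (e f : {set 'I_m}) : bool :=
  [exists a : 'I_m, exists b : 'I_m, exists c : 'I_m, exists d : 'I_m,
    [&& (a < b)%N, (b < c)%N, (c < d)%N &
        ((e == [set a; c]) && (f == [set b; d]))
        || ((f == [set a; c]) && (e == [set b; d]))]].

Definition noncrossing m (T : {set {set 'I_m}}) : bool :=
  [forall e in T, #|e| == 2%N]
  && [forall e in T, forall f in T, ~~ crosses e f].

Definition ideal_triangulation m (T : {set {set 'I_m}}) : bool :=
  maxset (@noncrossing m) T.

Definition boundary_edge m (e : {set 'I_m}) : bool :=
  [exists p, e == [set p; ordS p]].

Definition internal_edges m (T : {set {set 'I_m}}) : {set {set 'I_m}} :=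
  [set e in T | ~~ boundary_edge e].

(* The disk has no interior marked point, so three vertices pairwise joined in
   T span a triangle of T. *)
Definition triangles m (T : {set {set 'I_m}}) : {set {set 'I_m}} :=
  [set t : {set 'I_m} | (#|t| == 3%N)
     && [forall e : {set 'I_m}, (e \subset t) && (#|e| == 2%N) ==> (e \in T)]].

(* i = pr and j = ps with i clockwise to j at p: seen from p, the other marked
   points p+1, ..., p+m-1 occur in this order counterclockwise. *)
Definition clockwise_to m (i j : {set 'I_m}) : bool :=
  [exists p : 'I_m, exists r : 'I_m, exists s : 'I_m,
    [&& i == [set p; r], j == [set p; s], (0 < ccw_dist p r)%N
      & (ccw_dist p r < ccw_dist p s)%N]].

Definition lam m (i j : {set 'I_m}) : int :=
  if clockwise_to i j then 1 else if clockwise_to j i then -1 else 0.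

Definition eps m (T : {set {set 'I_m}}) (i j : {set 'I_m}) : int :=
  \sum_(t in triangles T | (i \subset t) && (j \subset t))
    (if clockwise_to j i then 1 else if clockwise_to i j then -1 else 0).

(* The lattice Z^I of a triangulation T consists of the vectors that satisfy
   [supported T]; vectors for all triangulations live in one ambient type. *)
Definition vec m := {ffun {set 'I_m} -> int}.

Definition supported m (T : {set {set 'I_m}}) (u : vec m) : Prop :=
  forall i, i \notin T -> u i = 0.

Definition basis_vec m (i : {set 'I_m}) : vec m := [ffun j => (i == j)%:Z].

Definition Lam m (T : {set {set 'I_m}}) (u v : vec m) : int :=
  \sum_(i in T) \sum_(j in T) u i * v j * lam i j.

(* c k is the coefficient of z^k *)
Definition laurent := {fsfun int -> int with 0}.
Definition laurent0 : laurent := [fsfun].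

Definition laurent_eval (A : unitRingType) (z : A) (c : laurent) : A :=
  \sum_(k <- finsupp c) (c k)%:~R * z ^ k.

(* P a is the coefficient of X_1^(a 1) ... X_n^(a n); the coefficients are in
   Z[q, 1/q] for [qlaurent] and in A for [mlaurent]. *)
Definition qlaurent n := {fsfun {ffun 'I_n -> int} -> laurent with laurent0}.
Definition mlaurent n (A : nzRingType) :=
  {fsfun {ffun 'I_n -> int} -> A with 0}.

(* The factors are taken in increasing order of i; the X i need not commute. *)
Definition monomial n (A : unitRingType) (X : 'I_n -> A)
    (a : {ffun 'I_n -> int}) : A :=
  \prod_(i < n) X i ^ a i.

Definition qlaurent_eval n (A : unitRingType) (q : A) (X : 'I_n -> A)
    (P : qlaurent n) : A :=
  \sum_(a <- finsupp P) laurent_eval q (P a) * monomial X a.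

Definition mlaurent_eval n (A : unitRingType) (X : 'I_n -> A)
    (P : mlaurent n A) : A :=
  \sum_(a <- finsupp P) P a * monomial X a.

Definition specialize_q1 n (A : unitRingType) (P : qlaurent n) :
    mlaurent n A :=
  [fsfun a in finsupp P => laurent_eval (1 : A) (P a)].

(* [S] is the finite set of exponent vectors that occur *)
Definition highest_exponent n (S : {fset {ffun 'I_n -> int}})
    (a : {ffun 'I_n -> int}) : Prop :=
  a \in S /\ forall b, b \in S -> forall i, b i <= a i.

Definition skew_field (F : unitRingType) : Prop :=
  forall x : F, x != 0 -> x \is a GRing.unit.

Definition is_flip m (T T' : {set {set 'I_m}}) (k k' : {set 'I_m}) : Prop :=
  [/\ ideal_triangulation T, ideal_triangulation T', k \in T, k' \notin T
    & T' = k' |: (T :\ k)].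

(* elements of the quantum torus of T: Z[omega, 1/omega]-combinations of the
   M v *)
Definition torus_eval m (F : unitRingType) (omega : F) (M : vec m -> F)
    (c : {fsfun vec m -> laurent with laurent0}) : F :=
  \sum_(v <- finsupp c) laurent_eval omega (c v) * M v.

Definition supported_coef m (T : {set {set 'I_m}})
    (c : {fsfun vec m -> laurent with laurent0}) : Prop :=
  forall v, v \in finsupp c -> supported T v.

Record toric_frames m (F : unitRingType) (omega : F)
    (M : {set {set 'I_m}} -> vec m -> F) : Prop := ToricFrames {
  tf_omega_unit : omega \is a GRing.unit;
  tf_omega_central : forall x, omega * x = x * omega;
  tf_neq0 : forall T v, ideal_triangulation T -> supported T v -> M T v != 0;
  tf_0 : forall T, ideal_triangulation T -> M T 0 = 1;
  tf_mul : forall T u v, ideal_triangulation T ->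
    supported T u -> supported T v ->
    M T u * M T v = omega ^ (- Lam T u v) * M T (u + v);
  (* omega is a formal variable and the M T v are linearly independent *)
  tf_free : forall T c, ideal_triangulation T -> supported_coef T c ->
    torus_eval omega (M T) c = 0 -> c = [fsfun];
  tf_fractions : forall T x, ideal_triangulation T ->
    exists c d, [/\ supported_coef T c, supported_coef T d,
      torus_eval omega (M T) d != 0
      & x = torus_eval omega (M T) c * (torus_eval omega (M T) d)^-1];
  tf_flip_other : forall T T' k k', is_flip T T' k k' ->
    forall i, i \in T -> i != k ->
      M T' (basis_vec i) = M T (basis_vec i);
  tf_flip : forall T T' k k', is_flip T T' k k' ->
    M T' (basis_vec k') =
      M T (- basis_vec k
           + \sum_(i in T) basis_vec i *~ Num.max (eps T k i) 0)
      + M T (- basis_vec k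
             + \sum_(i in T) basis_vec i *~ Num.max (- eps T k i) 0)
}.

Definition Xvar m (F : unitRingType) (M : {set {set 'I_m}} -> vec m -> F)
    (T : {set {set 'I_m}}) (j : {set 'I_m}) : F :=
  M T (\sum_(s in T) basis_vec s *~ eps T j s).

(* The skew subfield of F generated by q = omega^4 and all the X_(j;T); the
   scalar q is adjoined because the quantum tori are over Z[q, 1/q]. *)
Inductive in_Xq m (F : unitRingType) (omega : F)
    (M : {set {set 'I_m}} -> vec m -> F) : F -> Prop :=
| in_Xq_q : in_Xq omega M (omega ^+ 4)
| in_Xq_X T j : ideal_triangulation T -> j \in internal_edges T ->
    in_Xq omega M (Xvar M T j)
| in_Xq_1 : in_Xq omega M 1
| in_Xq_sub x y : in_Xq omega M x -> in_Xq omega M y -> in_Xq omega M (x - y)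
| in_Xq_mul x y : in_Xq omega M x -> in_Xq omega M y -> in_Xq omega M (x * y)
| in_Xq_inv x : in_Xq omega M x -> in_Xq omega M x^-1.

(* [star] matters only on the subfield K; as K is generated by q and the X_i,
   at most one map on K has these properties. *)
Definition canonical_star n (F : unitRingType) (K : F -> Prop) (q : F)
    (X : 'I_n -> F) (star : F -> F) : Prop :=
  [/\ forall x, K x -> K (star x),
      [/\ star 1 = 1,
          forall x y, K x -> K y -> star (x + y) = star x + star y
        & forall x y, K x -> K y -> star (x * y) = star y * star x],
      forall x, K x -> star (star x) = x,
      forall i, star (X i) = X i
    & star q = q^-1].

(* A noncontractible arc is determined up to homotopy by the two distinct
   boundary edges b_i, b_j on which it ends, so it is the set [set i; j].
   Distinct arcs can be made disjoint exactly when their ends do not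
   interleave.  A lamination is the function W giving the weight of each
   homotopy class, 0 for the arcs that are absent. *)

(* Going counterclockwise from b_i to b_j one meets [ccw_dist i j] marked
   points. *)
Definition special_arc m (a : {set 'I_m}) : bool :=
  [exists i, exists j, (a == [set i; j]) && (ccw_dist i j == 1%N)].

(* The edge v_p v_r (p < r) separates b_p, ..., b_(r-1) from the other
   boundary edges; it meets an arc once if it separates its ends, and can be
   avoided otherwise.  An arc ending on b_p thus counts as crossing b_p. *)
Definition arc_crosses_edge m (a e : {set 'I_m}) : bool :=
  [exists i : 'I_m, exists j : 'I_m, exists p : 'I_m, exists r : 'I_m,
    [&& a == [set i; j], e == [set p; r], (p < r)%N,
        (p <= i < r)%N & ~~ (p <= j < r)%N]].

Definition is_lamination m (W : {ffun {set 'I_m} -> rat}) : bool :=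
  [&& [forall a, (W a != 0) ==> (#|a| == 2%N)],
      [forall a, forall b, (W a != 0) && (W b != 0) ==> ~~ crosses a b],
      [forall a, ~~ special_arc a ==> (0 <= W a)],
      [forall i, \sum_(a : {set 'I_m} | i \in a) W a == 0]
    & [forall T : {set {set 'I_m}}, ideal_triangulation T ==>
        [forall e in T,
          2%:R^-1 * (\sum_(a | arc_crosses_edge a e) W a) \is a Num.int]]].

Definition lamination m := {W : {ffun {set 'I_m} -> rat} | is_lamination W}.

(* Dragging counterclockwise moves an end on b_i to v_(i+1), so the arc a
   becomes the edge @ordS m @: a, and e comes from @ordS m @^-1: e. *)
Definition curve_weight m (l : lamination m) (e : {set 'I_m}) : rat :=
  val l (@ordS m @^-1: e).

Definition wvec m (l : lamination m) : vec m :=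
  [ffun e => Num.floor (curve_weight l e)].

(* Integrality of the half crossing numbers makes the weights integers, so the
   rounding in [wvec] is harmless. *)
Section Integrality.

Variables (m : nat) (l : lamination m).

Let W := val l.

Let cut (S : pred 'I_m) : rat :=
  \sum_(a : {set 'I_m} | (#|a| == 2%N) && (#|[set x in a | S x]| == 1%N)) W a.

Let W0 (a : {set 'I_m}) : #|a| != 2 -> W a = 0.
Proof.
have /and5P[/forallP h _ _ _ _] := valP l.
by move=> na; apply/eqP; apply: contraNT na; apply: implyP (h a).
Qed.

Let card_side (x y : 'I_m) (S : pred 'I_m) : x != y ->
  (#|[set z in [set x; y] | S z]| == 1%N) = (S x (+) S y).
Proof.
move=> nxy; rewrite setIdE.
have -> : [set x; y] :&: [set z | S z] =
    (if S x then [set x] else set0) :|: (if S y then [set y] else set0).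
  apply/setP=> z; rewrite !inE.
  have [->|nzx] := eqVneq z x; have [zy|nzy] := eqVneq z y;
    try (by rewrite -?zy; case: (S x); rewrite ?inE ?eqxx ?orbT //=;
         case: (S y); rewrite ?inE ?(negPf nxy) ?eqxx).
  - case: (S x); rewrite inE ?eqxx //=.
    by case: (S y); rewrite inE ?(negPf nxy).
  - rewrite zy; case: (S y); rewrite !inE ?eqxx ?orbT ?orbF //=.
    by case: (S x); rewrite inE // eq_sym (negPf nxy).
  - by case: (S x); case: (S y); rewrite !inE ?(negPf nzx) ?(negPf nzy).
case: (S x); case: (S y); rewrite ?setU0 ?set0U ?cards1 ?cards0 //.
by rewrite cards2 nxy.
Qed.

Let cut_edge (p r : 'I_m) : (p < r)%N ->
  2%:R^-1 * cut (fun x => p <= x < r)%N \is a Num.int.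
Proof.
move=> pr.
have npr : p != r by apply: contraTneq pr => ->; rewrite ltnn.
have nc : noncrossing [set [set p; r]].
  apply/andP; split; apply/forall_inP => e; rewrite inE => /eqP->.
    by rewrite cards2 npr.
  apply/forall_inP => f; rewrite inE => /eqP->; apply/negP.
  case/existsP=> a /existsP[b /existsP[c /existsP[d /and4P[ab bc cd]]]].
  rewrite orbb => /andP[/eqP-> /eqP/setP/(_ a)]; rewrite !inE eqxx /=.
  by move/esym/orP=> [] /eqP Ea; move: ab bc cd; rewrite Ea; lia.
have [T mT sT] := maxset_exists nc.
have /and5P[_ _ _ _ /forallP/(_ T)] := valP l.
rewrite /ideal_triangulation mT /= => /forall_inP/(_ [set p; r]).
rewrite (subsetP sT) ?inE // => /(_ isT).
rewrite big_mkcond /= [cut _]big_mkcond /=.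
congr (_ * _ \is a _); apply: eq_bigr => a _ /=.
have [ca|ca] := boolP (#|a| == 2%N); last first.
  by rewrite -[sval l a]/(W a) (W0 ca) !if_same.
have /cards2P[x [y [nxy ->]]] := ca; rewrite card_side //=.
rewrite -[sval l _]/(W _); congr (if _ then _ else _).
apply/existsP/idP => [[i /existsP[j /existsP[p' /existsP[r' /and5P[]]]]]|].
  move=> /eqP Ea /eqP Ee pr' si sj.
  have [Ep Er] : p = p' /\ r = r'.
    move/setP: Ee => Ee; have := Ee p; have := Ee r; have := Ee p'.
    rewrite !inE !eqxx ?orbT /=.
    move=> /orP[] /eqP E1 /esym/orP[] /eqP E2 /esym/orP[] /eqP E3;
      split; apply/val_inj; move: pr pr'; rewrite ?E1 ?E2 ?E3; try lia;
      move: E1 E2 E3 => /(congr1 val) /= + /(congr1 val) /= + /(congr1 val) /=;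
      lia.
  move: si sj; rewrite -{}Ep -{}Er => si /negPf sj.
  move/setP: Ea => Ea; have := Ea x; have := Ea y.
  rewrite !inE !eqxx ?orbT /=.
  move=> /esym/orP[] /eqP E1 /esym/orP[] /eqP E2;
    rewrite E1 E2 ?si ?sj //; by move: nxy; rewrite E1 E2 eqxx.
move=> sxy; have [sx|sx] := boolP (p <= x < r)%N.
  exists x; apply/existsP; exists y; apply/existsP; exists p; apply/existsP.
  by exists r; rewrite !eqxx pr sx /=; move: sxy; rewrite sx.
exists y; apply/existsP; exists x; apply/existsP; exists p; apply/existsP.
by exists r; rewrite setUC !eqxx pr sx andbT /=; move: sxy; rewrite (negPf sx).
Qed.

Let eq_cut (S S' : pred 'I_m) :
  (forall x y, S x (+) S y = S' x (+) S' y) -> cut S = cut S'.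
Proof.
move=> eS; apply: eq_bigl => a; apply: andb_id2l => /cards2P[x [y [nxy ->]]].
by rewrite !card_side.
Qed.

Let cut_interval (p r : nat) : (p <= r <= m)%N ->
  2%:R^-1 * cut (fun x => p <= x < r)%N \is a Num.int.
Proof.
case/andP=> pr rm; have [Epr|npr] := eqVneq p r.
  rewrite (@eq_cut _ pred0); last by move=> x y /=; rewrite Epr; lia.
  rewrite [cut _]big1 ?mulr0 ?rpred0 // => a.
  by case/andP=> /cards2P[x [y [nxy ->]]]; rewrite card_side.
have [lrm|] := ltnP r m.
  by have lpm : (p < m)%N; [lia | apply: (@cut_edge (Ordinal lpm) (Ordinal lrm)) => /=; lia].
move=> mr; have {rm mr} Er : r = m by lia.
have [->|p0] := eqVneq p 0.
  rewrite (@eq_cut _ pred0); last first.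
    by move=> x y /=; rewrite Er !ltn_ord.
  rewrite [cut _]big1 ?mulr0 ?rpred0 // => a.
  by case/andP=> /cards2P[x [y [nxy ->]]]; rewrite card_side.
have lpm : (p < m)%N by lia.
have l0m : (0 < m)%N by lia.
rewrite (@eq_cut _ (fun x : 'I_m => 0 <= x < p)%N).
  by apply: (@cut_edge (Ordinal l0m) (Ordinal lpm)) => /=; lia.
by move=> x y; rewrite Er !ltn_ord /=; lia.
Qed.

Let W_int (a : {set 'I_m}) : W a \is a Num.int.
Proof.
have [ca|/W0->] := boolP (#|a| == 2%N); last exact: rpred0.
have {ca} [i [j [ij ->]]] : exists i j : 'I_m, (i < j)%N /\ a = [set i; j].
  have /cards2P[x [y [nxy ->]]] := ca.
  have [xy|xy] := ltnP x y; first by exists x, y.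
  exists y, x; rewrite setUC; split=> //; rewrite ltn_neqAle xy andbT.
  by rewrite eq_sym.
suff -> : W [set i; j] =
    2%:R^-1 * cut (fun x => i <= x < j)%N
    + 2%:R^-1 * cut (fun x => i.+1 <= x < j.+1)%N
    - 2%:R^-1 * cut (fun x => i.+1 <= x < j)%N
    - 2%:R^-1 * cut (fun x => i <= x < j.+1)%N.
  by have := ltn_ord j => jm; rewrite ?(rpredB, rpredD) // cut_interval //; lia.
rewrite -mulrDr -!mulrBr; apply: (mulfI (x := 2%:R)) => //.
rewrite mulrA divff // mul1r mulr_natl.
rewrite ![cut _]big_mkcond -big_split -!sumrB /=.
have -> : W [set i; j] *+ 2 =
    \sum_(a : {set 'I_m}) (if a == [set i; j] then W a *+ 2 else 0).
  by rewrite -big_mkcond big_pred1_eq.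
apply: eq_bigr => b _.
have [cb|/W0 ->] := boolP (#|b| == 2%N);
  last by rewrite ?mul0rn !if_same !(addr0, subr0, oppr0).
have /cards2P[x [y [nxy ->]]] := cb; rewrite !card_side //=.
have -> : ([set x; y] == [set i; j]) =
    ((x == i) && (y == j)) || ((x == j) && (y == i)).
  have nij : i != j by rewrite neq_ltn ij.
  apply/eqP/idP => [/setP E|/orP[]/andP[/eqP-> /eqP->] //]; last exact: setUC.
  have := E x; have := E y; rewrite !inE !eqxx ?orbT /=.
  move=> /esym/orP[] /eqP E1 /esym/orP[] /eqP E2;
    by move: nxy; rewrite E1 E2 ?eqxx // ?orbT.
pose z (t : 'I_m) := (i < t < j)%N.
have z1 (t : 'I_m) : (i <= t < j)%N = (t == i) || z t.
  by rewrite /z -val_eqE /=; lia.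
have z2 (t : 'I_m) : (i < t < j.+1)%N = (t == j) || z t.
  by rewrite /z -val_eqE /=; lia.
have z3 (t : 'I_m) : (i <= t < j.+1)%N = [|| t == i, t == j | z t].
  by rewrite /z -!val_eqE /=; lia.
have excl (t : 'I_m) : [&& ~~ ((t == i) && (t == j)), ~~ ((t == i) && z t)
    & ~~ ((t == j) && z t)].
  by rewrite /z -!val_eqE /=; lia.
have nxi : ~~ ((x == i) && (y == i)).
  by apply: contra nxy => /andP[/eqP-> /eqP->].
have nxj : ~~ ((x == j) && (y == j)).
  by apply: contra nxy => /andP[/eqP-> /eqP->].
rewrite !z1 !z2 !z3 -![(i < _ < j)%N]/(z _) mulr2n.
move: (excl x) (excl y) nxi nxj.
case: (x == i); case: (x == j); case: (z x) => //= _;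
case: (y == i); case: (y == j); case: (z y) => //= _ _ _;
by rewrite ?(addr0, add0r, subr0, oppr0, subrr, addrK).
Qed.

Lemma wvecE e : (wvec l e)%:~R = curve_weight l e.
Proof. by rewrite ffunE; apply: floorK; apply: W_int. Qed.

End Integrality.

Definition adapted m (l : lamination m) (T : {set {set 'I_m}}) : Prop :=
  ideal_triangulation T /\ forall e, curve_weight l e != 0 -> e \in T.

(* The product has exactly one factor when e has two elements. *)
Definition Acoord m (R : realType) (v : 'I_m -> 'cV[R[i]]_2)
    (e : {set 'I_m}) : R[i] :=
  \prod_(pr : 'I_m * 'I_m | (pr.1 < pr.2)%N && (e == [set pr.1; pr.2]))
    \det (row_mx (v pr.1) (v pr.2) : 'M_2).

Definition Xcoord m (R : realType) (v : 'I_m -> 'cV[R[i]]_2)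
    (T : {set {set 'I_m}}) (j : {set 'I_m}) : R[i] :=
  \prod_(s in T) Acoord v s ^ eps T j s.

Definition classical_map m (R : realType) (Tl : {set {set 'I_m}})
    (l : lamination m) (v : 'I_m -> 'cV[R[i]]_2) : R[i] :=
  \prod_(e in Tl) Acoord v e ^ wvec l e.

(* P is the expression of f as a Laurent polynomial in the X_j, where
   J : 'I_n -> _ enumerates the internal edges of T; the A_e of edges of T
   must not vanish for the X_j to be defined. *)
Definition classical_expression m (R : realType) (T : {set {set 'I_m}})
    n (J : 'I_n -> {set 'I_m}) (f : ('I_m -> 'cV[R[i]]_2) -> R[i])
    (P : mlaurent n R[i]) : Prop :=
  forall v : 'I_m -> 'cV[R[i]]_2, (forall e, e \in T -> Acoord v e != 0) ->
    f v = mlaurent_eval (fun i => Xcoord v T (J i)) P.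

(* Main.v *)
Require Import Defs.
From HB Require Import structures.
From mathcomp Require Import all_boot all_order all_algebra finmap.
From mathcomp Require Import complex reals boolp zify ring.

Set Implicit Arguments.
Unset Strict Implicit.
Unset Printing Implicit Defensive.

Import Order.TTheory GRing.Theory Num.Theory.
Local Open Scope ring_scope.

(* For a triangulation T, a chord pr that is not in T is a diagonal of a
   quadrilateral p, a, r, b whose triangle p, a, b belongs to T, and the Ptolemy relation
     A_ab A_pr = w^2 A_bp A_ar + w^-2 A_pa A_br
   expresses A_pr through chords that cross T less often.  By induction A_pr is a
   sum of monomials M_T(v), each with coefficient 1, one of which is the highest.
   The same relations with w = 1 hold for the classical coordinates, so that a
   product of A's has one expansion for both, a list of pairs (k, v) standing for
   w^k M_T(v); reversing the product negates the k's.  The powers of w that occur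
   are controlled by the form mu(e, f) = lambda(e, f) + 2 [e crosses f], which is
   additive modulo 4 under the Ptolemy relation: this makes all the coefficients
   powers of q = w^4, both in the expansions and when the crossings in a product
   of two elements are resolved. *)

(** * Cyclic order *)

(** Two facts tie words in the A's to the X's. First, [Lam] of the exponent vector of X_j with the
    basis vector of s is 4 if s = j and 0 otherwise. So a monomial in the X's pairs with an internal
    edge as -4 times its exponent: a lowest pairing is a highest exponent, and powers of omega
    become powers of q = omega^4. Second, the vectors of degree zero at every marked point are
    exactly the integer combinations of these exponent vectors; a lamination gives such degrees,
    hence an expansion in the X's. The highest monomial occurs once. The reversed word gives the
    same element with opposite powers, which forces the power of the highest monomial to be 0 and
    leaves only the cost of reordering into X_1^a_1 ... X_n^a_n. The frames are given triangulation
    by triangulation, so A_e has to be shown independent of it: flips lead to the fan at an end of e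
    without touching e. A classical expression is known only through its values; its uniqueness
    needs vectors realising all nonzero edge values, and independence of characters. Configurations
    of a few chords are settled by enumerating relative orders. *)

Definition cyc (T : Type) (lt : rel T) (a b c : T) : bool :=
  [|| lt a b && lt b c, lt b c && lt c a | lt c a && lt a b].

(** Equality too is phrased through [lt], so that a statement depends on the numbers only through
    their order and can be evaluated on a finite relation. *)
Definition eq_by (T : Type) (lt : rel T) (a b : T) : bool :=
  ~~ lt a b && ~~ lt b a.

(* The chord ac crosses the chord bd. *)
Definition chord_cross (T : Type) (lt : rel T) (a c b d : T) : bool :=
  (cyc lt a b c && cyc lt c d a) || (cyc lt a d c && cyc lt c b a).

Definition chord_cw (T : Type) (lt : rel T) (a b c d : T) : bool :=
  [|| eq_by lt a c && cyc lt a b d, eq_by lt a d && cyc lt a b c,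
      eq_by lt b c && cyc lt b a d | eq_by lt b d && cyc lt b a c].

Definition chord_lam (T : Type) (lt : rel T) (a b c d : T) : int :=
  if chord_cw lt a b c d then 1 else if chord_cw lt c d a b then -1 else 0.

(** * Reduction of order statements to finite checks *)

Fixpoint bounded_seqs (k n : nat) : seq (seq nat) :=
  if k is k'.+1 then
    [seq i :: l | i <- iota 0 n, l <- bounded_seqs k' n]
  else [:: [::]].

Definition seq_lt (s : seq nat) (i j : nat) : bool :=
  if (i < size s)%N && (j < size s)%N then (nth 0%N s i < nth 0%N s j)%N
  else false.

Lemma mem_bounded_seqs n (s : seq nat) :
  all (fun x => (x < n)%N) s -> s \in bounded_seqs (size s) n.
Proof.
elim: s => //= x s IHs /andP[xn sn].
by apply/allpairsP; exists (x, s); rewrite /= mem_iota xn IHs.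
Qed.

(** Each entry is replaced by its rank among the distinct entries, which keeps order and ties.
    Out-of-range indices compare as [false] on both sides, so the two relations are equal as
    functions. *)
Lemma compress_seq (s : seq nat) :
  exists t, [/\ size t = size s, all (fun x => (x < size s)%N) t
              & seq_lt t = seq_lt s].
Proof.
pose rk x := count (fun z => (z < x)%N) (undup s).
have rkS x y : x \in s -> (x < y)%N -> (rk x < rk y)%N.
  move=> xs xy; rewrite /rk -addn1.
  have <- : count_mem x (undup s) = 1%N.
    by rewrite count_uniq_mem ?undup_uniq // mem_undup xs.
  rewrite -count_predUI addnC.
  rewrite (@eq_count _ (predI _ _) pred0); last first.
    by move=> z /=; apply/negbTE; case: eqP => [->|]; rewrite ?ltnn ?andbF.
  rewrite count_pred0 add0n; apply: sub_count => z /= /orP[|/eqP->//].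
  by move=> /ltn_trans; apply.
have rk_ltn x : x \in s -> (rk x < size s)%N.
  move=> xs; apply: leq_trans (size_undup s).
  rewrite -(count_predC (fun z => (z < x)%N) (undup s)) -addn1 leq_add2l -has_count.
  by apply/hasP; exists x; rewrite ?mem_undup //= ltnn.
exists [seq rk x | x <- s]; split; first by rewrite size_map.
  by apply/allP => _ /mapP[x xs ->]; apply: rk_ltn.
apply/funext => i; apply/funext => j; rewrite /seq_lt size_map.
case: ifP => // /andP[li lj]; rewrite !(nth_map 0%N) //.
have [xy|yx|->] := ltngtP (nth 0%N s i) (nth 0%N s j).
- by apply: rkS => //; apply: mem_nth.
- by apply/negbTE; rewrite -leqNgt ltnW // rkS // mem_nth.
- by rewrite ltnn.
Qed.

(* A statement about the relative order of finitely many numbers needs to be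
   checked only on numbers smaller than their count. *)
Lemma order_check (P : rel nat -> bool) (n : nat) :
  all (fun s => P (seq_lt s)) (bounded_seqs n n) ->
  forall s, size s = n -> P (seq_lt s).
Proof.
move=> /allP H s sn; have [t [st tb <-]] := compress_seq s.
by apply: H; rewrite -[in bounded_seqs n]sn -st mem_bounded_seqs ?st // -sn.
Qed.

(** With [s] = 2 this is the form additive modulo 4; with [s] = -2 it gives the pairings of the
    highest monomial. The two differ by 4 exactly on crossing chords. *)
Definition chord_mu (s : int) (T : Type) (lt : rel T) (a b c d : T) : int :=
  chord_lam lt a b c d + (if chord_cross lt a b c d then s else 0).

Definition eq_chord (T : Type) (lt : rel T) (a b c d : T) : bool :=
  (eq_by lt a c && eq_by lt b d) || (eq_by lt a d && eq_by lt b c).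

(* xy is any chord; the last two groups are about the chords that cross no side
   of the triangle p, a, b, and no side of the quadrilateral p, a, r, b. *)
Definition quad_facts (T : Type) (lt : rel T) (p a r b x y : T) : bool :=
  if cyc lt p a r && cyc lt r b p && (lt x y || lt y x) then
    let L := chord_lam lt x y in
    let C := chord_cross lt x y in
    let mu s := chord_mu s lt x y in
    [&& ((mu 2 p r + mu 2 a b - mu 2 b p - mu 2 a r) %% 4 == 0)%Z,
        (C b p + C a r <= C a b + C p r)%N,
        (C p a + C b r <= C a b + C p r)%N,
        (~~ C p a && ~~ C a b && ~~ C b p) ==>
          [&& C a r ==> C p r, C b r ==> C p r,
              mu (-2) p r == L b p - L a b + mu (-2) a r,
              mu 2 p r == L p a - L a b + mu 2 b r
            & eq_chord lt x y a b ==>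
                [&& C p r, L p a == 1, ~~ C b r & L b r == 1]]
      & (~~ C p a && ~~ C a r && ~~ C r b && ~~ C b p) ==>
        [&& C a b ==> eq_chord lt x y p r,
            ~~ C a b && ~~ eq_chord lt x y a b ==> ~~ C p r
          & ~~ C a b ==>
            (L p a + L b r - L a r - L b p ==
              (if eq_chord lt x y a b then 4 else 0))]]
  else true.

Lemma quad_check (p a r b x y : nat) : quad_facts ltn p a r b x y.
Proof.
(* The numerals are positions in the list of the six actual numbers; for that list the fact about
   positions computes to the fact about the numbers, and 6^6 lists of labels remain to be tested. *)
refine (@order_check (fun lt => quad_facts lt 0 1 2 3 4 5)%N 6 _
          [:: p; a; r; b; x; y] erefl).
by vm_compute.
Qed.

(** A chord crossing only the side zb leaves through the vertex a; this is what contradicts the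
    extremal choice of the apex of a triangle. *)
Definition triangle_facts (T : Type) (lt : rel T) (a z b x y : T) : bool :=
  if cyc lt a z b && (lt x y || lt y x) then
    let C := chord_cross lt x y in
    (C z b && ~~ C a b && ~~ C a z) ==>
      (eq_by lt x a && cyc lt z y b) || (eq_by lt y a && cyc lt z x b)
  else true.

Lemma triangle_check (a z b x y : nat) : triangle_facts ltn a z b x y.
Proof.
refine (@order_check (fun lt => triangle_facts lt 0 1 2 3 4)%N 5 _
          [:: a; z; b; x; y] erefl).
by vm_compute.
Qed.

(** The first clause locates the apex of a triangle on ab. The others tabulate crossings and
    [chord_lam] for the sides and diagonals, from which the powers w^2 and w^-2 of the Ptolemy
    relation come. *)
Definition quad_vertex_facts (T : Type) (lt : rel T) (p a r b y : T) : bool :=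
  if cyc lt p a r && cyc lt r b p then
    let N c d := ~~ [|| chord_cross lt c d p a, chord_cross lt c d a r,
                       chord_cross lt c d r b | chord_cross lt c d b p] in
    [&& N y a && N y b ==>
          [|| eq_by lt y p, eq_by lt y a, eq_by lt y r | eq_by lt y b],
        chord_cross lt a b p r,
        ~~ chord_cross lt p a a r, ~~ chord_cross lt p a r b,
        ~~ chord_cross lt p a b p, ~~ chord_cross lt a r r b,
        ~~ chord_cross lt a r b p, ~~ chord_cross lt r b b p,
        chord_lam lt a b b p == -1, chord_lam lt a b a r == -1,
        chord_lam lt a b p a == 1, chord_lam lt a b b r == 1,
        chord_lam lt b p a r == 0, chord_lam lt p a b r == 0
      & N a b]
  else true.

Lemma quad_vertex_check (p a r b y : nat) : quad_vertex_facts ltn p a r b y.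
Proof.
refine (@order_check (fun lt => quad_vertex_facts lt 0 1 2 3 4)%N 5 _
          [:: p; a; r; b; y] erefl).
by vm_compute.
Qed.

Definition pair_facts (T : Type) (lt : rel T) (a b c d : T) : bool :=
  (chord_cross lt a b c d == chord_cross lt c d a b)
  && (chord_lam lt a b c d == - chord_lam lt c d a b).

Lemma pair_check (a b c d : nat) : pair_facts ltn a b c d.
Proof.
refine (@order_check (fun lt => pair_facts lt 0 1 2 3)%N 4 _
          [:: a; b; c; d] erefl).
by vm_compute.
Qed.

Definition cyc_facts (T : Type) (lt : rel T) (a b c d : T) : bool :=
  [&& cyc lt a b c == cyc lt b c a,
      cyc lt a b d && cyc lt b c d ==>
        eq_by lt a c || (cyc lt a c d && cyc lt a b c)
    & cyc lt a b c && cyc lt a b d && ~~ cyc lt a c d ==>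
        eq_by lt c d || cyc lt d c a].

Lemma cyc_check (a b c d : nat) : cyc_facts ltn a b c d.
Proof.
refine (@order_check (fun lt => cyc_facts lt 0 1 2 3)%N 4 _
          [:: a; b; c; d] erefl).
by vm_compute.
Qed.

(** Serves the uniqueness of the fan at p: if chords of two triangulations that both contain all
    chords at p crossed, one of them would cross a chord at p. *)
Definition star_facts (T : Type) (lt : rel T) (p x y z t : T) : bool :=
  let C := chord_cross lt in
  let N e1 e2 v := ~~ eq_by lt v p && C e1 e2 p v in
  C x y z t ==> [|| N x y z, N x y t, N z t x | N z t y].

Lemma star_check (p x y z t : nat) : star_facts ltn p x y z t.
Proof.
refine (@order_check (fun lt => star_facts lt 0 1 2 3 4)%N 5 _
          [:: p; x; y; z; t] erefl).
by vm_compute.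
Qed.

(** * Chords as two-element sets of marked points *)

Section Chords.

Variable m : nat.
Implicit Types (a b c d p r x y z : 'I_m) (e f : {set 'I_m}).

Lemma eq_byE x y : eq_by ltn (x : nat) y = (x == y).
Proof. by rewrite /eq_by -!leqNgt -val_eqE eqn_leq andbC. Qed.

Lemma set2_eq a b c d :
  ([set a; b] == [set c; d]) = ((a == c) && (b == d)) || ((a == d) && (b == c)).
Proof.
apply/eqP/idP => [/setP E|/orP[]/andP[/eqP-> /eqP->] //]; last exact: setUC.
have := E a; have := E b; have := E c; have := E d.
rewrite !inE !eqxx ?orbT /= (eq_sym c a) (eq_sym c b) (eq_sym d a) (eq_sym d b).
by case: (a == c); case: (a == d); case: (b == c); case: (b == d).
Qed.

Lemma eq_chordE a b c d :
  eq_chord ltn (a : nat) b c d = ([set a; b] == [set c; d]).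
Proof. by rewrite set2_eq /eq_chord !eq_byE. Qed.

Lemma cyc_distinct a b c : cyc ltn (a : nat) b c -> [&& a != b, b != c & a != c].
Proof. by rewrite /cyc -!val_eqE /=; lia. Qed.

Lemma cyc_rot a b c : cyc ltn (a : nat) b c = cyc ltn (b : nat) c a.
Proof. by have /and3P[/eqP] := cyc_check a b c c. Qed.

Lemma cyc_asym a b c : cyc ltn (a : nat) b c -> cyc ltn (c : nat) b a = false.
Proof. by rewrite /cyc /=; lia. Qed.

Lemma cyc_trans a b c d : cyc ltn (a : nat) b d -> cyc ltn (b : nat) c d ->
  a != c -> cyc ltn (a : nat) c d /\ cyc ltn (a : nat) b c.
Proof.
move=> h1 h2 /negbTE h3; have /and3P[_ + _] := cyc_check a b c d.
by rewrite h1 h2 eq_byE h3 /= => /andP.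
Qed.

Lemma cyc_total a b c d : cyc ltn (a : nat) b c -> cyc ltn (a : nat) b d ->
  ~~ cyc ltn (a : nat) c d -> c != d -> cyc ltn (d : nat) c a.
Proof.
move=> h1 h2 h3 /negbTE h4; have /and3P[_ _] := cyc_check a b c d.
by rewrite h1 h2 h3 eq_byE h4.
Qed.

(** [crosses] asks for increasing labels, while the cyclic form is blind to where the numbering
    starts; the smallest end decides which chord is listed first. *)
Lemma crossesE a b c d :
  crosses [set a; c] [set b; d] = chord_cross ltn (a : nat) c b d.
Proof.
apply/existsP/idP => [[p /existsP[q /existsP[r /existsP[s]]]]|].
  case/and4P=> pq qr rs; rewrite !set2_eq.
  by move=> /orP[] /andP[/orP[] /andP[/eqP-> /eqP->] /orP[] /andP[/eqP-> /eqP->]];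
    rewrite /chord_cross /cyc; lia.
rewrite /chord_cross /cyc.
have H (p q r s : 'I_m) : (p < q)%N && (q < r)%N && (r < s)%N ->
   ([set a; c] == [set p; r]) && ([set b; d] == [set q; s]) ||
   ([set b; d] == [set p; r]) && ([set a; c] == [set q; s]) ->
  exists x, [exists b0 : 'I_m, exists c0 : 'I_m, exists d0 : 'I_m, [&& (x < b0)%N,
     (b0 < c0)%N, (c0 < d0)%N & ([set a; c] == [set x; c0]) && ([set b; d] == [set b0; d0])
      || ([set b; d] == [set x; c0]) && ([set a; c] == [set b0; d0])]].
  move=> /andP[/andP[h1 h2] h3] h4; exists p; apply/existsP; exists q.
  by apply/existsP; exists r; apply/existsP; exists s; rewrite h1 h2 h3.
have [ac|ca|/val_inj->] := ltngtP a c; have [bd|db|/val_inj->] := ltngtP b d;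
  try lia; move=> h.
- have [ab|ba] := ltnP a b; [apply: (H a b c d)|apply: (H b a d c)];
    rewrite ?set2_eq ?eqxx ?orbT //; lia.
- have [ab|ba] := ltnP a d; [apply: (H a d c b)|apply: (H d a b c)];
    rewrite ?set2_eq ?eqxx ?orbT //; lia.
- have [ab|ba] := ltnP c b; [apply: (H c b a d)|apply: (H b c d a)];
    rewrite ?set2_eq ?eqxx ?orbT //; lia.
- have [ab|ba] := ltnP c d; [apply: (H c d a b)|apply: (H d c b a)];
    rewrite ?set2_eq ?eqxx ?orbT //; lia.
Qed.

Lemma ccw_distE p r :
  ccw_dist p r = if (p <= r)%N then (r - p)%N else (r + m - p)%N.
Proof.
rewrite /ccw_dist; have [pm rm] := (ltn_ord p, ltn_ord r); case: leqP => pr.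
  rewrite (_ : (r + (m - p) = r - p + m)%N); last by lia.
  by rewrite modnDr modn_small //; lia.
by rewrite modn_small; lia.
Qed.

Lemma ccw_dist_lt p r s :
  (0 < ccw_dist p r)%N && (ccw_dist p r < ccw_dist p s)%N = cyc ltn (p : nat) r s.
Proof.
have [[pm rm] sm] := (ltn_ord p, ltn_ord r, ltn_ord s).
rewrite !ccw_distE /cyc /=.
by case: (leqP p r); case: (leqP p s); lia.
Qed.

Lemma clockwise_toE a b c d :
  clockwise_to [set a; b] [set c; d] = chord_cw ltn (a : nat) b c d.
Proof.
rewrite /chord_cw !eq_byE.
apply/existsP/idP => [[p /existsP[r /existsP[s /and4P[+ + h1 h2]]]]|].
  have : cyc ltn (p : nat) r s by rewrite -ccw_dist_lt h1.
  rewrite !set2_eq => h.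
  by move=> /orP[] /andP[/eqP-> /eqP->] /orP[] /andP[/eqP-> /eqP->];
    rewrite h !eqxx ?orbT.
have H (p r s : 'I_m) : cyc ltn (p : nat) r s ->
    ([set a; b] == [set p; r]) && ([set c; d] == [set p; s]) ->
   exists x, [exists r0, exists s0, [&& [set a; b] == [set x; r0],
     [set c; d] == [set x; s0], (0 < ccw_dist x r0)%N & (ccw_dist x r0 < ccw_dist x s0)%N]].
  rewrite -ccw_dist_lt => /andP[h1 h2] /andP[h3 h4]; exists p; apply/existsP.
  by exists r; apply/existsP; exists s; rewrite h1 h2 h3 h4.
case/or4P=> /andP[/eqP E h];
  [apply: (H a b d)|apply: (H a b c)|apply: (H b a d)|apply: (H b a c)];
  by rewrite // !set2_eq E !eqxx ?orbT.
Qed.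

Lemma lamE a b c d :
  lam [set a; b] [set c; d] = chord_lam ltn (a : nat) b c d.
Proof. by rewrite /lam !clockwise_toE. Qed.

Lemma cards2E e : #|e| = 2%N -> exists x y, x != y /\ e = [set x; y].
Proof. by move/eqP/cards2P. Qed.

Lemma crossesC e f : crosses e f = crosses f e.
Proof.
rewrite /crosses; do 4!(apply: eq_existsb => ?).
by rewrite orbC.
Qed.

Lemma crosses_card e f : crosses e f -> #|e| = 2%N /\ #|f| = 2%N.
Proof.
case/existsP=> a /existsP[b /existsP[c /existsP[d /and4P[ab bc cd]]]].
have [ac bd] : a != c /\ b != d by rewrite -!val_eqE /=; lia.
by case/orP=> /andP[/eqP-> /eqP->]; rewrite !cards2 ac bd.
Qed.

Lemma crossesxx e : crosses e e = false.
Proof.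
case h: (crosses e e) => //; move: (h).
have [/cards2E[x [y [_ ->]]] _] := crosses_card h.
by rewrite crossesE /chord_cross /cyc; lia.
Qed.

Lemma lam_anti e f : #|e| = 2%N -> #|f| = 2%N -> lam e f = - lam f e.
Proof.
move=> /cards2E[x [y [_ ->]]] /cards2E[z [t [_ ->]]]; rewrite !lamE.
by have /andP[_ /eqP] := pair_check x y z t.
Qed.

Lemma lamxx e : lam e e = 0.
Proof.
rewrite /lam; case h: (clockwise_to e e) => //; move: h.
case/existsP=> p /existsP[r /existsP[s /and4P[/eqP-> ]]].
by rewrite set2_eq eqxx /= => /orP[/eqP->|/andP[/eqP-> /eqP->]]; rewrite ltnn.
Qed.

Lemma lam_crosses e f : crosses e f -> lam e f = 0.
Proof.
move=> h; move: (h).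
have [/cards2E[a [b [_ ->]]] /cards2E[c [d [_ ->]]]] := crosses_card h.
rewrite crossesE lamE /chord_lam /chord_cw !eq_byE.
by rewrite -!val_eqE /= /chord_cross /cyc => {}h; rewrite !ifF //; lia.
Qed.

End Chords.

(** * Triangulations *)

Definition mu m (s : int) (e f : {set 'I_m}) : int :=
  lam e f + (if crosses e f then s else 0).

Definition xvec m (T : {set {set 'I_m}}) (j : {set 'I_m}) : vec m :=
  \sum_(s in T) basis_vec s *~ eps T j s.

Section QuadFacts.

Variable m : nat.
Implicit Types (a b c d p r x y z : 'I_m) (e f : {set 'I_m}).

(* The vertices p, a, r, b of a quadrilateral in counterclockwise order. *)
Definition quad p a r b : bool := cyc ltn (p : nat) a r && cyc ltn (r : nat) b p.

Lemma quad_facts_edge p a r b e : quad p a r b -> #|e| = 2%N ->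
  let pr := [set p; r] in let ab := [set a; b] in
  let pa := [set p; a] in let ar := [set a; r] in
  let rb := [set r; b] in let br := [set b; r] in let bp := [set b; p] in
  let C := crosses e in let L := lam e in
  [&& ((mu 2 e pr + mu 2 e ab - mu 2 e bp - mu 2 e ar) %% 4 == 0)%Z,
      (C bp + C ar <= C ab + C pr)%N,
      (C pa + C br <= C ab + C pr)%N,
      (~~ C pa && ~~ C ab && ~~ C bp) ==>
        [&& C ar ==> C pr, C br ==> C pr,
            mu (-2) e pr == L bp - L ab + mu (-2) e ar,
            mu 2 e pr == L pa - L ab + mu 2 e br
          & (e == ab) ==> [&& C pr, L pa == 1, ~~ C br & L br == 1]]
    & (~~ C pa && ~~ C ar && ~~ C rb && ~~ C bp) ==>
      [&& C ab ==> (e == pr),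
          ~~ C ab && ~~ (e == ab) ==> ~~ C pr
        & ~~ C ab ==>
          (L pa + L br - L ar - L bp == (if e == ab then 4 else 0))]].
Proof.
case/andP=> h1 h2 /cards2E[x [y [nxy ->]]] /=.
have := quad_check p a r b x y; rewrite /quad_facts h1 h2 -neq_ltn nxy.
by rewrite /chord_mu -!lamE -!crossesE !eq_chordE.
Qed.

Lemma triangle_facts_edge a z b x y : cyc ltn (a : nat) z b -> x != y ->
  crosses [set x; y] [set z; b] -> ~~ crosses [set x; y] [set a; b] ->
  ~~ crosses [set x; y] [set a; z] ->
  (x = a /\ cyc ltn (z : nat) y b) \/ (y = a /\ cyc ltn (z : nat) x b).
Proof.
move=> h nxy; have := triangle_check a z b x y.
rewrite /triangle_facts h -neq_ltn nxy -!crossesE !eq_byE.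
move=> /implyP H h1 h2 h3; move: H; rewrite h1 h2 h3 => /(_ isT).
by case/orP=> /andP[/eqP-> ->]; [left|right].
Qed.

Lemma quad_facts_vertex p a r b y : quad p a r b ->
  let N e := ~~ [|| crosses e [set p; a], crosses e [set a; r],
                    crosses e [set r; b] | crosses e [set b; p]] in
  [&& N [set y; a] && N [set y; b] ==> [|| y == p, y == a, y == r | y == b],
      crosses [set a; b] [set p; r],
      ~~ crosses [set p; a] [set a; r], ~~ crosses [set p; a] [set r; b],
      ~~ crosses [set p; a] [set b; p], ~~ crosses [set a; r] [set r; b],
      ~~ crosses [set a; r] [set b; p], ~~ crosses [set r; b] [set b; p],
      lam [set a; b] [set b; p] == -1, lam [set a; b] [set a; r] == -1,
      lam [set a; b] [set p; a] == 1, lam [set a; b] [set b; r] == 1,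
      lam [set b; p] [set a; r] == 0, lam [set p; a] [set b; r] == 0
    & N [set a; b]].
Proof.
case/andP=> h1 h2 /=.
have := quad_vertex_check p a r b y; rewrite /quad_vertex_facts h1 h2 /=.
by rewrite -!lamE -!crossesE !eq_byE.
Qed.

Lemma quad_distinct p a r b : quad p a r b ->
  [/\ p != a, p != r, p != b & [/\ a != r, a != b & r != b]].
Proof. by rewrite /quad /cyc -!val_eqE /= => h; split; [| | |split]; lia. Qed.

Lemma quad_cyc p a r b : quad p a r b ->
  [/\ cyc ltn (a : nat) r b & cyc ltn (b : nat) p a].
Proof. by rewrite /quad /cyc /= => h; split; lia. Qed.

Lemma ordSE p : (ordS p : nat) = if p.+1 == m then 0%N else p.+1.
Proof.
have pm := ltn_ord p; rewrite /=; case: eqP => [->|h]; first by rewrite modnn.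
by rewrite modn_small //; lia.
Qed.

Lemma cyc_ordS_out p x : cyc ltn (p : nat) x (ordS p) = false.
Proof.
have [pm xm] := (ltn_ord p, ltn_ord x).
have := ordSE p; move: (ordS p) => s; rewrite /cyc /=.
by case: ifP => /eqP; lia.
Qed.

Lemma cyc_ordS p b : b != p -> b != ordS p -> cyc ltn (p : nat) (ordS p) b.
Proof.
have [pm bm] := (ltn_ord p, ltn_ord b).
have := ordSE p; move: (ordS p) => s; rewrite /cyc -!val_eqE /=.
by case: ifP => /eqP; lia.
Qed.

Lemma boundary_ncr e f : boundary_edge e -> crosses e f = false.
Proof.
case/existsP=> p /eqP->; case h: (crosses _ f) => //; move: (h).
have [_ /cards2E[x [y [_ ->]]]] := crosses_card h.
by rewrite crossesE /chord_cross !cyc_ordS_out.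
Qed.

(** [lam] is skew, and a crossing contributes 2 on each side, hence 4 in all. *)
Lemma mu_anti e f : #|e| = 2%N -> #|f| = 2%N ->
  ((mu 2 e f + mu 2 f e) %% 4 = 0)%Z.
Proof.
by move=> ce cf; rewrite /mu (lam_anti cf ce) crossesC; case: ifP => _; lia.
Qed.

End QuadFacts.

(** * Triangles and quadrilaterals of a triangulation *)

Section Triangulation.

Variables (m : nat) (T : {set {set 'I_m}}).
Hypotheses (hm : (2 < m)%N) (hT : ideal_triangulation T).
Implicit Types (a b c d p r x y z : 'I_m) (e f : {set 'I_m}).

Lemma ordS_neq p : ordS p != p.
Proof.
have := ordSE p; move: (ordS p) => s; rewrite -val_eqE /=.
by case: ifP => /eqP; lia.
Qed.

Lemma boundary_card e : boundary_edge e -> #|e| = 2%N.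
Proof. by case/existsP=> p /eqP->; rewrite cards2 eq_sym ordS_neq. Qed.

Lemma noncrossingP (U : {set {set 'I_m}}) :
  reflect ((forall e, e \in U -> #|e| = 2%N) /\
           (forall e f, e \in U -> f \in U -> crosses e f = false))
          (noncrossing U).
Proof.
apply: (iffP andP) => -[h1 h2]; split.
- by move=> e eU; apply/eqP; apply: (forall_inP h1).
- by move=> e f eU fU; apply/negbTE; apply: (forall_inP (forall_inP h2 e eU)).
- by apply/forall_inP => e eU; apply/eqP; apply: h1.
- by apply/forall_inP => e eU; apply/forall_inP => f fU; rewrite h2.
Qed.

Lemma tri_card e : e \in T -> #|e| = 2%N.
Proof. by have /maxsetp/noncrossingP[h _] := hT; apply: h. Qed.

Lemma tri_ncr e f : e \in T -> f \in T -> crosses e f = false.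
Proof. by have /maxsetp/noncrossingP[_ h] := hT; apply: h. Qed.

Lemma tri_max e : #|e| = 2%N -> (forall f, f \in T -> crosses e f = false) ->
  e \in T.
Proof.
move=> ce h; have nT : noncrossing (e |: T).
  apply/noncrossingP; split=> [f|f g]; rewrite !inE.
    by case/orP=> [/eqP->//|]; apply: tri_card.
  case/orP=> [/eqP->|fT] /orP[/eqP->|gT]; rewrite ?crossesxx ?h //.
    by rewrite crossesC h.
  by rewrite tri_ncr.
by rewrite -(maxsetsup hT nT (subsetUr _ _)) setU11.
Qed.

Lemma boundary_tri e : boundary_edge e -> e \in T.
Proof.
by move=> be; apply: tri_max => [|f _]; rewrite ?boundary_card ?boundary_ncr.
Qed.

Lemma triU x y : [set x; y] \in T -> [set y; x] \in T.
Proof. by rewrite setUC. Qed.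

Lemma tri_neq x y : [set x; y] \in T -> x != y.
Proof. by move/tri_card; rewrite cards2; case: (x == y). Qed.

(** Among the edges of T from a that end between a and b, az is the last. An edge of T crossing zb
    avoids ab and az, so it starts at a and ends between z and b, against the choice of z; hence zb
    is in T by maximality. *)
Lemma tri_third a b : [set a; b] \in T -> (exists c, cyc ltn (a : nat) c b) ->
  exists z, [/\ cyc ltn (a : nat) z b, [set a; z] \in T & [set z; b] \in T].
Proof.
move=> abT [c cab].
pose P z := cyc ltn (a : nat) z b && ([set a; z] \in T).
have P0 : P (ordS a).
  rewrite /P boundary_tri ?andbT; last by apply/existsP; exists a.
  have /and3P[_ _ ab] := cyc_distinct cab.
  apply: cyc_ordS; first by rewrite eq_sym.
  by apply: contraTneq cab => ->; rewrite cyc_ordS_out.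
have [z /andP[czb azT] zmax] := @arg_maxnP _ (ordS a) P (fun z => ccw_dist a z) P0.
exists z; split=> //; apply: tri_max => [|f fT].
  by have /and3P[_ zb _] := cyc_distinct czb; rewrite cards2 zb.
apply/negbTE/negP => h; move: fT h.
have [fT|//] := boolP (f \in T).
have /cards2E[x [y [nxy Ef]]] := tri_card fT; rewrite {}Ef in fT *.
rewrite crossesC => _ h.
have nab : ~~ crosses [set x; y] [set a; b] by rewrite tri_ncr.
have naz : ~~ crosses [set x; y] [set a; z] by rewrite tri_ncr.
have contra (w : 'I_m) : cyc ltn (z : nat) w b -> [set a; w] \in T -> False.
  move=> czwb awT; have aw := tri_neq awT.
  have [cawb] := cyc_trans czb czwb aw.
  have := zmax w; rewrite /P cawb awT => /(_ isT) + cazw; move: cazw.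
  by rewrite -ccw_dist_lt => /andP[_]; rewrite /= ltnNge => /negbTE ->.
have [[Ex hy]|[Ey hx]] := triangle_facts_edge czb nxy h nab naz.
  by apply: (contra y) => //; rewrite -Ex.
by apply: (contra x) => //; rewrite -Ey triU.
Qed.

(** Here pa is the last edge of T at p before r, and b is the apex of the triangle on the side of pa
    that contains r. By the choice of a it does not precede r, and it is not r since pr is not in T;
    so ab separates p from r. *)
Lemma tri_cross p r : p != r -> [set p; r] \notin T ->
  exists a b, [/\ quad p a r b, [set p; a] \in T, [set a; b] \in T
                & [set b; p] \in T].
Proof.
move=> pr prT.
pose P z := cyc ltn (p : nat) z r && ([set p; z] \in T).
have bT : [set p; ordS p] \in T by apply: boundary_tri; apply/existsP; exists p.
have P0 : P (ordS p).
  rewrite /P bT andbT; apply: cyc_ordS; first by rewrite eq_sym.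
  by apply: contraNneq prT => ->.
have [a /andP[cpar paT] amax] := @arg_maxnP _ (ordS p) P (fun z => ccw_dist p z) P0.
have apT := triU paT.
have [b [capb abT bpT]] : exists z, [/\ cyc ltn (a : nat) z p, [set a; z] \in T
    & [set z; p] \in T].
  by apply: tri_third => //; exists r; rewrite -cyc_rot.
exists a, b; split=> //; rewrite /quad cpar /=.
have br : b != r by apply: contraNneq prT => <-; apply: triU.
have := amax b; rewrite /P (triU bpT) andbT.
have [cpbr /(_ isT)|ncpbr _] := boolP (cyc ltn (p : nat) b r).
  by move: capb; rewrite -cyc_rot -ccw_dist_lt => /andP[_]; rewrite /= ltnNge => /negbTE ->.
by apply: (@cyc_total _ p a) => //; rewrite cyc_rot.
Qed.

Lemma internal_quad e : e \in internal_edges T ->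
  exists p a r b, [/\ e = [set a; b], quad p a r b &
    [/\ [set p; a] \in T, [set a; r] \in T, [set r; b] \in T
      & [set b; p] \in T]].
Proof.
rewrite inE => /andP[eT ne]; have /cards2E[a [b [nab Ee]]] := tri_card eT.
rewrite {}Ee in eT ne *.
have side x y : x != y -> ~~ boundary_edge [set x; y] ->
    exists c, cyc ltn (x : nat) c y.
  move=> nxy nb; exists (ordS x); apply: cyc_ordS; first by rewrite eq_sym.
  by apply: contraNneq nb => ->; apply/existsP; exists x.
have [r [c1 arT rbT]] := tri_third eT (side _ _ nab ne).
have [p [c2 bpT paT]] : exists z, [/\ cyc ltn (b : nat) z a,
    [set b; z] \in T & [set z; a] \in T].
  apply: tri_third (triU eT) _; apply: side; first by rewrite eq_sym.
  by rewrite setUC.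
exists p, a, r, b; split=> //.
have pr : p != r.
  by apply: contraTneq c1 => <-; rewrite (cyc_asym c2).
have c2' : cyc ltn (p : nat) a b by rewrite -cyc_rot.
have [c3 c4] := cyc_trans c2' c1 pr; rewrite /quad c4.
by rewrite -cyc_rot.
Qed.

End Triangulation.

(** * The form Lambda and the exponent vectors of the X's *)

Section Lattice.

Variables (m : nat) (T : {set {set 'I_m}}).
Implicit Types (u v w : vec m) (e f i j s : {set 'I_m}).

Lemma vecMz u (n : int) e : (u *~ n) e = u e * n.
Proof.
have E k : (u *+ k) e = u e * k%:Z by rewrite ffunMnE -mulr_natr natz.
by case: n => n; rewrite ?NegzE ?mulrNz -?pmulrn ?ffunE E // mulrN.
Qed.

Lemma vecD u v e : (u + v) e = u e + v e.
Proof. by rewrite ffunE. Qed.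

Lemma vecN u e : (- u) e = - u e.
Proof. by rewrite ffunE. Qed.

Definition vecE := (vecD, vecN, vecMz).

Lemma basis_vecE i j : basis_vec i j = (i == j)%:Z.
Proof. by rewrite ffunE. Qed.

Lemma supported0 : supported T (0 : vec m).
Proof. by move=> i _; rewrite ffunE. Qed.

Lemma supportedD u v : supported T u -> supported T v -> supported T (u + v).
Proof. by move=> hu hv i iT; rewrite ffunE hu ?hv ?addr0. Qed.

Lemma supportedN u : supported T u -> supported T (- u).
Proof. by move=> hu i iT; rewrite ffunE hu ?oppr0. Qed.

Lemma supportedMz u n : supported T u -> supported T (u *~ n).
Proof. by move=> hu i iT; rewrite vecMz hu ?mul0r. Qed.

Lemma supported_basis i : i \in T -> supported T (basis_vec i).
Proof. by move=> iT j; rewrite basis_vecE; case: eqP => // <-; rewrite iT. Qed.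

Lemma supported_sum (I : Type) (r : seq I) (P : pred I) (G : I -> vec m) :
  (forall k, P k -> supported T (G k)) -> supported T (\sum_(k <- r | P k) G k).
Proof.
move=> h; apply: big_ind => //; [exact: supported0|exact: supportedD].
Qed.

Lemma vec_basis v : supported T v -> v = \sum_(e in T) basis_vec e *~ v e.
Proof.
move=> hv; apply/ffunP => s; rewrite sum_ffunE.
under eq_bigr => e _ do rewrite vecMz basis_vecE.
have [sT|sT] := boolP (s \in T).
  rewrite (bigD1 s) //= eqxx mul1r big1 ?addr0 // => e /andP[_ /negbTE->].
  by rewrite mul0r.
rewrite hv // big1 // => e eT; case: eqP => [E|]; rewrite ?mul0r //.
by rewrite -E eT in sT.
Qed.

Lemma LamDl u v w : Lam T (u + v) w = Lam T u w + Lam T v w.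
Proof.
rewrite -big_split; apply: eq_bigr => i _; rewrite -big_split.
by apply: eq_bigr => j _; rewrite ffunE !mulrDl.
Qed.

Lemma LamDr u v w : Lam T w (u + v) = Lam T w u + Lam T w v.
Proof.
rewrite -big_split; apply: eq_bigr => i _; rewrite -big_split.
by apply: eq_bigr => j _; rewrite ffunE mulrDr !mulrDl.
Qed.

Lemma LamNl u w : Lam T (- u) w = - Lam T u w.
Proof.
rewrite -sumrN; apply: eq_bigr => i _; rewrite -sumrN.
by apply: eq_bigr => j _; rewrite ffunE !mulNr.
Qed.

Lemma LamNr u w : Lam T w (- u) = - Lam T w u.
Proof.
rewrite -sumrN; apply: eq_bigr => i _; rewrite -sumrN.
by apply: eq_bigr => j _; rewrite ffunE mulrN !mulNr.
Qed.

Lemma Lam0l w : Lam T 0 w = 0.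
Proof. by have := LamDl 0 0 w; rewrite addr0; lia. Qed.

Lemma Lam0r w : Lam T w 0 = 0.
Proof. by have := LamDr 0 0 w; rewrite addr0; lia. Qed.

Lemma LamMzl u w n : Lam T (u *~ n) w = Lam T u w * n.
Proof.
rewrite mulr_suml; apply: eq_bigr => i _; rewrite mulr_suml.
by apply: eq_bigr => j _; rewrite vecMz; ring.
Qed.

Lemma LamMzr u w n : Lam T w (u *~ n) = Lam T w u * n.
Proof.
rewrite mulr_suml; apply: eq_bigr => i _; rewrite mulr_suml.
by apply: eq_bigr => j _; rewrite vecMz; ring.
Qed.

Lemma Lam_suml (I : Type) (r : seq I) (P : pred I) (G : I -> vec m) w :
  Lam T (\sum_(k <- r | P k) G k) w = \sum_(k <- r | P k) Lam T (G k) w.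
Proof. by apply: (big_morph (Lam T ^~ w)) => [u v|]; rewrite ?LamDl ?Lam0l. Qed.

Lemma Lam_sumr (I : Type) (r : seq I) (P : pred I) (G : I -> vec m) w :
  Lam T w (\sum_(k <- r | P k) G k) = \sum_(k <- r | P k) Lam T w (G k).
Proof. by apply: (big_morph (Lam T w)) => [u v|]; rewrite ?LamDr ?Lam0r. Qed.

Lemma Lam_basis i j : i \in T -> j \in T ->
  Lam T (basis_vec i) (basis_vec j) = lam i j.
Proof.
move=> iT jT; rewrite /Lam (bigD1 i) //= (bigD1 j) //= !basis_vecE !eqxx !mul1r.
rewrite !big1 ?addr0 // => [k /andP[_ /negbTE ki]|k /andP[_ /negbTE ki]].
  by rewrite big1 // => l _; rewrite basis_vecE eq_sym ki !mul0r.
by rewrite basis_vecE eq_sym ki mulr0 mul0r.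
Qed.

Hypotheses (hm : (2 < m)%N) (hT : ideal_triangulation T).

Lemma Lam_anti u v : Lam T u v = - Lam T v u.
Proof.
rewrite /Lam exchange_big /= -sumrN; apply: eq_bigr => i iT; rewrite -sumrN.
apply: eq_bigr => j jT; rewrite (lam_anti (tri_card hT jT) (tri_card hT iT)).
by ring.
Qed.

Lemma Lam_self u : Lam T u u = 0.
Proof. by apply/eqP; rewrite -eqNr -Lam_anti. Qed.

(** Two distinct edges lie in at most one three-element set, their union, so the sum over triangles
    has at most one term; for equal edges every term vanishes. *)
Lemma eps_lam e f : #|e| = 2%N -> #|f| = 2%N ->
  eps T e f = if f :|: e \in triangles T then lam f e else 0.
Proof.
move=> ce cf; rewrite /eps -/(lam _ _).
have [->|nef] := eqVneq e f.
  by rewrite lamxx if_same big1.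
have c3 : (2 < #|f :|: e|)%N.
  rewrite -ce ltn_neqAle subset_leq_card ?subsetUr // andbT.
  apply: contra nef => /eqP E; have /eqP Ee : e == f :|: e by rewrite eqEcard subsetUr E leqnn.
  by rewrite eq_sym eqEcard ce cf leqnn andbT Ee subsetUl.
have tE t : t \in triangles T -> e \subset t -> f \subset t -> t = f :|: e.
  rewrite inE => /andP[/eqP c _] se sf; apply/esym/eqP; rewrite eqEcard c c3 andbT.
  by rewrite subUset sf se.
case: ifP => h; last first.
  by apply: big1 => t /and3P[tT se sf]; rewrite -(tE t) ?tT in h.
rewrite (big_pred1 (f :|: e)) // => t; apply/and3P/eqP => [[tT se sf]|->]; first exact: tE.
by rewrite subsetUl subsetUr.
Qed.

Lemma lam_share e f : lam e f != 0 ->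
  exists p r t, [/\ e = [set p; r], f = [set p; t] & r != t].
Proof.
have H i j : clockwise_to i j -> exists p r t, [/\ i = [set p; r], j = [set p; t] & r != t].
  case/existsP=> p /existsP[r /existsP[s /and4P[/eqP-> /eqP-> _ h]]].
  by exists p, r, s; split=> //; apply: contraTneq h => ->; rewrite ltnn.
rewrite /lam; case: ifP => [/H//|_]; case: ifP => // /H[p [r [s [-> -> rs]]]] _.
by exists p, s, r; rewrite eq_sym.
Qed.

Lemma xvecE e s : xvec T e s = if s \in T then eps T e s else 0.
Proof.
rewrite /xvec sum_ffunE; case: ifP => sT.
  rewrite (bigD1 s) //= vecMz basis_vecE eqxx mul1r big1 ?addr0 // => j /andP[_].
  by move=> /negbTE js; rewrite vecMz basis_vecE js mul0r.
apply: big1 => j jT; rewrite vecMz basis_vecE; case: eqP => [E|]; last by rewrite mul0r.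
by rewrite -E jT in sT.
Qed.

Lemma supported_xvec e : supported T (xvec T e).
Proof. by move=> i /negbTE h; rewrite xvecE h. Qed.

Lemma tri_in_triangles (a b c : 'I_m) : a != b -> b != c -> a != c ->
  [set a; b] \in T -> [set b; c] \in T -> [set a; c] \in T ->
  [set a; b] :|: [set b; c] \in triangles T.
Proof.
move=> ab bc ac h1 h2 h3.
have E : [set a; b] :|: [set b; c] = [set a; b; c].
  by apply/setP=> x; rewrite !inE; case: (x == a); case: (x == b).
rewrite E inE; apply/andP; split.
  by rewrite setUC cardsU1 !inE ![c == _]eq_sym negb_or ac bc cards2 ab.
apply/forallP => e; apply/implyP => /andP[/subsetP se /eqP /cards2E[x [y [nxy Ee]]]].
have := se x; have := se y; rewrite Ee !inE !eqxx ?orbT => /(_ isT) + /(_ isT).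
move: nxy => + /orP[/orP[]|] /eqP Ey /orP[/orP[]|] /eqP Ex;
  by rewrite Ex Ey ?eqxx // setUC.
Qed.

Lemma quad_sides (p a r b : 'I_m) : quad p a r b ->
  [/\ [set a; r] != [set b; p], [set a; r] != [set p; a], [set a; r] != [set b; r]
    & [/\ [set b; p] != [set p; a], [set b; p] != [set b; r]
        & [set p; a] != [set b; r]]].
Proof.
move=> /quad_distinct[h1 h2 h3 [h4 h5 h6]].
have F (x y : 'I_m) : x != y -> ((x == y) = false) * ((y == x) = false).
  by move=> /negbTE h; rewrite h eq_sym h.
rewrite !set2_eq ?(F _ _ h1) ?(F _ _ h2) ?(F _ _ h3) ?(F _ _ h4).
by rewrite ?(F _ _ h5) ?(F _ _ h6) ?andbF.
Qed.

(** An edge s with a nonzero entry spans a triangle with ab. The apex is joined to a and b by edges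
    crossing no side of the quadrilateral, so it is p or r and s is a side. *)
Lemma eps_quad (p a r b : 'I_m) : quad p a r b ->
  [set a; b] \in T -> [set p; a] \in T -> [set a; r] \in T ->
  [set r; b] \in T -> [set b; p] \in T ->
  forall s, s \in T -> eps T [set a; b] s =
    (s == [set a; r])%:Z + (s == [set b; p])%:Z
    - (s == [set p; a])%:Z - (s == [set b; r])%:Z.
Proof.
move=> hq abT paT arT rbT bpT s sT.
have [q1 q2 q3 [q4 q5 q6]] := quad_sides hq.
have [npa npr npb [nar nab nrb]] := quad_distinct hq.
have := quad_facts_vertex p hq; rewrite /= => /and5P[_ _ _ _ /and5P[_ _ _ _]].
case/and5P=> /eqP l1 /eqP l2 /eqP l3 /eqP l4 _.
have brT := triU rbT.
have cab := tri_card hT abT.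
have lE f : f \in T -> lam f [set a; b] = - lam [set a; b] f.
  by move=> fT; rewrite lam_anti // (tri_card hT fT).
rewrite eps_lam ?(tri_card hT) //.
have [->|n1] := eqVneq s [set a; r].
  rewrite (negbTE q1) (negbTE q2) (negbTE q3) lE // l2 [[set a; r]]setUC.
  by rewrite tri_in_triangles // 1?eq_sym // setUC.
have [->|n2] := eqVneq s [set b; p].
  rewrite (negbTE q4) (negbTE q5) lE // l1 setUC.
  by rewrite tri_in_triangles // 1?eq_sym // setUC.
have [->|n3] := eqVneq s [set p; a].
  rewrite (negbTE q6) lE // l3.
  by rewrite tri_in_triangles // 1?eq_sym // setUC.
have [->|n4] := eqVneq s [set b; r].
  rewrite lE // l4 setUC.
  by rewrite tri_in_triangles // 1?eq_sym // setUC.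
have -> : (0%:Z + 0%:Z - 0%:Z - 0%:Z = 0) by [].
case: ifP => // tr; apply/eqP; apply/negPn/negP => /lam_share[x [y [z [Es Eab yz]]]].
have N (c : 'I_m) : [set c; a] \in T -> [set c; b] \in T ->
    [|| c == p, c == a, c == r | c == b].
  move=> h1 h2; have := quad_facts_vertex c hq; rewrite /= => /andP[+ _].
  by rewrite !(tri_ncr hT).
have {tr} yzT : y != x -> [set y; z] \in T.
  move: tr; rewrite inE => /andP[_ /forall_inP tr] yx; apply: tr.
  rewrite Es Eab cards2 yz andbT; apply/subsetP => t; rewrite !inE.
  by case/orP=> /eqP->; rewrite eqxx ?orbT.
have yx : y != x by have := tri_card hT sT; rewrite Es cards2 eq_sym; case: (y == x).
move/eqP: Eab; rewrite set2_eq => /orP[] /andP[/eqP Ea /eqP Eb]; subst.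
  have := N y; rewrite triU // yzT // => /(_ isT isT) /or4P[] /eqP E; subst y.
  - by rewrite setUC eqxx in n3.
  - by rewrite eqxx in yx.
  - by rewrite eqxx in n1.
  - by rewrite eqxx in yz.
have := N y; rewrite yzT // triU // => /(_ isT isT) /or4P[] /eqP E; subst y.
- by rewrite eqxx in n2.
- by rewrite eqxx in yz.
- by rewrite eqxx in n4.
- by rewrite eqxx in yx.
Qed.

Lemma xvec_quad (p a r b : 'I_m) : quad p a r b ->
  [set a; b] \in T -> [set p; a] \in T -> [set a; r] \in T ->
  [set r; b] \in T -> [set b; p] \in T ->
  xvec T [set a; b] = basis_vec [set a; r] + basis_vec [set b; p]
    - basis_vec [set p; a] - basis_vec [set b; r].
Proof.
move=> hq abT paT arT rbT bpT; apply/ffunP => s; rewrite xvecE !ffunE.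
case: ifP => sT; first by rewrite (eps_quad hq) // ![s == _]eq_sym.
have brT := triU rbT.
have n f : f \in T -> (f == s) = false by move=> fT; apply: contraFF sT => /eqP<-.
by rewrite !n.
Qed.

(** The compatibility of Lambda with the exchange matrix, as in a quantum cluster seed. The exponent
    vector of X_j is the alternating sum of the sides of the quadrilateral around j, for which the
    chord facts give the value 4 or 0. *)
Lemma Lam_xvec_basis j s : j \in internal_edges T -> s \in T ->
  Lam T (xvec T j) (basis_vec s) = if s == j then 4 else 0.
Proof.
move=> jI sT; have [p [a [r [b [Ej hq [paT arT rbT bpT]]]]]] := internal_quad hm hT jI.
have jT : j \in T by move: jI; rewrite inE => /andP[].
rewrite {}Ej in jT *; have brT := triU rbT.
rewrite (xvec_quad hq) // !(LamDl, LamNl) !Lam_basis //.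
have := quad_facts_edge hq (tri_card hT sT); rewrite /= => /and5P[_ _ _ _].
have N := tri_ncr hT sT.
rewrite (N _ paT) (N _ arT) (N _ rbT) (N _ bpT) (N _ jT) /= => /andP[_ /eqP <-].
rewrite !(lam_anti _ (tri_card hT sT)) ?(tri_card hT) //; lia.
Qed.

Lemma Lam_xvec j v : j \in internal_edges T -> supported T v ->
  Lam T (xvec T j) v = 4 * v j.
Proof.
move=> jI /vec_basis Ev; rewrite {1}Ev Lam_sumr (bigD1 j) /=; last first.
  by move: jI; rewrite inE => /andP[].
rewrite LamMzr Lam_xvec_basis ?eqxx //; last by move: jI; rewrite inE => /andP[].
rewrite big1 ?addr0 // => i /andP[iT /negbTE nij].
by rewrite LamMzr Lam_xvec_basis ?nij ?mul0r.
Qed.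

Lemma Lam_xvec_xvec i j : i \in internal_edges T -> j \in internal_edges T ->
  Lam T (xvec T i) (xvec T j) = - (4 * eps T i j).
Proof.
move=> iI jI; rewrite Lam_anti Lam_xvec //; last exact: supported_xvec.
by move: jI; rewrite inE xvecE => /andP[-> _].
Qed.

End Lattice.

(** The weight of a monomial under rescaling of the vector at p; the Ptolemy relations are
    homogeneous for it. *)
Definition vdeg m (v : vec m) (p : 'I_m) : int := \sum_(e : {set 'I_m} | p \in e) v e.

(** * Vectors of degree zero are exponents of monomials in the X's *)

Section Span.

Variables (m : nat) (T : {set {set 'I_m}}).
Hypotheses (hm : (2 < m)%N) (hT : ideal_triangulation T).
Implicit Types (v : vec m) (e : {set 'I_m}) (p a r q x y : 'I_m).

Lemma vdegD u v p : vdeg (u + v) p = vdeg u p + vdeg v p.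
Proof. by rewrite -big_split; apply: eq_bigr => e _; rewrite ffunE. Qed.

Lemma vdegN v p : vdeg (- v) p = - vdeg v p.
Proof. by rewrite -sumrN; apply: eq_bigr => e _; rewrite ffunE. Qed.

Lemma vdeg0 p : vdeg 0 p = 0.
Proof. by rewrite /vdeg big1 // => e _; rewrite ffunE. Qed.

Lemma vdegMz v n p : vdeg (v *~ n) p = vdeg v p * n.
Proof. by rewrite mulr_suml; apply: eq_bigr => e _; rewrite vecMz. Qed.

Lemma vdeg_basis e p : vdeg (basis_vec e) p = (p \in e)%:Z.
Proof.
rewrite /vdeg; under eq_bigr => f _ do rewrite basis_vecE.
have [pe|/negP pe] := boolP (p \in e).
  rewrite (bigD1 e) //= eqxx big1 ?addr0 // => f /andP[_].
  by rewrite eq_sym => /negbTE->.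
by rewrite big1 // => f pf; case: eqP => // E; rewrite E in pe.
Qed.

Definition xspan v : Prop :=
  exists b : vec m, v = \sum_(j in internal_edges T) xvec T j *~ b j.

Lemma xspan0 : xspan 0.
Proof. by exists 0; rewrite big1 // => j _; rewrite ffunE mulr0z. Qed.

Lemma xspanD u v : xspan u -> xspan v -> xspan (u + v).
Proof.
move=> [b ->] [c ->]; exists (b + c); rewrite -big_split; apply: eq_bigr => j _.
by rewrite ffunE mulrzDr.
Qed.

Lemma xspanMz v n : xspan v -> xspan (v *~ n).
Proof.
move=> [b ->]; exists (b *~ n); rewrite mulrz_suml; apply: eq_bigr => j _.
by rewrite vecMz mulrzA.
Qed.

Lemma xspan_xvec j : j \in internal_edges T -> xspan (xvec T j).
Proof.
move=> jI; exists (basis_vec j); rewrite (bigD1 j) //= basis_vecE eqxx mulr1z.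
rewrite big1 ?addr0 // => i /andP[_ ij].
by rewrite basis_vecE eq_sym (negbTE ij) mulr0z.
Qed.

Lemma vdeg_xvec j p : j \in internal_edges T -> vdeg (xvec T j) p = 0.
Proof.
move=> jI; have [a [b [c [d [Ej hq [h1 h2 h3 h4]]]]]] := internal_quad hm hT jI.
have jT : j \in T by move: jI; rewrite inE => /andP[].
rewrite {}Ej in jT *.
rewrite (xvec_quad hT hq) // !(vdegD, vdegN, vdeg_basis) !inE.
have [k1 k2 k3 [k4 k5 k6]] := quad_distinct hq.
have F x y : x != y -> ~~ ((p == x) && (p == y)).
  by move=> xy; apply: contra xy => /andP[/eqP<- /eqP<-].
move: (F _ _ k1) (F _ _ k2) (F _ _ k3) (F _ _ k4) (F _ _ k5) (F _ _ k6).
by case: (p == a); case: (p == b); case: (p == c); case: (p == d).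
Qed.

Lemma vdeg_xspan v p : xspan v -> vdeg v p = 0.
Proof.
move=> [b ->]; elim/big_ind: _ => [|u w Hu Hw|j jI]; first exact: vdeg0.
  by rewrite vdegD Hu Hw.
by rewrite vdegMz vdeg_xvec // mul0r.
Qed.

Lemma two_sided_internal x y (c d : 'I_m) : [set x; y] \in T ->
  cyc ltn (x : nat) c y -> cyc ltn (y : nat) d x ->
  [set x; y] \in internal_edges T.
Proof.
move=> xyT h1 h2; rewrite inE xyT /=; apply/negP => /existsP[z].
rewrite set2_eq => /orP[] /andP[/eqP Ex /eqP Ey]; subst.
  by rewrite cyc_ordS_out in h1.
by rewrite cyc_ordS_out in h2.
Qed.

(** An edge pr cuts off the polygon on p, ..., r, which the triangle at pr splits into those cut off
    by pa and ar; the length r - p decreases. *)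
Lemma tri_interval_ind (Q : 'I_m -> 'I_m -> Prop) :
  (forall p r, [set p; r] \in T -> (r = p.+1 :> nat) -> Q p r) ->
  (forall p a r, (p < a)%N -> (a < r)%N -> [set p; a] \in T ->
     [set a; r] \in T -> [set p; r] \in T -> Q p a -> Q a r -> Q p r) ->
  forall p r, (p < r)%N -> [set p; r] \in T -> Q p r.
Proof.
move=> h1 h2 p r; move: {2}(r - p)%N (leqnn (r - p)) => n.
elim: n p r => [|n IHn] p r; first by lia.
move=> hn pr prT; have [E|nE] := eqVneq (r : nat) p.+1; first exact: h1.
have lpm : (p.+1 < m)%N by have := ltn_ord r; lia.
have [a [cpar paT arT]] : exists a, [/\ cyc ltn (p : nat) a r,
    [set p; a] \in T & [set a; r] \in T].
  by apply: tri_third => //; exists (Ordinal lpm); rewrite /cyc /=; lia.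
have [pa ar] : (p < a)%N /\ (a < r)%N by move: cpar; rewrite /cyc /=; lia.
by apply: (h2 p a r) => //; apply: IHn => //; lia.
Qed.

Definition inside p r e : bool := [forall x in e, (p <= x <= r)%N].

Lemma inside2 p r x y :
  inside p r [set x; y] = (p <= x <= r)%N && (p <= y <= r)%N.
Proof.
apply/forall_inP/andP => [h|[hx hy] z]; first by rewrite !h // !inE eqxx ?orbT.
by rewrite !inE => /orP[] /eqP->.
Qed.

Lemma inside_cases p a r e : (p < a)%N -> (a < r)%N -> [set p; a] \in T ->
  [set a; r] \in T -> e \in T -> inside p r e ->
  [|| e == [set p; r], inside p a e | inside a r e].
Proof.
move=> pa ar paT arT eT; have /cards2E[x [y [nxy Ee]]] := tri_card hT eT.
have := tri_ncr hT eT paT; have := tri_ncr hT eT arT.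
rewrite {}Ee !crossesE !inside2 set2_eq -!val_eqE /chord_cross /cyc /=.
by move: nxy; rewrite -val_eqE /=; lia.
Qed.

(** Modulo the X-exponents, a vector on the polygon cut off by pr leaves only pr and the difference
    pq - qr, where q is the apex on the far side of pr. The form reproduces itself because the
    X-exponent of pr carries pa - ar across pr to pq - qr. *)
Definition interval_span p r : Prop :=
  forall v, supported T v -> (forall e, v e != 0 -> inside p r e) ->
    (forall x, (p < x < r)%N -> vdeg v x = 0) ->
  forall q, ~~ (p <= q <= r)%N -> [set p; q] \in T -> [set q; r] \in T ->
  exists c t, xspan (v - basis_vec [set p; r] *~ c
                     - (basis_vec [set p; q] - basis_vec [set q; r]) *~ t).

(** The two smaller polygons leave multiples of pa, ar and pr; the vanishing degree at their common
    vertex a makes the coefficients of pa and ar opposite. *)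
Lemma interval_step p a r v :
  (p < a)%N -> (a < r)%N -> [set p; a] \in T ->
  [set a; r] \in T -> [set p; r] \in T ->
  interval_span p a -> interval_span a r ->
  supported T v -> (forall e, v e != 0 -> inside p r e) ->
  (forall x, (p < x < r)%N -> vdeg v x = 0) ->
  exists c t, xspan (v - basis_vec [set p; r] *~ c
                     - (basis_vec [set p; a] - basis_vec [set a; r]) *~ t).
Proof.
move=> pa ar paT arT prT Qpa Qar vT vpr vdeg_v.
pose part x y : vec m := [ffun e => if inside x y e then v e else 0].
have partT x y : supported T (part x y).
  by move=> e eT; rewrite ffunE vT // if_same.
have part_in x y e : part x y e != 0 -> inside x y e.
  by rewrite ffunE; case: ifP; rewrite ?eqxx.
have caseE e : v e != 0 -> [|| e == [set p; r], inside p a e | inside a r e].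
  move=> ve; apply: inside_cases => //; last exact: vpr.
  by apply: contraR ve => /vT->.
have nboth e : v e != 0 -> inside p a e -> inside a r e -> False.
  move=> ve; have eT : e \in T by apply: contraR ve => /vT->.
  have /cards2E[x [y [nxy ->]]] := tri_card hT eT.
  by rewrite !inside2; move: nxy; rewrite -val_eqE /=; lia.
have Ev : v = basis_vec [set p; r] *~ v [set p; r] + part p a + part a r.
  apply/ffunP => e; rewrite !ffunE vecMz basis_vecE eq_sym.
  have [->|ne] := eqVneq e [set p; r].
    by rewrite !inside2 !ifF ?addr0 ?mul1r //; lia.
  rewrite mul0r add0r; have [->|ve] := eqVneq (v e) 0; first by rewrite !if_same.
  have := caseE e ve; rewrite (negbTE ne) /=; have := nboth e ve.
  by case: ifP => _; case: ifP => _ //; rewrite ?addr0 ?add0r // => /(_ isT isT).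
have deg_pa x : (p < x < a)%N -> vdeg (part p a) x = 0.
  move=> hx; rewrite -(vdeg_v x); last by lia.
  apply: eq_bigr => e xe; rewrite ffunE; case: ifP => // nin.
  have [//|ve] := eqVneq (v e) 0; have := caseE e ve; rewrite nin /=.
  case/orP=> [/eqP E|/forall_inP/(_ x xe)]; last by lia.
  by move: xe; rewrite E !inE -!val_eqE /=; lia.
have deg_ar x : (a < x < r)%N -> vdeg (part a r) x = 0.
  move=> hx; rewrite -(vdeg_v x); last by lia.
  apply: eq_bigr => e xe; rewrite ffunE; case: ifP => // nin.
  have [//|ve] := eqVneq (v e) 0; have := caseE e ve; rewrite nin orbF.
  case/orP=> [/eqP E|/forall_inP/(_ x xe)]; last by lia.
  by move: xe; rewrite E !inE -!val_eqE /=; lia.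
have [c1 [t1 S1]] : exists c t, xspan (part p a - basis_vec [set p; a] *~ c
                     - (basis_vec [set p; r] - basis_vec [set r; a]) *~ t).
  by apply: Qpa => //; [exact: part_in|lia|exact: triU].
have [c2 [t2 S2]] : exists c t, xspan (part a r - basis_vec [set a; r] *~ c
                     - (basis_vec [set a; p] - basis_vec [set p; r]) *~ t).
  by apply: Qar => //; [exact: part_in|lia|exact: triU].
have S := xspanD S1 S2; rewrite ![[set a; p]]setUC ![[set r; a]]setUC in S.
have dS := vdeg_xspan a S.
have d0 := vdeg_v a; rewrite pa ar in d0; move/(_ isT): d0.
rewrite Ev !vdegD !vdegMz !vdeg_basis.
move: dS; rewrite !(vdegD, vdegN, vdegMz, vdeg_basis) !inE eqxx orbT /=.
rewrite (_ : (a == p) = false); last by rewrite -val_eqE /=; lia.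
rewrite (_ : (a == r) = false); last by rewrite -val_eqE /=; lia.
move=> /= dS d0; have Ec : c1 + t2 + c2 - t1 = 0 by lia.
exists (v [set p; r] + t1 - t2), (c1 + t2); move: S; congr (xspan _).
apply/ffunP => e; rewrite [v in RHS]Ev !vecE.
have -> : c2 = t1 - c1 - t2; first by lia.
by ring.
Qed.

Lemma interval_spanP p r : (p < r)%N -> [set p; r] \in T -> interval_span p r.
Proof.
apply: tri_interval_ind => {p r} [p r prT E|p a r pa ar paT arT prT Qpa Qar].
  move=> v vT vpr _ q _ _ _; exists (v [set p; r]), 0; rewrite mulr0z subr0.
  suff -> : v = basis_vec [set p; r] *~ v [set p; r].
    by rewrite vecMz basis_vecE eqxx mul1r subrr; exact: xspan0.
  apply/ffunP => e; rewrite vecMz basis_vecE; case: eqP => [<-|ne]; first by rewrite mul1r.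
  rewrite mul0r; apply/eqP/negPn/negP => ve; apply: ne.
  have eT : e \in T by apply: contraR ve => /vT->.
  have := vpr e ve; have /cards2E[x [y [nxy ->]]] := tri_card hT eT.
  rewrite inside2 => h; apply/eqP; rewrite set2_eq -!val_eqE /=.
  by move: nxy; rewrite -val_eqE /=; lia.
move=> v vT vpr vd q hq pqT qrT.
have [c [t S]] := interval_step pa ar paT arT prT Qpa Qar vT vpr vd.
have rpT := triU prT.
have qd : quad a r q p by rewrite /quad /cyc /=; lia.
have rpI : [set r; p] \in internal_edges T.
  by apply: (two_sided_internal (c := q) (d := a)); rewrite // /cyc /=; lia.
exists c, t; have := xspanD S (xspanMz t (xspan_xvec rpI)); congr (xspan _).
rewrite (xvec_quad hT qd) //; try exact: triU.
rewrite (setUC [set r] [set q]).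
move: (basis_vec _) (basis_vec _) (basis_vec _) (basis_vec _) (basis_vec _).
by move=> B1 B2 B3 B4 B5; apply/ffunP => e; rewrite !vecE; ring.
Qed.

(** The disk itself is the polygon cut off by the boundary edge from 0 to m - 1. The remainder c pr
    + t (pa - ar) has degree c + t at p and c - t at r, so c = t = 0. All steps are over the
    integers, as the exponents require. *)
Lemma vdeg0_xspan v : supported T v -> (forall x, vdeg v x = 0) -> xspan v.
Proof.
move=> vT vd.
have m0 : (0 < m)%N by lia.
have m1 : (m.-1 < m)%N by lia.
pose p := Ordinal m0; pose r := Ordinal m1.
have prT : [set p; r] \in T.
  apply: boundary_tri => //; apply/existsP; exists r; rewrite setUC.
  apply/eqP; congr [set _; _]; apply/val_inj.
  by rewrite [RHS]ordSE /= (_ : m.-1.+1 == m) //; apply/eqP; lia.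
have m2 : (1 < m)%N by lia.
have [a [cpar paT arT]] : exists a, [/\ cyc ltn (p : nat) a r,
    [set p; a] \in T & [set a; r] \in T].
  by apply: tri_third => //; exists (Ordinal m2); rewrite /cyc /=; lia.
have [pa ar] : (p < a)%N /\ (a < r)%N by move: cpar; rewrite /cyc /=; lia.
have [||c [t S]] := interval_step pa ar paT arT prT (interval_spanP pa paT)
  (interval_spanP ar arT) vT.
- move=> e ve; have eT : e \in T by apply: contraR ve => /vT->.
  by apply/forall_inP => x _ /=; have := ltn_ord x; lia.
- by move=> x _; apply: vd.
have dp := vdeg_xspan p S; have dr := vdeg_xspan r S; move: dp dr.
rewrite !(vdegD, vdegN, vdegMz, vdeg_basis) !vd !inE !eqxx ?orbT /=.
have -> : (p == a) = false by rewrite -val_eqE /=; lia.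
have -> : (p == r) = false by rewrite -val_eqE /=; lia.
have -> : (r == p) = false by rewrite -val_eqE /=; lia.
have -> : (r == a) = false by apply/eqP => E; move: ar; rewrite E ltnn.
rewrite /= => dp dr; have [c0 t0] : c = 0 /\ t = 0 by lia.
by move: S; rewrite c0 t0 !mulr0z !subr0.
Qed.

End Span.

(** * Expansions in the torus of a triangulation *)

(* A ring with elements A e satisfying the Ptolemy relations, together with the
   monomials Mt in the A e for e in T; both the skew field of the theorem and,
   with w = 1, the values of the classical coordinates are instances. *)
Record ptolemy_model m (T : {set {set 'I_m}}) (F : unitRingType) (w : F)
    (Mt : vec m -> F) (A : {set 'I_m} -> F) : Prop := PtolemyModel {
  pm_unit : w \is a GRing.unit;
  pm_central : forall x, w * x = x * w;
  pm_0 : Mt 0 = 1;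
  pm_mul : forall u v, supported T u -> supported T v ->
    Mt u * Mt v = w ^ (- Lam T u v) * Mt (u + v);
  pm_A : forall e, e \in T -> A e = Mt (basis_vec e);
  pm_ptolemy : forall p a r b, quad p a r b ->
    A [set a; b] * A [set p; r] =
      w ^ (2 : int) * (A [set b; p] * A [set a; r])
      + w ^ (- 2 : int) * (A [set p; a] * A [set b; r])
}.

Definition eqm4 (x y : int) : Prop := ((x - y) %% 4 = 0)%Z.

Lemma eqm4_step (x1 x2 x3 y0 y1 y2 y3 : int) :
  eqm4 x1 y1 -> eqm4 x2 y2 -> eqm4 x3 y3 -> eqm4 (y0 + y1) (y2 + y3) ->
  eqm4 (- x1 + (x2 + x3)) y0.
Proof. by rewrite /eqm4; lia. Qed.

(** The other pair of opposite sides is covered by the same condition for the quadrilateral turned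
    by one vertex. *)
Definition quad_additive m (g : {set 'I_m} -> int) : Prop :=
  forall p a r b, quad p a r b ->
    eqm4 (g [set p; r] + g [set a; b]) (g [set b; p] + g [set a; r]).

Section Model.

Variables (m : nat) (T : {set {set 'I_m}}) (hT : ideal_triangulation T).
Variables (F : unitRingType) (w : F) (Mt : vec m -> F) (A : {set 'I_m} -> F).
Hypothesis (pm : ptolemy_model T w Mt A).

Lemma wz_comm (k : int) x : w ^ k * x = x * w ^ k.
Proof. by apply/esym/commrXz; rewrite /GRing.comm (pm_central pm). Qed.

Lemma wzD (k l : int) : w ^ (k + l) = w ^ k * w ^ l.
Proof. by rewrite exprzDr ?(pm_unit pm). Qed.

Lemma wzK (k : int) x : w ^ k * (w ^ (- k) * x) = x.
Proof. by rewrite mulrA -wzD subrr expr0z mul1r. Qed.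

Lemma MtD u v : supported T u -> supported T v ->
  Mt (u + v) = w ^ (Lam T u v) * (Mt u * Mt v).
Proof. by move=> hu hv; rewrite (pm_mul pm) // wzK. Qed.

Lemma Mt_mulN u : supported T u -> Mt u * Mt (- u) = 1.
Proof.
move=> hu; rewrite (pm_mul pm) //; last exact: supportedN.
by rewrite LamNr opprK Lam_self // expr0z mul1r subrr (pm_0 pm).
Qed.

Lemma Mt_Nmul u : supported T u -> Mt (- u) * Mt u = 1.
Proof. by move=> /supportedN /Mt_mulN; rewrite opprK. Qed.

Lemma Mt_unit u : supported T u -> Mt u \is a GRing.unit.
Proof. by move=> hu; apply/unitrP; exists (Mt (- u)); rewrite Mt_mulN ?Mt_Nmul. Qed.

Lemma MtN u : supported T u -> Mt (- u) = (Mt u)^-1.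
Proof.
by move=> hu; apply: (mulrI (Mt_unit hu)); rewrite Mt_mulN ?divrr // Mt_unit.
Qed.

End Model.

Section Expansion.

Variables (m : nat) (T : {set {set 'I_m}}).
Hypotheses (hm : (2 < m)%N) (hT : ideal_triangulation T).
Implicit Types (e f j : {set 'I_m}) (u v : vec m).

(** For monomials in the X's the pairing with an internal edge is -4 times the exponent, so the
    lowest possible pairing, [mu (-2) j e], marks the highest monomial. *)
Definition is_top e v : bool :=
  [forall j in T, Lam T (basis_vec j) v == mu (-2) j e].

(** Modulo 4, a monomial in the expansion of A_e pairs like e itself: agreement of u with an
    additive g on the edges of T extends to e. This evaluates [Lam] of unknown exponents through
    [mu]. *)
Definition compat e v : Prop :=
  forall g u, quad_additive g -> supported T u ->
    (forall j, j \in T -> eqm4 (Lam T (basis_vec j) u) (g j)) ->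
    eqm4 (Lam T v u) (g e).

Definition edge_term e v : Prop :=
  [/\ supported T v, forall x, vdeg v x = (x \in e)%:Z,
      forall j, j \in T -> Lam T (basis_vec j) v = mu (-2) j e \/
                           Lam T (basis_vec j) v = mu 2 j e
    & compat e v].

Definition expansion e (s : seq (vec m)) : Prop :=
  [/\ forall v, v \in s -> edge_term e v, count (is_top e) s = 1%N
    & forall (F : unitRingType) (w : F) Mt A, ptolemy_model T w Mt A ->
        A e = \sum_(v <- s) Mt v].

Lemma mu_ncr (k : int) e f : crosses e f = false -> mu k e f = lam e f.
Proof. by move=> h; rewrite /mu h addr0. Qed.

Lemma mu_plus e f : mu 2 e f = mu (-2) e f + (if crosses e f then 4 else 0).
Proof. by rewrite /mu -addrA; case: ifP. Qed.

Lemma expansion_tri e : e \in T -> expansion e [:: basis_vec e].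
Proof.
move=> eT.
have top j : j \in T -> Lam T (basis_vec j) (basis_vec e) = mu (-2) j e.
  by move=> jT; rewrite Lam_basis // mu_ncr // (tri_ncr hT).
split=> [v| |F w Mt A pm].
- rewrite inE => /eqP->; split.
  + exact: supported_basis.
  + by move=> x; rewrite vdeg_basis.
  + by move=> j jT; left; apply: top.
  + by move=> g u _ _; apply.
- rewrite /= (_ : is_top _ _) //.
  by apply/forall_inP => j jT; rewrite top.
- by rewrite big_seq1 (pm_A pm).
Qed.

Section Step.

Variables p a r b : 'I_m.
Hypotheses (hq : quad p a r b) (paT : [set p; a] \in T)
  (abT : [set a; b] \in T) (bpT : [set b; p] \in T).

Local Notation pr := [set p; r].
Local Notation ab := [set a; b].

Lemma step_facts j : j \in T ->
  [/\ crosses j [set a; r] -> crosses j pr,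
      crosses j [set b; r] -> crosses j pr,
      mu (-2) j pr = lam j [set b; p] - lam j ab + mu (-2) j [set a; r]
    & mu 2 j pr = lam j [set p; a] - lam j ab + mu 2 j [set b; r]].
Proof.
move=> jT; have := quad_facts_edge hq (tri_card hT jT).
rewrite /= => /and5P[_ _ _ + _].
rewrite (tri_ncr hT jT paT) (tri_ncr hT jT abT) (tri_ncr hT jT bpT).
move=> /and5P[/implyP h1 /implyP h2 /eqP h3 /eqP h4 _].
exact: And4 h1 h2 h3 h4.
Qed.

(** The alternatives for (c, x, y) are the two summands of the Ptolemy relation divided by A_ab: the
    side bp with a term of A_ar, and the side pa with a term of A_br. *)
Lemma step_edge_term c v x y :
  ((c, x, y) = ([set b; p], b, a) \/ (c, x, y) = ([set p; a], a, b)) ->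
  edge_term [set y; r] v ->
  edge_term pr (- basis_vec ab + (basis_vec c + v)).
Proof.
move=> hc [vT vd vL vc].
have [q1 q2 q3 [q4 q5 q6]] := quad_distinct hq.
have cT : c \in T by case: hc => -[-> _ _].
have csum t : (t \in c)%:Z - (t \in ab)%:Z + (t \in [set y; r])%:Z = (t \in pr)%:Z :> int.
  have F (k l : 'I_m) : k != l -> ~~ ((t == k) && (t == l)).
    by move=> xy; apply: contra xy => /andP[/eqP<- /eqP<-].
  move: (F _ _ q1) (F _ _ q2) (F _ _ q3) (F _ _ q4) (F _ _ q5) (F _ _ q6).
  case: hc => -[-> _ ->]; rewrite !inE;
  by case: (t == a); case: (t == b); case: (t == p); case: (t == r).
split.
- by do ![apply: supportedD | apply: supportedN | apply: supported_basis].
- by move=> t; rewrite !(vdegD, vdegN, vdeg_basis) vd -csum; ring.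
- move=> j jT; rewrite !(LamDr, LamNr) !Lam_basis //.
  have := vL j jT; have [h1 h2 h3 h4] := step_facts jT.
  case: hc => -[-> _ ->] [->|->].
  + by left; rewrite h3 addrA (addrC (- _)).
  + rewrite mu_plus; case: ifP => [/h1 cr|_]; last first.
      by left; rewrite h3 addr0 addrA (addrC (- _)).
    by right; rewrite mu_plus cr h3 !addrA (addrC (- _)).
  + case: ifP (mu_plus j [set b; r]) => [/h2 cr|_] E.
      left; apply: (addIr 4); move: h4; rewrite mu_plus cr E => ->; ring.
    by right; rewrite h4 E addr0 addrA (addrC (- _)).
  + by right; rewrite h4 addrA (addrC (- _)).
move=> g u gq uT gL; have := vc g u gq uT gL.
rewrite !(LamDl, LamNl) => h.
have [k1 k2] : quad p a r b /\ quad a r b p.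
  by have [k1 k2] := quad_cyc hq; split=> //; rewrite /quad k1 k2.
apply: (eqm4_step (gL _ abT) (gL _ cT) h).
move: (gq _ _ _ _ k1) (gq _ _ _ _ k2).
rewrite (setUC [set r] [set p]) (setUC [set r] [set b]) (addrC (g ab)).
by case: hc => -[-> _ ->].
Qed.

End Step.
End Expansion.

Section ExpansionExists.

Variables (m : nat) (T : {set {set 'I_m}}).
Hypotheses (hm : (2 < m)%N) (hT : ideal_triangulation T).
Implicit Types (e f j : {set 'I_m}) (u v : vec m).

Lemma is_topP e v :
  reflect (forall j, j \in T -> Lam T (basis_vec j) v = mu (-2) j e) (is_top T e v).
Proof.
apply: (iffP forall_inP) => h j jT; first exact/eqP/h.
by apply/eqP/h.
Qed.

Lemma expansion_step p a r b s1 s2 : quad p a r b ->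
  [set p; a] \in T -> [set a; b] \in T -> [set b; p] \in T ->
  expansion T [set a; r] s1 -> expansion T [set b; r] s2 ->
  expansion T [set p; r]
    ([seq - basis_vec [set a; b] + (basis_vec [set b; p] + v) | v <- s1] ++
     [seq - basis_vec [set a; b] + (basis_vec [set p; a] + v) | v <- s2]).
Proof.
move=> hq paT abT bpT [t1 c1 e1] [t2 c2 e2].
have := quad_facts_vertex p hq; rewrite /= => /and5P[_ x1 _ _ /and5P[_ _ n4 _ /and5P[]]].
move=> /eqP l1 /eqP l2 /eqP l3 /eqP l4 /and3P[/eqP l5 /eqP l6 N].
have n5 : crosses [set b; p] [set a; r] = false.
  by rewrite crossesC; apply/negbTE.
have [n1 n2] : crosses [set a; b] [set a; r] = false /\
    crosses [set a; b] [set b; r] = false.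
  by move: N; rewrite (setUC [set b] [set r]) !negb_or => /and4P[_ /negbTE-> /negbTE-> _].
have n3 : crosses [set p; a] [set b; r] = false.
  have [k1 k2] := quad_cyc hq; have hq' : quad a r b p by rewrite /quad k1 k2.
  have := quad_facts_vertex p hq'; rewrite /= => /and5P[_ _ _ _ /and5P[_ _ + _ _]].
  by rewrite crossesC (setUC [set r]) => /negbTE.
have bvT e : e \in T -> supported T (basis_vec e) by exact: supported_basis.
have F := step_facts hT hq paT abT bpT.
split.
- move=> v; rewrite mem_cat => /orP[] /mapP[u us ->].
    by apply: (step_edge_term hT hq paT abT bpT (or_introl _) (t1 u us)).
  by apply: (step_edge_term hT hq paT abT bpT (or_intror _) (t2 u us)).
- rewrite count_cat !count_map -[RHS](addn0 1%N); congr (_ + _)%N.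
    rewrite -c1; apply: eq_in_count => v vs /=; apply/is_topP/is_topP => h j jT.
      have := h j jT; have [_ _ -> _] := F j jT.
      rewrite !(LamDr, LamNr) !Lam_basis // addrA (addrC (- _)).
      exact: addrI.
    have [_ _ -> _] := F j jT.
    by rewrite !(LamDr, LamNr) !Lam_basis // h // addrA (addrC (- _)).
  (* The second summand never gives the top: its terms pair with ab as 1 + 1 = 2, while the lowest
     value, [mu (-2)] of ab and pr, is -2. *)
  apply/eqP; rewrite -leqn0 leqNgt -has_count; apply/hasPn => v vs /=.
  apply/negP => /is_topP/(_ _ abT).
  rewrite !(LamDr, LamNr) !Lam_basis // lamxx l3.
  have [_ _ /(_ _ abT) + _] := t2 v vs; rewrite !(mu_ncr _ n2) l4 /mu x1 (lam_crosses x1).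
  by case=> ->.
- move=> F' w Mt A pm.
  have Eab : A [set a; b] = Mt (basis_vec [set a; b]) by rewrite (pm_A pm).
  have uab := Mt_Nmul hT pm (bvT _ abT).
  rewrite -[LHS]mul1r -uab -Eab -mulrA (pm_ptolemy pm) // mulrDr.
  rewrite big_cat !big_map (e1 _ _ _ _ pm) (e2 _ _ _ _ pm) /=.
  rewrite (pm_A pm bpT) (pm_A pm paT).
  (* Merging the three monomials costs the power k, which is 2 for the first summand and -2 for the
     second: exactly the powers of the Ptolemy relation, so all coefficients are 1. *)
  have term e v k : e \in T -> supported T v ->
     Lam T (- basis_vec [set a; b]) (basis_vec e + v) + Lam T (basis_vec e) v = k ->
     Mt (- basis_vec [set a; b] + (basis_vec e + v)) =
     Mt (- basis_vec [set a; b]) * (w ^ k * (Mt (basis_vec e) * Mt v)).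
    move=> eT vT <-; have eS := bvT e eT.
    rewrite (MtD pm (supportedN (bvT _ abT)) (supportedD eS vT)) (MtD pm eS vT).
    by rewrite (wzD pm) -[in RHS]mulrA [in RHS]mulrA -(wz_comm pm) -[in RHS]mulrA.
  congr (_ + _); rewrite mulr_sumr mulr_sumr mulr_sumr big_seq [RHS]big_seq;
    apply: eq_bigr => v vs.
    have [vT _ vL _] := t1 v vs.
    rewrite (term _ _ 2) // LamNl LamDr Lam_basis // l1.
    have := vL _ abT; have := vL _ bpT; rewrite !(mu_ncr _ n1) !(mu_ncr _ n5) l2 l5.
    by case=> -> [] ->.
  have [vT _ vL _] := t2 v vs.
  rewrite (term _ _ (-2)) // LamNl LamDr Lam_basis // l3.
  have := vL _ abT; have := vL _ paT; rewrite !(mu_ncr _ n2) !(mu_ncr _ n3) l4 l6.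
  by case=> -> [] ->.
Qed.

Lemma expansion_exists e : #|e| = 2%N -> exists s, expansion T e s.
Proof.
pose N e := #|[set f in T | crosses f e]|.
move: {2}(N e) (leqnn (N e)) => n; elim: n e => [|n IHn] e hn ce.
  exists [:: basis_vec e]; apply: expansion_tri => //; apply: tri_max => // f fT.
  apply/negbTE/negP => h; have : f \in [set f in T | crosses f e].
    by rewrite inE fT crossesC.
  by rewrite (cards0_eq (_ : N e = 0%N)) ?inE //; apply/eqP; rewrite -leqn0.
have [eT|eT] := boolP (e \in T).
  by exists [:: basis_vec e]; apply: expansion_tri.
have /cards2E[p [r [npr Ee]]] := ce; rewrite {}Ee in hn eT *.
have [a [b [hq paT abT bpT]]] := tri_cross hm hT npr eT.
have F := step_facts hT hq paT abT bpT.
have := quad_facts_vertex p hq; rewrite /= => /and5P[_ x1 _ _ /and5P[_ _ _ _ /and5P[]]].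
move=> _ _ _ _ /and3P[_ _ N0].
have [n1 n2] : crosses [set a; b] [set a; r] = false /\
    crosses [set a; b] [set b; r] = false.
  by move: N0; rewrite (setUC [set b] [set r]) !negb_or => /and4P[_ /negbTE-> /negbTE-> _].
(* The edge ab crosses pr but neither ar nor br, and these cross no edge of T that pr avoids, so the
   number of crossed edges drops. *)
have dec f : crosses [set a; b] f = false ->
    (forall j, j \in T -> crosses j f -> crosses j [set p; r]) -> (N f <= n)%N.
  move=> nf sub; rewrite -ltnS; apply: leq_trans hn; apply: proper_card.
  apply/properP; split.
    by apply/subsetP => j; rewrite !inE => /andP[jT hj]; rewrite jT; exact: sub.
  by exists [set a; b]; rewrite inE ?abT ?nf // abT x1.
have [q1 q2 q3 [q4 q5 q6]] := quad_distinct hq.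
have [||s1 hs1] := IHn [set a; r].
- by apply: (dec _ n1) => j jT; have [h _ _ _] := F j jT; exact: h.
- by rewrite cards2 q4.
have [||s2 hs2] := IHn [set b; r].
- by apply: (dec _ n2) => j jT; have [_ h _ _] := F j jT; exact: h.
- by rewrite cards2 eq_sym q6.
by eexists; apply: expansion_step hs1 hs2.
Qed.

End ExpansionExists.

(** * Words in the edges *)

Lemma eqm4_refl x : eqm4 x x.
Proof. by rewrite /eqm4; lia. Qed.

Lemma eqm4_sym x y : eqm4 x y -> eqm4 y x.
Proof. by rewrite /eqm4; lia. Qed.

Lemma eqm4_trans y x z : eqm4 x y -> eqm4 y z -> eqm4 x z.
Proof. by rewrite /eqm4; lia. Qed.

Lemma eqm4D x y z t : eqm4 x y -> eqm4 z t -> eqm4 (x + z) (y + t).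
Proof. by rewrite /eqm4; lia. Qed.

Lemma eqm4N x y : eqm4 x y -> eqm4 (- x) (- y).
Proof. by rewrite /eqm4; lia. Qed.

Lemma eqm4_dvd x y : eqm4 x y <-> exists k, x = y + 4 * k.
Proof.
split=> [/dvdz_mod0P/dvdzP[k E]|[k ->]]; last by rewrite /eqm4; lia.
by exists k; lia.
Qed.

Lemma eqm4M k x y : eqm4 x y -> eqm4 (k * x) (k * y).
Proof. by move=> /eqm4_dvd[l ->]; apply/eqm4_dvd; exists (k * l); ring. Qed.

Lemma count_allpairs (S U V : eqType) (f : S -> U -> V) (a : pred V)
    (b : pred S) (c : pred U) (s : seq S) (u : seq U) :
  (forall x y, x \in s -> y \in u -> a (f x y) = b x && c y) ->
  count a [seq f x y | x <- s, y <- u] = (count b s * count c u)%N.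
Proof.
elim: s => [//|x s IHs] h; rewrite allpairs_cons count_cat count_map /=.
rewrite IHs; last by move=> y z ys zu; apply: h => //; rewrite inE ys orbT.
rewrite mulnDl; congr (_ + _)%N.
rewrite (@eq_in_count _ _ (fun y => b x && c y)); last first.
  by move=> y yu /=; apply: h; rewrite ?inE ?eqxx.
by case: (b x); rewrite ?mul1n ?mul0n //= count_pred0.
Qed.

Section Words.

Variable m : nat.
Implicit Types (e f : {set 'I_m}) (v : vec m).

(** The exponent -1 will be allowed only on boundary edges. These carry the negative weights of
    special arcs, and since they lie in every triangulation their inverses are monomials in every
    torus. *)
Definition letter : Type := ({set 'I_m} * int)%type.
Implicit Types (x y : letter) (W : seq letter).

(* A letter (e, 1) stands for A_e and (e, -1) for its inverse. *)
Definition valid_letter x : Prop :=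
  #|x.1| = 2%N /\ (x.2 = 1 \/ (x.2 = -1 /\ boundary_edge x.1)).

Definition valid_word W : Prop := forall x, x \in W -> valid_letter x.

Definition wdeg W (p : 'I_m) : int := \sum_(x <- W) x.2 * (p \in x.1)%:Z.

Definition wvec_of W : vec m := \sum_(x <- W) basis_vec x.1 *~ x.2.

(** Pairs are taken in the order of the word; this is the shape of the exponent that normalises a
    product of letters. *)
Fixpoint psum (k : letter -> letter -> int) W : int :=
  if W is x :: W' then \sum_(y <- W') k x y + psum k W' else 0.

Definition csum (k : letter -> letter -> int) W W' : int :=
  \sum_(x <- W) \sum_(y <- W') k x y.

Definition on_letters (g : {set 'I_m} -> {set 'I_m} -> int) x y : int :=
  x.2 * y.2 * g x.1 y.1.

Definition wprod (F : unitRingType) (A : {set 'I_m} -> F) W : F :=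
  \prod_(x <- W) A x.1 ^ x.2.

Definition leval (F : unitRingType) (w : F) (Mt : vec m -> F)
    (L : seq (int * vec m)) : F :=
  \sum_(t <- L) w ^ t.1 * Mt t.2.

(** The bar involution w -> 1/w on the coefficients. *)
Definition lbar (L : seq (int * vec m)) := [seq (- t.1, t.2) | t <- L].

Lemma mu_quad_additive f k : #|f| = 2%N ->
  quad_additive (fun e => k * mu 2 e f).
Proof.
move=> cf p a r b hq; rewrite -!mulrDr; apply: eqm4M.
have [q1 q2 q3 [q4 q5 q6]] := quad_distinct hq.
have c2 (i j : 'I_m) : i != j -> #|[set i; j]| = 2%N by move=> ij; rewrite cards2 ij.
have := quad_facts_edge hq cf; rewrite /= => /and5P[/eqP + _ _ _ _].
have := mu_anti cf (c2 _ _ q2); have := mu_anti cf (c2 _ _ q5).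
have := mu_anti cf (c2 _ _ q4); have := mu_anti cf (c2 b p _); rewrite eq_sym => /(_ q3).
rewrite /eqm4; move: (mu 2 f _) (mu 2 f _) (mu 2 f _) (mu 2 f _).
by move: (mu 2 _ _) (mu 2 _ _) (mu 2 _ _) (mu 2 _ _); lia.
Qed.

Lemma quad_additive_sum W (g : letter -> {set 'I_m} -> int) :
  (forall y, y \in W -> quad_additive (g y)) ->
  quad_additive (fun e => \sum_(y <- W) g y e).
Proof.
move=> h p a r b hq; rewrite -!big_split /= big_seq [X in eqm4 _ X]big_seq.
apply: (big_ind2 eqm4) => [||y yW]; first exact: eqm4_refl.
  by move=> *; apply: eqm4D.
exact: (h y yW).
Qed.

Section Torus.

Variable T : {set {set 'I_m}}.
Hypotheses (hm : (2 < m)%N) (hT : ideal_triangulation T).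

Definition low W j : int := \sum_(x <- W) x.2 * mu (-2) j x.1.

Definition is_wtop W v : bool :=
  [forall j in T, Lam T (basis_vec j) v == low W j].

Definition word_term W v : Prop :=
  [/\ supported T v, forall p, vdeg v p = wdeg W p,
      forall j, j \in T -> low W j <= Lam T (basis_vec j) v
    & forall g u, quad_additive g -> supported T u ->
        (forall j, j \in T -> eqm4 (Lam T (basis_vec j) u) (g j)) ->
        eqm4 (Lam T v u) (\sum_(x <- W) x.2 * g x.1)].

(** The congruence says that all powers of w become multiples of 4 once the word is multiplied by w
    to its [psum]. One list serves every model, quantum and classical. *)
Definition word_expansion W (L : seq (int * vec m)) : Prop :=
  [/\ forall t, t \in L -> word_term W t.2 /\
        eqm4 t.1 (- psum (on_letters (mu 2)) W),
      count (fun t => is_wtop W t.2) L = 1%N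
    & forall (F : unitRingType) (w : F) Mt A, ptolemy_model T w Mt A ->
        wprod A W = leval w Mt L /\ wprod A (rev W) = leval w Mt (lbar L)].

Lemma letter_expansion x : valid_letter x -> exists s : seq (vec m),
  [/\ forall v, v \in s -> word_term [:: x] v /\
        (forall j, j \in T -> eqm4 (Lam T (basis_vec j) v) (x.2 * mu 2 j x.1)),
      count (is_wtop [:: x]) s = 1%N
    & forall (F : unitRingType) (w : F) Mt A, ptolemy_model T w Mt A ->
        A x.1 ^ x.2 = \sum_(v <- s) Mt v].
Proof.
case: x => e k [/= ce [->|[-> be]]]; rewrite /word_term /is_wtop /low /wdeg.
  have [s [h c E]] := expansion_exists hm hT ce; exists s; split.
  - move=> v /h[vT vd vL vc]; split=> [|j jT]; last first.
      by case: (vL j jT) => ->; rewrite /mu /eqm4; case: ifP; lia.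
    split=> // [p|j jT|g u gq uT gu].
    + by rewrite big_seq1 vd mul1r.
    + by rewrite big_seq1 mul1r; case: (vL j jT) => ->; rewrite /mu lerD2l; case: ifP.
    + by rewrite big_seq1 mul1r; apply: vc.
  - apply: etrans c; apply: eq_count => v /=; apply: eq_forallb_in => j _.
    by rewrite big_seq1 mul1r.
  - by move=> F w Mt A pm; rewrite expr1z (E _ _ _ _ pm).
have eT : e \in T by exact: boundary_tri.
have top j : j \in T -> Lam T (basis_vec j) (- basis_vec e) = -1 * lam j e.
  by move=> jT; rewrite LamNr Lam_basis // mulN1r.
have ncr k' j : mu k' j e = lam j e.
  by rewrite mu_ncr // crossesC boundary_ncr.
exists [:: - basis_vec e]; split.
- move=> v; rewrite inE => /eqP->; split=> [|j jT]; last first.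
    by rewrite top // ncr; apply: eqm4_refl.
  split=> [|p|j jT|g u gq uT gu].
  + exact/supportedN/supported_basis.
  + by rewrite vdegN vdeg_basis big_seq1 mulN1r.
  + by rewrite top // big_seq1 ncr.
  + by rewrite big_seq1 LamNl mulN1r; apply/eqm4N/gu.
- rewrite /= (_ : [forall j in T, _]) //.
  by apply/forall_inP => j jT; rewrite top // big_seq1 ncr.
- move=> F w Mt A pm; rewrite big_seq1 (MtN hT pm) -?(pm_A pm) ?exprN1 //.
  exact: supported_basis.
Qed.

Lemma low_cons x W j : low (x :: W) j = low [:: x] j + low W j.
Proof. by rewrite /low big_cons big_seq1. Qed.

Lemma word_expansion_exists W : valid_word W -> exists L, word_expansion W L.
Proof.
elim: W => [|x W IHW] vW.
  exists [:: (0, 0)]; split=> [t| |F w Mt A pm].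
  - rewrite inE => /eqP->; split; last exact: eqm4_refl.
    split=> [|p|j jT|g u _ _ _] /=; first exact: supported0.
    + by rewrite vdeg0 /wdeg big_nil.
    + by rewrite Lam0r /low big_nil.
    + by rewrite Lam0l big_nil; apply: eqm4_refl.
  - rewrite /= (_ : is_wtop _ _) //.
    by apply/forall_inP => j jT; rewrite Lam0r /low big_nil.
  - by rewrite /wprod /leval /lbar /= !big_nil !big_seq1 /= ?oppr0 !expr0z mul1r (pm_0 pm).
have [L [hL cL eL]] := IHW (fun y yW => vW y (mem_behead (s := x :: W) yW)).
have vx : valid_letter x by apply: vW; rewrite inE eqxx.
have [s [hs cs es]] := letter_expansion vx.
exists [seq (t.1 - Lam T v t.2, v + t.2) | v <- s, t <- L]; split.
- move=> _ /allpairsP[[v t] [/= vs tL ->]] /=.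
  have [[v1 v2 v3 v4] v5] := hs v vs; have [[t1 t2 t3 t4] t5] := hL t tL.
  split.
    split=> [|p|j jT|g u gq uT gu].
    + exact: supportedD.
    + by rewrite vdegD v2 t2 /wdeg big_seq1 big_cons.
    + by rewrite LamDr low_cons lerD // ?v3 ?t3.
    + rewrite LamDl big_cons; apply: eqm4D; last exact: t4.
      by have := v4 g u gq uT gu; rewrite big_seq1.
  (* Merging the monomials v and t costs [Lam] of v and t. The vector v realises on T the additive
     function e -> x.2 * mu 2 e x.1, so the property of t evaluates this modulo 4 as the sum of [mu]
     over the letters of W. *)
  have h4 := t4 _ v (mu_quad_additive x.2 vx.1) v1 v5.
  rewrite opprD addrC (Lam_anti hT) opprK; apply: eqm4D => //.
  apply: eqm4_trans h4 _; rewrite -sumrN big_seq [X in eqm4 _ X]big_seq.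
  apply: (big_ind2 eqm4) => [||y yW]; first exact: eqm4_refl.
    by move=> *; apply: eqm4D.
  have cy : #|y.1| = 2%N by have [] := vW y (mem_behead (s := x :: W) yW).
  have := mu_anti cy vx.1; rewrite /on_letters => h.
  rewrite (_ : _ * _ = y.2 * x.2 * mu 2 y.1 x.1); last by rewrite mulrA.
  rewrite (mulrC x.2) -mulrN; apply: eqm4M; rewrite /eqm4 opprK; exact: h.
- rewrite (count_allpairs (b := is_wtop [:: x]) (c := fun t => is_wtop W t.2)).
    by rewrite cs cL.
  move=> v t vs tL /=; have [[_ _ v3 _] _] := hs v vs; have [[_ _ t3 _] _] := hL t tL.
  apply/forall_inP/andP => [h|[/forall_inP h1 /forall_inP h2] j jT]; last first.
    by rewrite LamDr low_cons (eqP (h1 j jT)) (eqP (h2 j jT)).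
  (* Both pairings are bounded below, so their sum is lowest only if each of them is. *)
  split; apply/forall_inP => j jT; have := h j jT; rewrite LamDr low_cons;
    have := v3 j jT; have := t3 j jT;
    move: (Lam _ _ v) (Lam _ _ t.2) (low _ j) (low _ j); lia.
- move=> F w Mt A pm; have [e1 e2] := eL _ _ _ _ pm; have e3 := es _ _ _ _ pm.
  have -> : wprod A (x :: W) = A x.1 ^ x.2 * wprod A W by rewrite /wprod big_cons.
  have -> : wprod A (rev (x :: W)) = wprod A (rev W) * A x.1 ^ x.2.
    by rewrite /wprod rev_cons -cats1 big_cat big_seq1.
  rewrite e1 e2 e3 /leval /lbar !big_map !mulr_suml.
  rewrite !big_allpairs_dep; split.
    rewrite big_seq [RHS]big_seq; apply: eq_bigr => v vs.
    rewrite mulr_sumr big_seq [RHS]big_seq; apply: eq_bigr => t tL /=.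
    have [[v1 _ _ _] _] := hs v vs; have [[t1 _ _ _] _] := hL t tL.
    rewrite mulrA -(wz_comm pm) -mulrA (pm_mul pm) // mulrA -(wzD pm).
    by [].
  (* In the reversed word the factor of x stands on the right, and skewness of [Lam] inverts the
     power. *)
  rewrite [LHS](eq_bigr (fun t => \sum_(v <- s) w ^ (- t.1) * Mt t.2 * Mt v));
    last by move=> t _; rewrite mulr_sumr.
  rewrite exchange_big /=.
  rewrite big_seq [RHS]big_seq; apply: eq_bigr => v vs.
  rewrite big_seq [RHS]big_seq; apply: eq_bigr => t tL /=.
  have [[v1 _ _ _] _] := hs v vs; have [[t1 _ _ _] _] := hL t tL.
  rewrite -mulrA (pm_mul pm) // mulrA -(wzD pm) (Lam_anti hT) opprK opprB.
  by rewrite (addrC (Lam _ _ _)) (addrC v).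
Qed.

End Torus.
End Words.

(** * Flips *)

Section Flips.

Variables (m : nat).
Hypotheses (hm : (2 < m)%N).
Implicit Types (T : {set {set 'I_m}}) (e f : {set 'I_m}) (p a r b : 'I_m).

Lemma tri_intro T : noncrossing T ->
  (forall e, #|e| = 2%N -> (forall f, f \in T -> crosses e f = false) -> e \in T) ->
  ideal_triangulation T.
Proof.
move=> nT hT; apply/maxsetP; split=> // U nU sTU; apply/eqP.
rewrite eqEsubset sTU andbT; apply/subsetP => e eU.
have /noncrossingP[h1 h2] := nU.
by apply: hT => [|f fT]; [apply: h1|apply: h2 => //; apply: (subsetP sTU)].
Qed.

Lemma tri_extend (U : {set {set 'I_m}}) : noncrossing U ->
  exists2 T, ideal_triangulation T & U \subset T.
Proof. by case/maxset_exists=> T hT sUT; exists T. Qed.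

Lemma noncrossingU1 e T : #|e| = 2%N -> noncrossing T ->
  (forall f, f \in T -> crosses e f = false) -> noncrossing (e |: T).
Proof.
move=> ce /noncrossingP[h1 h2] h; apply/noncrossingP.
split=> [f|f g]; rewrite !inE.
  by case/orP=> [/eqP->//|]; apply: h1.
case/orP=> [/eqP->|fT] /orP[/eqP->|gT].
- exact: crossesxx.
- exact: h.
- by rewrite crossesC h.
- exact: h2.
Qed.

Lemma quad_extend p a r b : quad p a r b ->
  exists2 T, ideal_triangulation T & [/\ [set a; b] \in T, [set p; a] \in T,
    [set a; r] \in T, [set r; b] \in T & [set b; p] \in T].
Proof.
move=> hq; have [q1 q2 q3 [q4 q5 q6]] := quad_distinct hq.
have := quad_facts_vertex p hq; rewrite /= => /and5P[_ _ n1 n2 /and5P[n3 n4 n5 n6]].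
case/and5P=> _ _ _ _ /and3P[_ _]; rewrite !negb_or => /and4P[n7 n8 n9 n10].
have c2 (x y : 'I_m) : x != y -> #|[set x; y]| = 2%N by move=> xy; rewrite cards2 xy.
have nc : noncrossing ([set a; b] |: ([set p; a] |: ([set a; r] |:
    ([set r; b] |: ([set b; p] |: set0))))).
  do ![apply: noncrossingU1]; try by apply: c2; rewrite // eq_sym.
  - by apply/noncrossingP; split=> [e|e f]; rewrite inE.
  - by move=> f; rewrite inE.
  - by move=> f; rewrite !inE orbF => /eqP->; apply/negbTE.
  - by move=> f; rewrite !inE orbF => /orP[] /eqP->; apply/negbTE.
  - by move=> f; rewrite !inE orbF => /or3P[] /eqP->; apply/negbTE.
  - by move=> f; rewrite !inE orbF => /or4P[] /eqP->; apply/negbTE.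
have [T hT /subsetP sT] := tri_extend nc.
by exists T => //; split; apply: sT; rewrite !inE eqxx ?orbT.
Qed.

(** A chord that crosses no side of the quadrilateral crosses ab only if it is pr, and crosses pr
    only if it is ab or crosses ab; so exchanging the diagonals keeps the set noncrossing and
    maximal. *)
Lemma quad_flip T p a r b : ideal_triangulation T -> quad p a r b ->
  [set a; b] \in T -> [set p; a] \in T -> [set a; r] \in T ->
  [set r; b] \in T -> [set b; p] \in T ->
  is_flip T ([set p; r] |: (T :\ [set a; b])) [set a; b] [set p; r].
Proof.
move=> hT hq abT paT arT rbT bpT.
have [q1 q2 q3 [q4 q5 q6]] := quad_distinct hq.
have := quad_facts_vertex p hq; rewrite /= => /and5P[_ x1 _ _ _].
have prT : [set p; r] \notin T by apply: contraL x1 => /(tri_ncr hT abT) ->.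
have F e : #|e| = 2%N -> crosses e [set p; a] = false ->
    crosses e [set a; r] = false -> crosses e [set r; b] = false ->
    crosses e [set b; p] = false ->
    (crosses e [set a; b] -> e = [set p; r]) /\
    (crosses e [set a; b] = false -> e != [set a; b] -> crosses e [set p; r] = false).
  move=> ce h1 h2 h3 h4; have := quad_facts_edge hq ce.
  rewrite /= h1 h2 h3 h4 => /and5P[_ _ _ _ /implyP/(_ isT)].
  move=> /and3P[/implyP g1 /implyP g2 _].
  split=> [/g1/eqP//|h5 h6]; apply/negbTE; apply: g2.
  by rewrite h5 h6.
have ncpr e : e \in T -> e != [set a; b] -> crosses e [set p; r] = false.
  move=> eT ne; have N := tri_ncr hT eT.
  have [_ ->] := F e (tri_card hT eT) (N _ paT) (N _ arT) (N _ rbT) (N _ bpT) => //.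
  exact: N.
have side c : c != [set a; b] -> c \in T -> c \in [set p; r] |: (T :\ [set a; b]).
  by move=> h cT; rewrite !inE h cT orbT.
have G (x y : 'I_m) : x != y -> ((x == y) = false) * ((y == x) = false).
  by move=> /negbTE h; rewrite h eq_sym h.
have k := (G _ _ q1, G _ _ q2, G _ _ q3, G _ _ q4, (G _ _ q5, G _ _ q6)).
split=> //; apply: tri_intro => [|e ce he].
  apply/noncrossingP; split=> [e|e f]; rewrite !inE.
    by case/orP=> [/eqP->|/andP[_ /(tri_card hT)//]]; rewrite cards2 q2.
  case/orP=> [/eqP->|/andP[ne eT]] /orP[/eqP->|/andP[nf fT]].
  - exact: crossesxx.
  - by rewrite crossesC ncpr.
  - exact: ncpr.
  - exact: (tri_ncr hT eT fT).
have [c1 c2] : (crosses e [set a; b] -> e = [set p; r]) /\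
    (crosses e [set a; b] = false -> e != [set a; b] -> crosses e [set p; r] = false).
  by apply: F => //; apply: he; apply: side => //; rewrite set2_eq ?k ?andbF.
case h : (crosses e [set a; b]); first by rewrite (c1 h) !inE eqxx.
have eT : e \in T.
  apply: tri_max => // f fT; have [->//|nf] := eqVneq f [set a; b].
  exact/he/side.
apply: side => //; apply: contraTneq x1 => <-.
by rewrite he // !inE eqxx.
Qed.

Lemma star_tri_unique p T T' :
  ideal_triangulation T -> ideal_triangulation T' ->
  (forall x, x != p -> [set p; x] \in T) -> (forall x, x != p -> [set p; x] \in T') ->
  T = T'.
Proof.
wlog suff H : T T' / ideal_triangulation T -> ideal_triangulation T' ->
    (forall x, x != p -> [set p; x] \in T) ->
    (forall x, x != p -> [set p; x] \in T') -> T \subset T'.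
  by move=> hT hT' sT sT'; apply/eqP; rewrite eqEsubset !H.
move=> hT hT' sT sT'; apply/subsetP => e eT.
apply: tri_max => //; first exact: (tri_card hT eT).
move=> f fT'; case h: (crosses e f) => //; move: (h).
have ne x : x != p -> crosses e [set p; x] = false.
  by move=> xp; apply: (tri_ncr hT eT); apply: sT.
have nf x : x != p -> crosses f [set p; x] = false.
  by move=> xp; apply: (tri_ncr hT' fT'); apply: sT'.
have [/cards2E[x [y [_ Ee]]] /cards2E[z [t [_ Ef]]]] := crosses_card h.
have := star_check p x y z t; rewrite /star_facts; subst e f.
rewrite -!crossesE !eq_byE h /= => /or4P[] /andP[xp].
- by rewrite ne.
- by rewrite ne.
- by rewrite nf.
- by rewrite nf.
Qed.

End Flips.

Section ModelWords.

Variables (m : nat) (T : {set {set 'I_m}}) (hT : ideal_triangulation T).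
Variables (F : unitRingType) (w : F) (Mt : vec m -> F) (A : {set 'I_m} -> F).
Hypothesis (pm : ptolemy_model T w Mt A).

Lemma MtMz u (k : int) : supported T u -> Mt (u *~ k) = Mt u ^ k.
Proof.
move=> hu; have E n : Mt (u *+ n) = Mt u ^+ n.
  elim: n => [|n IHn]; first by rewrite mulr0n expr0 (pm_0 pm).
  have hn : supported T (u *+ n) by rewrite pmulrn; apply: supportedMz.
  rewrite mulrS (MtD pm) // pmulrn LamMzr Lam_self // mul0r expr0z mul1r.
  by rewrite -pmulrn IHn exprS.
case: k => n; first by rewrite -pmulrn E.
rewrite NegzE mulrNz -pmulrn (MtN hT pm) ?E ?exprnN //.
by rewrite pmulrn; apply: supportedMz.
Qed.

Lemma Mt_word (W : seq (letter m)) : (forall x, x \in W -> x.1 \in T) ->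
  Mt (wvec_of W) = w ^ (psum (on_letters (@lam m)) W) * wprod A W.
Proof.
have S W' : (forall x, x \in W' -> x.1 \in T) -> supported T (wvec_of W').
  move=> h; rewrite /wvec_of big_seq; apply: supported_sum => x xW.
  by apply/supportedMz/supported_basis/h.
elim: W => [|x W IHW] h.
  by rewrite /wvec_of /wprod !big_nil (pm_0 pm) expr0z mulr1.
have hW y : y \in W -> y.1 \in T by move=> yW; apply: h; rewrite inE yW orbT.
have xT : x.1 \in T by apply: h; rewrite inE eqxx.
have xS := supported_basis xT.
rewrite /wvec_of big_cons -/(wvec_of W) (MtD pm (supportedMz _ xS) (S _ hW)).
rewrite IHW // (MtMz _ xS) /wprod big_cons -/(wprod _ _) -(pm_A pm xT) /=.
rewrite (mulrA (A _ ^ _)) -(wz_comm pm (psum _ _)) -mulrA mulrA -(wzD pm).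
congr (w ^ (_ + _) * _).
rewrite LamMzl /wvec_of Lam_sumr mulr_suml big_seq [RHS]big_seq.
apply: eq_bigr => y yW; rewrite LamMzr Lam_basis //; last exact: hW.
by rewrite /on_letters; ring.
Qed.

End ModelWords.

Section VectorWord.

Variable m : nat.
Implicit Types (v : vec m) (x : letter m) (W : seq (letter m)).

(** Letters carry unit exponents, so that crossings can be resolved one pair at a time. *)
Definition word_of v : seq (letter m) :=
  flatten [seq nseq `|v e|%N (e, Num.sg (v e)) | e <- enum {: {set 'I_m}}].

Lemma mem_word_of v x : x \in word_of v -> v x.1 != 0 /\ x.2 = Num.sg (v x.1).
Proof.
case/flattenP=> s /mapP[e _ ->]; rewrite mem_nseq => /andP[h /eqP->] /=.
by rewrite -absz_gt0.
Qed.

Lemma word_of_prod (R : Type) (idx : R) (op : Monoid.com_law idx)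
    (G : letter m -> R) v :
  \big[op/idx]_(x <- word_of v) G x =
  \big[op/idx]_(e : {set 'I_m}) iterop `|v e|%N op (G (e, Num.sg (v e))) idx.
Proof.
rewrite /word_of big_flatten big_map big_enum /=; apply: eq_bigr => e _.
by rewrite big_nseq Monoid.iteropE.
Qed.

Lemma wvec_of_word_of v : wvec_of (word_of v) = v.
Proof.
have hv : supported [set: {set 'I_m}] v by move=> i; rewrite inE.
rewrite [RHS](vec_basis hv) /wvec_of word_of_prod.
apply: eq_big => [e|e _]; first by rewrite inE.
rewrite Monoid.iteropE /=.
rewrite -[X in X = _](_ : basis_vec e *~ Num.sg (v e) *+ `|v e|%N = _); last first.
  by elim: `|v e|%N => //= n <-; rewrite mulrS.
by rewrite pmulrn -mulrzA -[RHS](_ : basis_vec e *~ (Num.sg (v e) * `|v e|) = _)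
  ?abszE // -numEsg.
Qed.

Lemma vdeg_wvec_of W p : vdeg (wvec_of W) p = wdeg W p.
Proof.
rewrite /wvec_of /wdeg; elim/big_rec2: _ => [|x k u _ <-]; first exact: vdeg0.
by rewrite vdegD vdegMz vdeg_basis mulrC.
Qed.

End VectorWord.

(** * Edge elements independent of the triangulation *)

Section Frames.

Variables (m : nat).
Hypotheses (hm : (2 < m)%N).
Variables (F : unitRingType) (omega : F).
Variables (M : {set {set 'I_m}} -> vec m -> F).
Hypothesis (hM : toric_frames omega M).
Implicit Types (T : {set {set 'I_m}}) (e f : {set 'I_m}) (p a r b : 'I_m).

(* Flipping towards the fan at an end p of e never flips e. *)
Lemma reach_star p T : ideal_triangulation T -> exists T',
  [/\ ideal_triangulation T', forall x, x != p -> [set p; x] \in T'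
    & forall e, e \in T -> p \in e -> M T (basis_vec e) = M T' (basis_vec e)].
Proof.
pose N T := #|[set x | (x != p) && ([set p; x] \notin T)]|.
move: {2}(N T) (leqnn (N T)) => n; elim: n T => [|n IHn] T hn hT.
  exists T; split=> // x xp; apply/negPn/negP => h.
  suff : x \in [set x | (x != p) && ([set p; x] \notin T)].
    by rewrite (cards0_eq (_ : N T = 0%N)) ?inE //; apply/eqP; rewrite -leqn0.
  by rewrite inE xp h.
have [/forallP h|] := boolP [forall x, (x != p) ==> ([set p; x] \in T)].
  by exists T; split=> // x; apply/implyP.
case/forallPn=> r; rewrite negb_imply => /andP[rp prT].
have pr : p != r by rewrite eq_sym.
have [a [b [hq paT abT bpT]]] := tri_cross hm hT pr prT.
have [/andP[h1 h2] [h3 h4]] := (hq, quad_cyc hq).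
(* The apex z lies on the far side of ab from p; flipping ab to pz adds an edge at p and removes
   none. *)
have [z [azb azT zbT]] := tri_third hm hT abT (ex_intro _ r h3).
have pz : p != z.
  by apply: contraTneq azb => <-; rewrite (cyc_asym h4).
have pab : cyc ltn (p : nat) a b by rewrite -cyc_rot.
have [pzb paz] := cyc_trans pab azb pz.
have hqz : quad p a z b by rewrite /quad paz -cyc_rot.
have fl := quad_flip hT hqz abT paT azT zbT bpT.
have [_ hT' _ pzT _] := fl; set T' := _ |: _ in fl hT'.
have pab' : p \notin [set a; b].
  by have [q1 _ q3 _] := quad_distinct hqz; rewrite !inE negb_or q1 q3.
have keep e : e \in T -> p \in e -> e != [set a; b].
  by move=> _ pe; apply: contraNneq pab' => <-.
have [|T2 [hT2 st E]] := IHn T' _ hT'.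
  rewrite -ltnS; apply: leq_trans hn; apply: proper_card; apply/properP; split.
    apply/subsetP => x; rewrite !inE !negb_or => /andP[-> /andP[_]] /=.
    rewrite negb_and => /orP[/negPn/eqP Ex|//].
    by rewrite -Ex !inE eqxx in pab'.
  by exists z; rewrite !inE 1?eq_sym pz ?pzT //= eqxx.
exists T2; split=> // e eT pe; rewrite -E //.
  by rewrite (tf_flip_other hM fl) // keep.
by rewrite !inE eT keep ?orbT.
Qed.

(** Any triangulation containing e will do; the default 1 is reached only by sets that are an edge
    of no triangulation. *)
Definition edge_elt e : F :=
  if [pick T | ideal_triangulation T && (e \in T)] is Some T
  then M T (basis_vec e) else 1.

(** Both triangulations can be flipped to the fan at an end of e without changing the element of e,
    and that fan is unique. *)
Lemma edge_eltE T e : ideal_triangulation T -> e \in T ->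
  M T (basis_vec e) = edge_elt e.
Proof.
move=> hT eT; rewrite /edge_elt; case: pickP => [T' /andP[hT' eT']|/(_ T)]; last first.
  by rewrite hT eT.
have /cards2E[p [r [pr Ee]]] := tri_card hT eT.
have pe : p \in e by rewrite Ee !inE eqxx.
have [T1 [h1 s1 E1]] := reach_star p hT; have [T2 [h2 s2 E2]] := reach_star p hT'.
by rewrite E1 // E2 // (star_tri_unique h1 h2 s1 s2).
Qed.

Lemma sum_basisE T (g : {set 'I_m} -> int) s :
  (\sum_(i in T) basis_vec i *~ g i) s = if s \in T then g s else 0.
Proof.
rewrite sum_ffunE; case: ifP => sT.
  rewrite (bigD1 s) //= vecMz basis_vecE eqxx mul1r big1 ?addr0 // => j /andP[_].
  by move=> /negbTE js; rewrite vecMz basis_vecE js mul0r.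
apply: big1 => j jT; rewrite vecMz basis_vecE; case: eqP => [E|]; last by rewrite mul0r.
by rewrite -E jT in sT.
Qed.

(** Flip ab in a triangulation containing the quadrilateral and multiply the flip relation by the
    element of ab. Separating the merged monomials gives omega^-(k + k), with k = -1 for bp, ar and
    k = 1 for pa, br. *)
Lemma quantum_ptolemy p a r b : quad p a r b ->
  edge_elt [set a; b] * edge_elt [set p; r] =
    omega ^ (2 : int) * (edge_elt [set b; p] * edge_elt [set a; r])
    + omega ^ (- 2 : int) * (edge_elt [set p; a] * edge_elt [set b; r]).
Proof.
move=> hq; have [T hT [abT paT arT rbT bpT]] := quad_extend hq.
have fl := quad_flip hT hq abT paT arT rbT bpT.
have [_ hT' _ _ _] := fl.
have brT := triU rbT.
rewrite -(edge_eltE hT' (setU11 _ _)) (tf_flip hM fl).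
have [q1 q2 q3 [q4 q5 q6]] := quad_sides hq.
have E1 : \sum_(i in T) basis_vec i *~ Num.max (eps T [set a; b] i) 0 =
    basis_vec [set b; p] + basis_vec [set a; r] :> vec m.
  apply/ffunP => s; rewrite sum_basisE vecD !basis_vecE.
  case: ifP => sT; last first.
    by rewrite !(eq_sym _ s); do ![case: eqP => [E|_]]; rewrite ?E ?arT ?bpT in sT *.
  rewrite (eps_quad hT hq) // ![_ == s]eq_sym.
  have [->|n1] := eqVneq s [set a; r].
    by rewrite (negbTE q1) (negbTE q2) (negbTE q3).
  have [->|n2] := eqVneq s [set b; p]; first by rewrite (negbTE q4) (negbTE q5).
  by case: eqP; case: eqP.
have E2 : \sum_(i in T) basis_vec i *~ Num.max (- eps T [set a; b] i) 0 =
    basis_vec [set p; a] + basis_vec [set b; r] :> vec m.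
  apply/ffunP => s; rewrite sum_basisE vecD !basis_vecE.
  case: ifP => sT; last first.
    by rewrite !(eq_sym _ s); do ![case: eqP => [E|_]]; rewrite ?E ?paT ?brT in sT *.
  rewrite (eps_quad hT hq) // ![_ == s]eq_sym.
  have [->|n1] := eqVneq s [set a; r].
    by rewrite (negbTE q1) (negbTE q2) (negbTE q3).
  have [->|n2] := eqVneq s [set b; p]; first by rewrite (negbTE q4) (negbTE q5).
  by have [->|n3] := eqVneq s [set p; a]; [rewrite (negbTE q6)|case: eqP].
rewrite {}E1 {}E2 mulrDr -!(edge_eltE hT) //.
have := quad_facts_vertex p hq; rewrite /= => /and5P[_ _ _ _ /and5P[_ _ _ _]].
case/and5P=> /eqP l1 /eqP l2 /eqP l3 /eqP l4 /and3P[/eqP l5 /eqP l6 _].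
have S e : e \in T -> supported T (basis_vec e) by apply: supported_basis.
have wU := tf_omega_unit hM.
have term e f k : e \in T -> f \in T -> lam [set a; b] e = k ->
    lam [set a; b] f = k -> lam e f = 0 ->
    M T (basis_vec [set a; b]) * M T (- basis_vec [set a; b] + (basis_vec e + basis_vec f)) =
    omega ^ (- (k + k)) * (M T (basis_vec e) * M T (basis_vec f)).
  move=> eT fT h1 h2 h3; have S2 := supportedD (S _ eT) (S _ fT).
  have S3 := supportedD (supportedN (S _ abT)) S2.
  rewrite (tf_mul hM hT (S _ abT) S3) (tf_mul hM hT (S _ eT) (S _ fT)).
  rewrite !(LamDr, LamNr) !Lam_basis // lamxx h1 h2 h3 !oppr0 expr0z mul1r add0r.
  by rewrite addrA subrr add0r.
by rewrite (term _ _ (-1)) // (term _ _ 1).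
Qed.

Lemma quantum_model T : ideal_triangulation T ->
  ptolemy_model T omega (M T) edge_elt.
Proof.
move=> hT; split.
- exact: tf_omega_unit hM.
- exact: tf_omega_central hM.
- exact: tf_0 hM T hT.
- by move=> u v; apply: (tf_mul hM).
- by move=> e eT; rewrite edge_eltE.
- exact: quantum_ptolemy.
Qed.

Lemma frame_word T v : ideal_triangulation T -> supported T v ->
  M T v = omega ^ (psum (on_letters (@lam m)) (word_of v)) * wprod edge_elt (word_of v).
Proof.
move=> hT vT; rewrite -[in LHS](wvec_of_word_of v).
rewrite (Mt_word hT (quantum_model hT)) // => x /mem_word_of[vx _].
by apply: contraR vx => /vT->.
Qed.

(** The normalised word of v does not mention the triangulation. *)
Lemma frame_indep T T' v : ideal_triangulation T -> ideal_triangulation T' ->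
  supported T v -> supported T' v -> M T v = M T' v.
Proof. by move=> hT hT' vT vT'; rewrite !frame_word. Qed.

End Frames.

(** * Resolving crossings *)

Section WordSums.

Variables (m : nat) (k : letter m -> letter m -> int).
Implicit Types (x y : letter m) (W : seq (letter m)).

Lemma csum_catr W1 W2 W3 : csum k W1 (W2 ++ W3) = csum k W1 W2 + csum k W1 W3.
Proof. by rewrite /csum -big_split; apply: eq_bigr => x _; rewrite big_cat. Qed.

Lemma psum_cat W1 W2 : psum k (W1 ++ W2) = psum k W1 + psum k W2 + csum k W1 W2.
Proof.
elim: W1 => [|x W1 IHW]; first by rewrite /csum big_nil addr0 /= add0r.
by rewrite /= IHW big_cat /csum big_cons /=; ring.
Qed.

Lemma psum2 x y : psum k [:: x; y] = k x y.
Proof. by rewrite /= big_seq1 big_nil !addr0. Qed.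

Lemma csum2r W x y : csum k W [:: x; y] = \sum_(z <- W) (k z x + k z y).
Proof. by apply: eq_bigr => z _; rewrite big_cons big_seq1. Qed.

Lemma csum2l W x y : csum k [:: x; y] W = \sum_(z <- W) (k x z + k y z).
Proof. by rewrite /csum big_cons big_seq1 big_split. Qed.

Lemma csum2rC W x y : csum k W [:: x; y] = csum k W [:: y; x].
Proof. by rewrite !csum2r; apply: eq_bigr => z _; rewrite addrC. Qed.

Lemma csum2lC W x y : csum k [:: x; y] W = csum k [:: y; x] W.
Proof. by rewrite !csum2l; apply: eq_bigr => z _; rewrite addrC. Qed.

End WordSums.

Lemma on_letters1 m (g : {set 'I_m} -> {set 'I_m} -> int) e f :
  on_letters g (e, 1) (f, 1) = g e f.
Proof. by rewrite /on_letters !mul1r. Qed.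

(** No letter between x and y crosses x, which later lets x be moved next to y. *)
Lemma find_crossing m (W : seq (letter m)) :
  (forall x y, x \in W -> y \in W -> crosses x.1 y.1 = false) \/
  exists W1 x W2 y W3, [/\ W = W1 ++ x :: W2 ++ y :: W3, crosses x.1 y.1
    & forall z, z \in W2 -> crosses x.1 z.1 = false].
Proof.
elim: W => [|x W [nc|[W1 [y [W2 [z [W3 [E h1 h2]]]]]]]]; first by left.
  have [/hasP[y0 y0W h0]|nx] := boolP (has (fun y => crosses x.1 y.1) W); last first.
    left=> y z; have N t : t \in W -> crosses x.1 t.1 = false.
      by move=> tW; apply/negbTE; have /hasPn := nx; apply.
    rewrite !inE => /orP[/eqP->|yW] /orP[/eqP->|zW].
    - exact: crossesxx.
    - exact: N.
    - by rewrite crossesC N.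
    - exact: nc.
  right; pose i := find (fun y => crosses x.1 y.1) W.
  have hi : has (fun y => crosses x.1 y.1) W by apply/hasP; exists y0.
  exists [::], x, (take i W), (nth y0 W i), (drop i.+1 W); split.
  - by rewrite /= -drop_nth ?cat_take_drop // -has_find.
  - exact: (nth_find y0 hi).
  - move=> z /(nthP y0)[j]; rewrite size_take -has_find hi => ji <-.
    rewrite nth_take //.
    exact: (@before_find _ y0 (fun y : letter m => crosses x.1 y.1) W j ji).
by right; exists (x :: W1), y, W2, z, W3; rewrite E.
Qed.

Section Resolve.

Variables (m : nat).
Hypotheses (hm : (2 < m)%N).
Variables (F : unitRingType) (omega : F).
Variables (M : {set {set 'I_m}} -> vec m -> F).
Hypothesis (hM : toric_frames omega M).
Implicit Types (x y z : letter m) (W U : seq (letter m)).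

Local Notation A := (edge_elt M).
Local Notation kmu := (on_letters (mu 2)).

(** The normalisation makes neighbouring letters that do not cross exchangeable; on a crossing-free
    word the value is the frame element of the exponent vector. *)
Definition wval W : F := omega ^ (psum kmu W) * wprod A W.

Lemma omega_comm (n : int) u : omega ^ n * u = u * omega ^ n.
Proof. by apply/esym/commrXz; rewrite /GRing.comm (tf_omega_central hM). Qed.

Lemma omegaD (n l : int) : omega ^ (n + l) = omega ^ n * omega ^ l.
Proof. by rewrite exprzDr ?(tf_omega_unit hM). Qed.

Lemma omegaM i j u v :
  (omega ^ i * u) * (omega ^ j * v) = omega ^ (i + j) * (u * v).
Proof. by rewrite mulrA -(mulrA _ u) -omega_comm mulrA -omegaD -mulrA. Qed.

Lemma wval_cat W1 W2 :
  wval (W1 ++ W2) = omega ^ (csum kmu W1 W2) * (wval W1 * wval W2).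
Proof.
rewrite /wval psum_cat /wprod big_cat /= -!/(wprod _ _).
by rewrite omegaM [in RHS]mulrA -omegaD; congr (omega ^ _ * _); ring.
Qed.

Lemma wval_ctx W1 U W3 :
  wval (W1 ++ U ++ W3) =
  omega ^ (csum kmu W1 U + csum kmu U W3 + csum kmu W1 W3) *
    (wval W1 * wval U * wval W3).
Proof.
rewrite wval_cat wval_cat csum_catr -[wval W1 in LHS]mul1r -(expr0z omega).
rewrite omegaM [in LHS]mulrA -omegaD add0r !mulrA.
by rewrite (addrAC (csum _ W1 U)).
Qed.

Lemma wval_noncrossing W T : ideal_triangulation T ->
  (forall x, x \in W -> x.1 \in T) -> wval W = M T (wvec_of W).
Proof.
move=> hT h; rewrite (Mt_word hT (quantum_model hm hM hT)) // /wval.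
congr (omega ^ _ * _).
elim: W h => //= x W IHW h; rewrite IHW; last first.
  by move=> y yW; apply: h; rewrite inE yW orbT.
congr (_ + _); rewrite big_seq [RHS]big_seq; apply: eq_bigr => y yW.
rewrite /on_letters mu_ncr // (tri_ncr hT) //; apply: h; rewrite inE ?eqxx //.
by rewrite yW orbT.
Qed.

Lemma noncrossing_word W : valid_word W ->
  (forall x y, x \in W -> y \in W -> crosses x.1 y.1 = false) ->
  exists2 T, ideal_triangulation T & forall x, x \in W -> x.1 \in T.
Proof.
move=> vW nc; have [|T hT /subsetP sT] := @tri_extend _ [set e in [seq x.1 | x <- W]].
  apply/noncrossingP; split=> [e|e f]; rewrite !inE.
    by case/mapP=> x /vW[cx _] ->.
  by case/mapP=> x xW -> /mapP[y yW ->]; apply: nc.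
by exists T => // x xW; apply: sT; rewrite inE; apply: map_f.
Qed.

Lemma wval_swap x y W1 W3 : valid_letter x -> valid_letter y ->
  crosses x.1 y.1 = false ->
  wval (W1 ++ [:: x; y] ++ W3) = wval (W1 ++ [:: y; x] ++ W3).
Proof.
move=> vx vy nxy; rewrite !wval_ctx (csum2rC _ _ y) (csum2lC _ _ y).
congr (_ * (_ * _ * _)).
have [||T hT h] := @noncrossing_word [:: x; y].
- by move=> z; rewrite !inE => /orP[] /eqP->.
- move=> z t; rewrite !inE => /orP[] /eqP-> /orP[] /eqP->; rewrite ?crossesxx //.
  by rewrite crossesC.
rewrite !(wval_noncrossing hT) //.
  by rewrite /wvec_of !big_cons !big_nil !addr0 addrC.
by move=> z zyx; apply: h; move: zyx; rewrite !inE orbC.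
Qed.

Lemma wval_move x W1 W2 W3 : valid_letter x -> valid_word W2 ->
  (forall z, z \in W2 -> crosses x.1 z.1 = false) ->
  wval (W1 ++ x :: W2 ++ W3) = wval (W1 ++ W2 ++ x :: W3).
Proof.
elim: W2 W1 => [//|y W2 IHW] W1 vx vW nc.
rewrite (wval_swap W1 (W2 ++ W3) vx (vW y (mem_head _ _)) (nc y (mem_head _ _))).
have := IHW (rcons W1 y); rewrite !cat_rcons; apply=> // z zW.
  by apply: vW; rewrite inE zW orbT.
by apply: nc; rewrite inE zW orbT.
Qed.

(** The coefficients are sums of powers of q = omega^4; resolving crossings introduces no signs. *)
Inductive qspan (B : F -> Prop) : F -> Prop :=
| qspan0 : qspan B 0
| qspanD u v : qspan B u -> qspan B v -> qspan B (u + v)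
| qspan_base (n : int) u : B u -> qspan B (omega ^ (4 * n) * u).

Lemma qspan_in (B : F -> Prop) u : B u -> qspan B u.
Proof. by move=> Bu; rewrite -[u]mul1r -(expr0z omega); apply: (@qspan_base _ 0). Qed.

Lemma qspanZ B n u : qspan B u -> qspan B (omega ^ (4 * n) * u).
Proof.
elim=> [|{}u v _ IHu _ IHv|l {}u Bu].
- by rewrite mulr0; apply: qspan0.
- by rewrite mulrDr; apply: qspanD.
- by rewrite mulrA -omegaD -mulrDr; apply: qspan_base.
Qed.

Lemma qspan_eqm4 B n l u : eqm4 n l -> qspan B (omega ^ l * u) ->
  qspan B (omega ^ n * u).
Proof.
by move=> /eqm4_dvd[j ->] h; rewrite addrC omegaD -mulrA; apply: qspanZ.
Qed.

(** [mu] is 2 on the crossing diagonals and 0 on opposite sides, so normalising multiplies omega^2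
    and omega^-2 by omega^2 and leaves the coefficients q and 1. *)
Lemma wval_ptolemy p a r b : quad p a r b ->
  wval [:: ([set a; b], 1); ([set p; r], 1)] =
    omega ^ (4 : int) * wval [:: ([set b; p], 1); ([set a; r], 1)]
    + wval [:: ([set p; a], 1); ([set b; r], 1)].
Proof.
move=> hq; have := quad_facts_vertex p hq; rewrite /=.
case/and5P=> _ x1 _ _ /and5P[_ _ n4 _ /and5P[_ _ _ _ /and3P[/eqP l5 /eqP l6 _]]].
have [k1 k2] := quad_cyc hq; have hq' : quad a r b p by rewrite /quad k1 k2.
have := quad_facts_vertex p hq'; rewrite /= => /and5P[_ _ _ _ /and5P[_ _ + _ _]].
rewrite crossesC (setUC [set r]) => n3.
rewrite /wval !psum2 /wprod !big_cons !big_nil !mulr1 !expr1z !on_letters1.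
rewrite /mu x1 (lam_crosses x1) l5 l6.
rewrite (negbTE n3) (crossesC [set b; p]) (negbTE n4) !addr0 !add0r expr0z !mul1r.
rewrite (quantum_ptolemy hm hM hq) mulrDr ![omega ^ _ * (omega ^ _ * _)]mulrA.
by rewrite -!omegaD subrr expr0z mul1r.
Qed.

Lemma quad_wdeg (p a r b t : 'I_m) : quad p a r b ->
  (t \in [set a; b])%:Z + (t \in [set p; r])%:Z =
    (t \in [set b; p])%:Z + (t \in [set a; r])%:Z :> int /\
  (t \in [set a; b])%:Z + (t \in [set p; r])%:Z =
    (t \in [set p; a])%:Z + (t \in [set b; r])%:Z :> int.
Proof.
case/quad_distinct=> q1 q2 q3 [q4 q5 q6].
have G (i j : 'I_m) : i != j -> ~~ ((t == i) && (t == j)).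
  by move=> xy; apply: contra xy => /andP[/eqP<- /eqP<-].
move: (G _ _ q1) (G _ _ q2) (G _ _ q3) (G _ _ q4) (G _ _ q5) (G _ _ q6).
by rewrite !inE; case: (t == a); case: (t == b); case: (t == p); case: (t == r).
Qed.

Definition kcr x y : int := (crosses x.1 y.1)%:Z.

Lemma psum_kcr_ge0 W : 0 <= psum kcr W.
Proof. by elim: W => //= x W IHW; rewrite addr_ge0 // sumr_ge0. Qed.

Lemma eqm4_quad (i j k l : int) : ((i + j - k - l) %% 4 = 0)%Z ->
  eqm4 (i + j) (k + l).
Proof. by rewrite /eqm4; lia. Qed.

(** The diagonals of a quadrilateral are replaced by opposite sides inside a word. Additivity of
    [mu] changes the normalising power by a multiple of 4, and the chord facts keep crossings with
    the other letters from increasing. *)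
Lemma quad_context p a r b (c d : {set 'I_m}) W1 W3 : quad p a r b ->
  (c, d) = ([set b; p], [set a; r]) \/ (c, d) = ([set p; a], [set b; r]) ->
  valid_word W1 -> valid_word W3 ->
  let U := [:: ([set a; b], 1); ([set p; r], 1)] in
  let V := [:: (c, 1); (d, 1)] in
  [/\ eqm4 (csum kmu W1 U + csum kmu U W3) (csum kmu W1 V + csum kmu V W3),
      csum kcr W1 V + csum kcr V W3 <= csum kcr W1 U + csum kcr U W3
    & valid_word V].
Proof.
move=> hq hc v1 v3 U V; have [q1 q2 q3 [q4 q5 q6]] := quad_distinct hq.
have c2 (i j : 'I_m) : i != j -> #|[set i; j]| = 2%N by move=> ij; rewrite cards2 ij.
have [k1 k2] := quad_cyc hq; have hq' : quad a r b p by rewrite /quad k1 k2.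
have [cc cd] : #|c| = 2%N /\ #|d| = 2%N.
  by case: hc => -[-> ->]; rewrite !c2 // eq_sym.
have muE (f : {set 'I_m}) : #|f| = 2%N ->
    eqm4 (mu 2 f [set a; b] + mu 2 f [set p; r]) (mu 2 f c + mu 2 f d).
  move=> cf; have := quad_facts_edge hq cf; have := quad_facts_edge hq' cf.
  rewrite /= => /andP[/eqP + _] /andP[/eqP + _].
  rewrite (setUC [set r] [set p]) (setUC [set r] [set b]).
  move=> E1 E2; case: hc => -[-> ->]; last exact: (eqm4_quad E1).
  by rewrite addrC; exact: (eqm4_quad E2).
have muE' (f : {set 'I_m}) : #|f| = 2%N ->
    eqm4 (mu 2 [set a; b] f + mu 2 [set p; r] f) (mu 2 c f + mu 2 d f).
  move=> cf; have := muE f cf; have := mu_anti cf cc; have := mu_anti cf cd.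
  have := mu_anti cf (c2 _ _ q5); have := mu_anti cf (c2 _ _ q2); rewrite /eqm4.
  move: (mu 2 f [set p; r]) (mu 2 [set p; r] f) (mu 2 f [set a; b]) (mu 2 [set a; b] f).
  by move: (mu 2 f c) (mu 2 c f) (mu 2 f d) (mu 2 d f); clear; lia.
have crE (f : {set 'I_m}) : #|f| = 2%N -> (crosses f c)%:Z + (crosses f d)%:Z <=
    (crosses f [set a; b])%:Z + (crosses f [set p; r])%:Z :> int.
  move=> cf; have := quad_facts_edge hq cf.
  rewrite /= => /and5P[_ h1 h2 _ _]; rewrite -!PoszD lez_nat.
  by case: hc => -[-> ->].
split.
- apply: eqm4D.
    rewrite !csum2r big_seq [X in eqm4 _ X]big_seq.
    apply: (big_ind2 eqm4) => [||z zW]; [exact: eqm4_refl|by move=> *; apply: eqm4D|].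
    rewrite /on_letters /= !mulr1 -!mulrDr; apply/eqm4M/muE.
    by have [] := v1 z zW.
  rewrite !csum2l big_seq [X in eqm4 _ X]big_seq.
  apply: (big_ind2 eqm4) => [||z zW]; [exact: eqm4_refl|by move=> *; apply: eqm4D|].
  rewrite /on_letters /= !mul1r -!mulrDr; apply/eqm4M/muE'.
  by have [] := v3 z zW.
- apply: lerD.
    rewrite !csum2r big_seq [X in _ <= X]big_seq; apply: ler_sum => z zW.
    by apply: crE; have [] := v1 z zW.
  rewrite !csum2l big_seq [X in _ <= X]big_seq; apply: ler_sum => z zW.
  rewrite /kcr /= !(crossesC _ z.1); apply: crE.
  by have [] := v3 z zW.
- by move=> z; rewrite !inE => /orP[] /eqP->; split=> //; left.
Qed.

Lemma psum_kcr_move x W1 W2 W3 :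
  psum kcr (W1 ++ x :: W2 ++ W3) = psum kcr (W1 ++ W2 ++ x :: W3).
Proof.
rewrite !psum_cat /= big_cat psum_cat /=.
have -> : csum kcr W1 (x :: W2 ++ W3) = csum kcr W1 (W2 ++ x :: W3).
  rewrite -cat1s -[x :: W3]cat1s !csum_catr; ring.
have -> : csum kcr W2 (x :: W3) = \sum_(z <- W2) kcr x z + csum kcr W2 W3.
  rewrite -cat1s csum_catr; congr (_ + _).
  by apply: eq_bigr => z _; rewrite big_seq1 /kcr crossesC.
by move: (psum _ _) (psum _ _) (psum _ _) (csum _ _ _) (csum _ _ _) (\sum_(_ <- _) _)
  (\sum_(_ <- _) _) => *; ring.
Qed.

Lemma wdeg_cat W1 W2 p : wdeg (W1 ++ W2) p = wdeg W1 p + wdeg W2 p.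
Proof. by rewrite /wdeg big_cat. Qed.

Lemma wdeg_cons x W p : wdeg (x :: W) p = x.2 * (p \in x.1)%:Z + wdeg W p.
Proof. by rewrite /wdeg big_cons. Qed.

Lemma wdeg_nil (p : 'I_m) : wdeg [::] p = 0.
Proof. by rewrite /wdeg big_nil. Qed.

Definition terminal (d : 'I_m -> int) (u : F) : Prop :=
  exists W, [/\ valid_word W,
    forall x y, x \in W -> y \in W -> crosses x.1 y.1 = false,
    forall p, wdeg W p = d p & u = wval W].

(** Induction on the number of crossing pairs: the Ptolemy relation removes the crossing of the
    chosen pair and creates none with the rest of the word. *)
Lemma resolve W : valid_word W -> qspan (terminal (wdeg W)) (wval W).
Proof.
suff H n W' : psum kcr W' <= n%:Z -> valid_word W' ->
    forall d, (forall p, wdeg W' p = d p) -> qspan (terminal d) (wval W').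
  move=> vW; apply: (H `|psum kcr W|%N) => //.
  by rewrite gez0_abs // psum_kcr_ge0.
elim: n W' => [|n IHn] W' hn vW d dW.
all: have [nc|[W1 [x [W2 [y [W3 [E cxy nc]]]]]]] := find_crossing W'.
- by apply: qspan_in; exists W'.
- have := psum_kcr_ge0 W1; have := psum_kcr_ge0 (x :: W2 ++ y :: W3).
  have : 0 <= csum kcr W1 (x :: W2 ++ y :: W3) by do 2!apply: sumr_ge0 => ? _.
  have : 0 < psum kcr (x :: W2 ++ y :: W3).
    rewrite /= big_cat big_cons /= {2}/kcr cxy.
    have := psum_kcr_ge0 (W2 ++ y :: W3).
    have : 0 <= \sum_(i <- W2) kcr x i by apply: sumr_ge0.
    have : 0 <= \sum_(i <- W3) kcr x i by apply: sumr_ge0.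
    by move: (\sum_(_ <- _) _) (\sum_(_ <- _) _) (psum _ _); clear; lia.
  move: hn; rewrite E psum_cat.
  by move: (psum _ _) (psum _ _) (csum _ _ _); clear; lia.
- by apply: qspan_in; exists W'.
have vx : valid_letter x by apply: vW; rewrite E !(mem_cat, inE) eqxx orbT.
have vy : valid_letter y by apply: vW; rewrite E !(mem_cat, inE) eqxx !orbT.
have v2 : valid_word W2 by move=> z zW; apply: vW; rewrite E !(mem_cat, inE) zW !orbT.
have v1 : valid_word (W1 ++ W2).
  by move=> z; rewrite mem_cat => /orP[] zW; apply: vW; rewrite E !(mem_cat, inE) zW ?orbT.
have v3 : valid_word W3 by move=> z zW; apply: vW; rewrite E !(mem_cat, inE) zW !orbT.
(* Boundary edges cross nothing, so letters that cross have exponent 1 and the Ptolemy relation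
   applies to them. *)
have sgn z t : valid_letter z -> crosses z.1 t -> z.2 = 1.
  by move=> [_ [//|[_ /boundary_ncr->]]].
have := sgn y x.1 vy; rewrite crossesC => /(_ cxy) y2; have x2 := sgn x _ vx cxy.
have [p [a [r [b [hq [Ex Ey]]]]]] : exists p a r b, quad p a r b /\
    (x.1 = [set a; b] /\ y.1 = [set p; r]).
  have [/cards2E[a [b [_ Ex]]] /cards2E[p [r [_ Ey]]]] := crosses_card cxy.
  move: cxy; rewrite Ex Ey crossesE => /orP[] /andP[h1 h2].
    have hq : quad a p b r by rewrite /quad h1 h2.
    have [h3 h4] := quad_cyc hq.
    by exists p, b, r, a; rewrite (setUC [set b]) /quad h3 h4.
  have hq : quad a r b p by rewrite /quad h1 h2.
  have [h3 h4] := quad_cyc hq.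
  by exists p, a, r, b; rewrite /quad h3 h4.
have {x2} xE : x = ([set a; b], 1) by case: x x2 Ex {E cxy nc vx} => ? ? /= -> ->.
have {y2} yE : y = ([set p; r], 1) by case: y y2 Ey {E cxy vy} => ? ? /= -> ->.
pose U := [:: x; y].
have EW : wval W' = wval ((W1 ++ W2) ++ U ++ W3).
  by rewrite E wval_move // /U -catA.
have Edeg : forall t, wdeg W' t = wdeg (W1 ++ W2) t + wdeg U t + wdeg W3 t.
  move=> t; rewrite E /U !(wdeg_cat, wdeg_cons) wdeg_nil.
  by move: (wdeg _ _) (wdeg _ _) (wdeg _ _) (_ * _) (_ * _) => *; ring.
have Ecr : psum kcr W' = psum kcr ((W1 ++ W2) ++ U ++ W3).
  by rewrite E psum_kcr_move // /U -catA.
have U1 : psum kcr U = 1 by rewrite psum2 /kcr cxy.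
have step c d' : (c, d') = ([set b; p], [set a; r]) \/
      (c, d') = ([set p; a], [set b; r]) -> crosses c d' = false ->
    qspan (terminal d) (omega ^ (csum kmu (W1 ++ W2) U + csum kmu U W3
      + csum kmu (W1 ++ W2) W3) *
      (wval (W1 ++ W2) * wval [:: (c, 1); (d', 1)] * wval W3)).
  move=> hc ncd; have := quad_context hq hc v1 v3; rewrite /= -xE -yE -/U.
  set V := [:: (c, 1); (d', 1)] => -[e1 e2 vV].
  apply: (@qspan_eqm4 _ _ (csum kmu (W1 ++ W2) V + csum kmu V W3
      + csum kmu (W1 ++ W2) W3)); first by apply: eqm4D e1 (eqm4_refl _).
  rewrite -wval_ctx; apply: IHn.
  - have V0 : psum kcr V = 0 by rewrite psum2 /kcr /= ncd.
    move: hn e2 U1 V0; rewrite Ecr !psum_cat !csum_catr.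
    move: (csum _ _ U) (csum _ _ V) (csum _ U _) (csum _ V _) (psum _ U) (psum _ V).
    by move: (csum _ _ _) (psum _ _) (psum _ W3); clear; lia.
  - move=> z; rewrite mem_cat => /orP[zW|]; first exact: v1.
    by rewrite mem_cat => /orP[zV|zW]; [apply: vV|apply: v3].
  - move=> t; rewrite -dW Edeg !wdeg_cat -!addrA; congr (_ + (_ + (_ + _))).
    rewrite /U xE yE !wdeg_cons !mul1r !wdeg_nil !addr0.
    have [E1 E2] := quad_wdeg t hq.
    by case: hc => -[-> ->].
rewrite EW wval_ctx /U xE yE (wval_ptolemy hq) -xE -yE -/U.
have comm4 (k e u v1' v2' v : F) : (forall t, k * t = t * k) ->
    e * (u * (k * v1' + v2') * v) = k * (e * (u * v1' * v)) + e * (u * v2' * v).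
  move=> h; rewrite mulrDr mulrDl mulrDr; congr (_ + _).
  by rewrite !mulrA -(h (e * u)) !mulrA.
rewrite (comm4 _ _ _ _ _ _ (omega_comm 4)).
have := quad_facts_vertex p hq; rewrite /=.
case/and5P=> _ _ _ _ /and5P[_ _ n4 _ _].
have [k1 k2] := quad_cyc hq; have hq' : quad a r b p by rewrite /quad k1 k2.
have := quad_facts_vertex p hq'; rewrite /= => /and5P[_ _ _ _ /and5P[_ _ + _ _]].
rewrite crossesC (setUC [set r]) => n3.
apply: qspanD; last by apply: step; [right|apply/negbTE].
have nbar : crosses [set b; p] [set a; r] = false by rewrite crossesC; apply/negbTE.
by have := qspanZ 1 (step [set b; p] [set a; r] (or_introl erefl) nbar); rewrite mulr1.
Qed.

End Resolve.

(** * Laminations *)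

Section Rotation.

Variable m : nat.
Hypothesis hm : (2 < m)%N.
Implicit Types (a b e f : {set 'I_m}) (x y z p : 'I_m).

Lemma cyc_ordS_mono x y z :
  cyc ltn (ordS x : nat) (ordS y) (ordS z) = cyc ltn (x : nat) y z.
Proof.
have := ltn_ord x; have := ltn_ord y; have := ltn_ord z.
have := ordSE x; have := ordSE y; have := ordSE z; clear hm.
move: (ordS x) (ordS y) (ordS z) => [x' hx] [y' hy] [z' hz]; rewrite /cyc /=.
by case: eqP => ? ->; case: eqP => ? ->; case: eqP => ? ->; lia.
Qed.

Lemma imset_ordS2 x y : @ordS m @: [set x; y] = [set ordS x; ordS y].
Proof. by rewrite imsetU1 imset_set1. Qed.

Lemma ordS_imK a : @ordS m @^-1: (@ordS m @: a) = a.
Proof.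
by apply/setP=> x; rewrite inE mem_imset //; apply: ordS_inj.
Qed.

Lemma ordS_preK e : @ordS m @: (@ordS m @^-1: e) = e.
Proof.
apply/setP=> x; apply/imsetP/idP => [[y + ->]|xe]; first by rewrite inE.
by exists (ord_pred x); rewrite ?inE ord_predK.
Qed.

Lemma card_ordS a : #|@ordS m @: a| = #|a|.
Proof. by apply: card_imset; apply: ordS_inj. Qed.

Lemma crosses_ordS a b : crosses (@ordS m @: a) (@ordS m @: b) = crosses a b.
Proof.
have [/andP[/eqP/cards2E[x [y [_ ->]]] /eqP/cards2E[z [t [_ ->]]]]|nc] :=
    boolP ((#|a| == 2%N) && (#|b| == 2%N)).
  by rewrite !imset_ordS2 !crossesE /chord_cross !cyc_ordS_mono.
case h1: (crosses (_ @: _) _).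
  by have [] := crosses_card h1; rewrite !card_ordS => ca cb; rewrite ca cb in nc.
by case h2: (crosses a b) => //; have [ca cb] := crosses_card h2; rewrite ca cb in nc.
Qed.

Lemma ccw_dist_ordS x : ccw_dist x (ordS x) = 1%N.
Proof.
have xm := ltn_ord x; have := ordSE x; rewrite ccw_distE.
by move: (ordS x) => [y hy] /=; case: eqP => E ->; case: leqP; lia.
Qed.

Lemma ccw_dist1 x y : ccw_dist x y = 1%N -> y = ordS x.
Proof.
have xm := ltn_ord x; have ym := ltn_ord y; have := ordSE x; rewrite ccw_distE.
move: (ordS x) => [z hz] /=; move=> h1 h2; apply/val_inj; move: h1 h2 => /=.
by case: eqP => E ->; case: leqP; lia.
Qed.

(** The arc around v_(i+1) joins b_i to b_(i+1) and is dragged onto the boundary edge from v_(i+1)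
    to v_(i+2). *)
Lemma special_arcE a : special_arc a = boundary_edge (@ordS m @: a).
Proof.
apply/existsP/existsP => [[i /existsP[j /andP[/eqP-> /eqP/ccw_dist1->]]]|[p]].
  by exists (ordS i); rewrite imset_ordS2.
rewrite -{1}(ord_predK p) -imset_ordS2 => /eqP/(imset_inj (@ordS_inj m)) ->.
exists (ord_pred p); apply/existsP; exists p; rewrite eqxx /=.
by rewrite -{2}(ord_predK p) ccw_dist_ordS.
Qed.

Lemma sum_ordS (K : nmodType) (G : {set 'I_m} -> K) p :
  \sum_(a : {set 'I_m} | p \in a) G (@ordS m @: a) =
  \sum_(e : {set 'I_m} | ordS p \in e) G e.
Proof.
rewrite [RHS](reindex (fun a => @ordS m @: a)) /=; last first.
  exists (fun e => @ordS m @^-1: e) => e _; [exact: ordS_imK|exact: ordS_preK].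
by apply: eq_bigl => a; rewrite mem_imset //; apply: ordS_inj.
Qed.

End Rotation.

(** The conditions on a lamination after dragging, for integer weights; integrality of the half
    crossing numbers is recovered from the vanishing degrees. *)
Definition balanced m (v : vec m) : Prop :=
  [/\ forall e, v e != 0 -> #|e| = 2%N,
      forall e f, v e != 0 -> v f != 0 -> crosses e f = false,
      forall e, ~~ boundary_edge e -> 0 <= v e
    & forall p, vdeg v p = 0].

Section Laminations.

Variable m : nat.
Hypothesis hm : (2 < m)%N.
Implicit Types (l : lamination m) (v : vec m) (p : 'I_m).

Lemma wvec_neq0 l e : (wvec l e != 0) = (val l (@ordS m @^-1: e) != 0).
Proof. by rewrite -[RHS]/(curve_weight l e != 0) -wvecE intr_eq0. Qed.

Lemma wvec_balanced l : balanced (wvec l).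
Proof.
have /and5P[/forallP h1 /forallP h2 /forallP h3 /forallP h4 _] := valP l.
have E (e : {set 'I_m}) : @ordS m @: (@ordS m @^-1: e) = e by apply: ordS_preK.
split=> [e|e f|e|p].
- rewrite wvec_neq0 => /(implyP (h1 _)) /eqP.
  by rewrite -card_ordS E.
- rewrite !wvec_neq0 => he hf; rewrite -(E e) -(E f) crosses_ordS; apply/negbTE.
  by apply: (implyP (forallP (h2 _) _)); rewrite he hf.
- rewrite -{1}(E e) -special_arcE // => /(implyP (h3 _)).
  by rewrite -[val l _]/(curve_weight l e) -wvecE ler0z.
- apply/eqP; rewrite -(intr_eq0 rat) /vdeg -[p](ord_predK p) -sum_ordS.
  rewrite rmorph_sum /=; apply/eqP; rewrite -[RHS](eqP (h4 (ord_pred p))).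
  by apply: eq_bigr => a _; rewrite wvecE /curve_weight ordS_imK.
Qed.

Lemma arc_crosses_pair (x y p r : 'I_m) : x != y -> (p < r)%N ->
  arc_crosses_edge [set x; y] [set p; r] = (p <= x < r)%N (+) (p <= y < r)%N.
Proof.
move=> nxy pr; apply/existsP/idP => [[i /existsP[j /existsP[p' /existsP[r']]]]|h].
  rewrite !set2_eq => /and5P[h1 h2 pr' si sj].
  have {h2} [Ep Er] : p = p' /\ r = r'.
    by case/orP: h2 => /andP[/eqP E1 /eqP E2]; subst => //; move: pr pr'; clear; lia.
  by subst p' r'; case/orP: h1 => /andP[/eqP-> /eqP->]; rewrite si (negbTE sj).
have [hx|hx] := boolP (p <= x < r)%N.
  exists x; apply/existsP; exists y; apply/existsP; exists p; apply/existsP; exists r.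
  by rewrite !eqxx pr hx /=; move: h; rewrite hx.
exists y; apply/existsP; exists x; apply/existsP; exists p; apply/existsP; exists r.
by rewrite setUC !eqxx pr hx andbT /=; move: h; rewrite (negbTE hx).
Qed.

Lemma sum_indicator (S : pred 'I_m) (x y : 'I_m) : x != y ->
  \sum_(z : 'I_m | S z) (z \in [set x; y])%:Z = (S x)%:Z + (S y)%:Z :> int.
Proof.
move=> nxy; rewrite big_mkcond /= (bigD1 x) //= (bigD1 y) 1?eq_sym //= !inE !eqxx orbT.
rewrite big1 ?addr0; first by case: (S x); case: (S y).
by move=> z /andP[/negbTE zx /negbTE zy]; rewrite !inE zx zy if_same.
Qed.

(* The arcs inside an interval of boundary edges contribute twice, those that
   leave it once, to the vanishing total weight of the ends on the interval. *)
Lemma even_crossings (n : {set 'I_m} -> int) (e : {set 'I_m}) :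
  (forall a, n a != 0 -> #|a| = 2%N) ->
  (forall p, \sum_(a : {set 'I_m} | p \in a) n a = 0) -> #|e| = 2%N ->
  exists k, \sum_(a | arc_crosses_edge a e) n a = 2 * k.
Proof.
move=> n2 n0 /cards2E[p0 [r0 [npr Ee]]].
have {npr Ee} [p [r [pr ->]]] : exists p r : 'I_m, (p < r)%N /\ e = [set p; r].
  have [h|h|h] := ltngtP p0 r0; [by exists p0, r0|by exists r0, p0; rewrite setUC|].
  by rewrite (val_inj h) eqxx in npr.
pose S (x : 'I_m) := (p <= x < r)%N.
exists (- \sum_(a : {set 'I_m} | [forall x in a, S x]) n a).
have : \sum_(x | S x) \sum_(a : {set 'I_m} | x \in a) n a = 0 by apply: big1.
rewrite (exchange_big_dep xpredT) //=.
under eq_bigr => a _ do rewrite big_mkcondr /=.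
move=> H; apply/eqP; rewrite mulrN -addr_eq0 -[X in _ == X]H; apply/eqP.
rewrite mulr_sumr big_mkcond [X in _ + X]big_mkcond -big_split /=.
apply: eq_bigr => a _.
have [->|/n2/cards2E[x [y [nxy ->]]]] := eqVneq (n a) 0.
  by rewrite mulr0 !if_same big1 // => z _; rewrite if_same.
have -> : \sum_(z | S z) (if z \in [set x; y] then n [set x; y] else 0) =
    n [set x; y] * ((S x)%:Z + (S y)%:Z).
  rewrite -(sum_indicator S nxy) mulr_sumr; apply: eq_bigr => z _.
  by case: ifP; rewrite ?mulr1 ?mulr0.
rewrite arc_crosses_pair // -/(S x) -/(S y).
have -> : [forall z in [set x; y], S z] = S x && S y.
  apply/forall_inP/andP => [h|[hx hy] z]; first by rewrite !h // !inE eqxx ?orbT.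
  by rewrite !inE => /orP[] /eqP->.
case: (S x); case: (S y) => /=; rewrite ?addr0 ?add0r ?mulr1 ?mulr0 //.
by rewrite mulrC.
Qed.

Lemma balanced_lamination v : balanced v -> exists l, wvec l = v.
Proof.
move=> [v1 v2 v3 v4].
pose W : {ffun {set 'I_m} -> rat} := [ffun a => (v (@ordS m @: (a : {set 'I_m})))%:~R].
have WE (a : {set 'I_m}) : W a = (v (@ordS m @: a))%:~R by rewrite ffunE.
have W0 (a : {set 'I_m}) : (W a != 0) = (v (@ordS m @: a) != 0) by rewrite WE intr_eq0.
have hW : is_lamination W.
  apply/and5P; split.
  - apply/forallP => a; apply/implyP; rewrite W0 => /v1.
    by rewrite card_ordS => ->.
  - apply/forallP => a; apply/forallP => b; apply/implyP; rewrite !W0 => /andP[ha hb].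
    by rewrite -crosses_ordS v2.
  - apply/forallP => a; apply/implyP; rewrite special_arcE // => /v3.
    by rewrite WE ler0z.
  - apply/forallP => p; apply/eqP.
    under eq_bigr => a _ do rewrite WE.
    by rewrite -rmorph_sum /= sum_ordS -/(vdeg v (ordS p)) v4.
  - apply/forallP => T; apply/implyP => hT; apply/forall_inP => e eT.
    under eq_bigr => a _ do rewrite WE.
    rewrite -rmorph_sum /=.
    have [||k ->] := @even_crossings
      (fun a : {set 'I_m} => v (@ordS m @: a)) e _ _ (tri_card hT eT).
    + by move=> a /v1; rewrite card_ordS.
    + by move=> p; rewrite sum_ordS; apply: v4.
    by rewrite rmorphM /= mulKf ?intr_int.
exists (exist _ W hW); apply/ffunP => e; apply/eqP.
rewrite -(eqr_int rat) wvecE /curve_weight /= WE ordS_preK; exact: eqxx.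
Qed.

Lemma word_of_valid v : balanced v -> valid_word (word_of v).
Proof.
move=> [v1 _ v3 _] x /mem_word_of[vx Ex]; split; first exact: v1.
rewrite Ex; move: vx; rewrite neq_lt => /orP[h|h]; [right|left]; last exact: gtr0_sg.
split; first exact: ltr0_sg.
by apply: contraLR h => /v3; rewrite -leNgt.
Qed.

Lemma adapted_supported l T : adapted l T -> supported T (wvec l).
Proof.
move=> [_ h] e; apply: contraNeq; rewrite wvec_neq0 => he.
exact: h.
Qed.

End Laminations.

(** * Laurent polynomials as signed lists of monomials *)

Section SignedLists.

Variable K : choiceType.
Implicit Types (s : seq (int * (int * K))) (c : {fsfun K -> laurent with laurent0}).

(** An entry (n, (k, a)) stands for n z^k g(a), and the same (k, a) may occur several times. *)
Definition coef_of s (k : int) (a : K) : int := \sum_(t <- s | t.2 == (k, a)) t.1.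

Definition seval (B : unitRingType) (z : B) (g : K -> B) s : B :=
  \sum_(t <- s) t.1%:~R * z ^ t.2.1 * g t.2.2.

Definition fseval (B : unitRingType) (z : B) (g : K -> B) c : B :=
  \sum_(a <- finsupp c) laurent_eval z (c a) * g a.

Lemma laurent_eval_incl (B : unitRingType) (z : B) (f : laurent) (D : {fset int}) :
  (forall k, f k != 0 -> k \in D) ->
  laurent_eval z f = \sum_(k <- D) (f k)%:~R * z ^ k.
Proof.
move=> h; apply: big_fset_incl => [|k _]; last first.
  by rewrite memNfinsupp => /eqP->; rewrite mul0r.
by apply/fsubsetP => k; rewrite mem_finsupp; apply: h.
Qed.

Lemma laurent_eval0 (B : unitRingType) (z : B) : laurent_eval z laurent0 = 0.
Proof. by rewrite /laurent_eval /laurent0 finsupp0 big_nil. Qed.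

Lemma fseval_incl (B : unitRingType) (z : B) g c (D : {fset K}) :
  (forall a, c a != laurent0 -> a \in D) ->
  fseval z g c = \sum_(a <- D) laurent_eval z (c a) * g a.
Proof.
move=> h; apply: big_fset_incl => [|a _]; last first.
  by rewrite memNfinsupp => /eqP->; rewrite laurent_eval0 mul0r.
by apply/fsubsetP => a; rewrite mem_finsupp; apply: h.
Qed.

Lemma coef_of_neq0 s k a : coef_of s k a != 0 ->
  exists t, t \in s /\ t.2 = (k, a).
Proof.
rewrite /coef_of => h; have [/hasP[t ts /eqP E]|/hasPn n] :=
  boolP (has (fun t => t.2 == (k, a)) s); first by exists t.
move: h; rewrite big_seq_cond big_pred0 ?eqxx // => t.
by apply/negbTE; rewrite negb_and -implybE; apply/implyP/n.
Qed.

(** Like terms are gathered once for all rings: the same coefficients then serve at q in the skew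
    field and at 1 in the complex numbers. *)
Lemma collect s : exists c,
  [/\ forall a k, c a k = coef_of s k a,
      forall a, a \in finsupp c -> exists2 t, t \in s & t.2.2 = a
    & forall (B : unitRingType) (z : B) g, seval z g s = fseval z g c].
Proof.
pose DK := [fset t.2.1 | t in s]%fset; pose DA := [fset t.2.2 | t in s]%fset.
pose row a : laurent := [fsfun k in DK => coef_of s k a].
pose c : {fsfun K -> laurent with laurent0} := [fsfun a in DA => row a].
have inK t : t \in s -> t.2.1 \in DK by move=> ts; apply/imfsetP; exists t.
have inA t : t \in s -> t.2.2 \in DA by move=> ts; apply/imfsetP; exists t.
have cE a k : c a k = coef_of s k a.
  have [/eqP h|h] := boolP (coef_of s k a == 0).
    rewrite h fsfunE; case: ifP => _; last by rewrite fsfunE.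
    by rewrite fsfunE h if_same.
  have [t [ts Et]] := coef_of_neq0 h.
  have kD : k \in DK by have := inK t ts; rewrite Et.
  have aD : a \in DA by have := inA t ts; rewrite Et.
  by rewrite fsfunE aD fsfunE kD.
exists c; split=> // [a|B z g].
  rewrite mem_finsupp fsfunE; case: ifP => [/imfsetP[t /= ts ->] _|]; first by exists t.
  by rewrite eqxx.
rewrite (@fseval_incl B z g c DA); last first.
  by move=> a; rewrite fsfunE; case: ifP => // _; rewrite eqxx.
have rowE a : laurent_eval z (c a) = \sum_(k <- DK) (coef_of s k a)%:~R * z ^ k.
  rewrite (@laurent_eval_incl B z (c a) DK); first by apply: eq_bigr => k _; rewrite cE.
  by move=> k; rewrite cE => /coef_of_neq0[t [ts Et]]; have := inK t ts; rewrite Et.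
under [RHS]eq_bigr => a _ do rewrite rowE mulr_suml.
have term a k : (coef_of s k a)%:~R * z ^ k * g a =
    \sum_(t <- s) if t.2 == (k, a) then t.1%:~R * z ^ t.2.1 * g t.2.2 else 0.
  rewrite /coef_of rmorph_sum /= !mulr_suml big_mkcond /=.
  by apply: eq_bigr => t _; case: eqP => [->|].
under [RHS]eq_bigr => a _ do under eq_bigr => k _ do rewrite term.
under [RHS]eq_bigr => a _ do rewrite exchange_big.
rewrite exchange_big /= /seval big_seq [RHS]big_seq; apply: eq_bigr => t ts.
rewrite (big_fsetD1 t.2.2) ?inA //= (big_fsetD1 t.2.1) ?inK //=.
rewrite -surjective_pairing eqxx.
rewrite big1_seq ?addr0; last first.
  move=> k /andP[_]; rewrite in_fsetD1 => /andP[/negbTE kt _].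
  by case: eqP => // /(congr1 fst) /= E; rewrite -E eqxx in kt.
rewrite big1_seq ?addr0 // => a /andP[_]; rewrite in_fsetD1 => /andP[/negbTE at_ _].
rewrite big1 // => k _.
by case: eqP => // /(congr1 snd) /= E; rewrite -E eqxx in at_.
Qed.

Lemma fs_ext c c' : (forall a k, c a k = c' a k) -> c = c'.
Proof. by move=> h; apply/fsfunP => a; apply/fsfunP => k; apply: h. Qed.

Lemma seval_eq s s' : (forall k a, coef_of s k a = coef_of s' k a) ->
  forall (B : unitRingType) (z : B) g, seval z g s = seval z g s'.
Proof.
move=> h B z g; have [c [c1 _ c2]] := collect s; have [c' [c1' _ c2']] := collect s'.
by rewrite c2 c2' (fs_ext (_ : forall a k, c a k = c' a k)) // => a k; rewrite c1 c1'.
Qed.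

Lemma uncollect c : exists s, 
  [/\ forall k a, coef_of s k a = c a k,
      forall t, t \in s -> t.2.2 \in finsupp c
    & forall (B : unitRingType) (z : B) g, seval z g s = fseval z g c].
Proof.
pose s := [seq (c a k, (k, a)) | a <- finsupp c, k <- finsupp (c a)].
have sE k a : coef_of s k a = c a k.
  rewrite /coef_of big_mkcond big_allpairs_dep /=.
  have [aS|aS] := boolP (a \in finsupp c); last first.
    rewrite big1_seq; first by rewrite (fsfun_dflt aS) fsfun_dflt // finsupp0.
    move=> b /andP[_ bS]; rewrite big1 // => l _.
    by case: eqP => // -[_ E]; rewrite -E bS in aS.
  rewrite (big_fsetD1 a) //= [X in _ + X]big1_seq ?addr0; last first.
    move=> b /andP[_]; rewrite in_fsetD1 => /andP[/negbTE ba _]; rewrite big1 // => l _.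
    by case: eqP => // -[_ E]; rewrite E eqxx in ba.
  have [kS|kS] := boolP (k \in finsupp (c a)); last first.
    rewrite (fsfun_dflt kS) big1_seq // => l /andP[_ lS].
    by case: eqP => // -[E]; rewrite -E lS in kS.
  rewrite (big_fsetD1 k) //= eqxx big1_seq ?addr0 // => l /andP[_].
  rewrite in_fsetD1 => /andP[/negbTE lk _].
  by case: eqP => // -[E]; rewrite E eqxx in lk.
exists s; split=> // [t /allpairsPdep[a [k [aS _ ->]]] //|B z g].
rewrite /seval big_allpairs_dep /=; apply: eq_bigr => a _.
by rewrite /laurent_eval mulr_suml.
Qed.

Lemma coef_of_cat s s' k a : coef_of (s ++ s') k a = coef_of s k a + coef_of s' k a.
Proof. by rewrite /coef_of big_cat. Qed.

Definition sopp s := [seq (- t.1, t.2) | t <- s].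

Lemma coef_of_opp s k a : coef_of (sopp s) k a = - coef_of s k a.
Proof. by rewrite /coef_of /sopp big_map sumrN. Qed.

Lemma seval_cat (B : unitRingType) (z : B) g s s' :
  seval z g (s ++ s') = seval z g s + seval z g s'.
Proof. by rewrite /seval big_cat. Qed.

Lemma seval_opp (B : unitRingType) (z : B) g s : seval z g (sopp s) = - seval z g s.
Proof.
rewrite /seval /sopp big_map -sumrN; apply: eq_bigr => t _ /=.
by rewrite rmorphN !mulNr.
Qed.

End SignedLists.

Section Free.

Variables (m : nat) (T : {set {set 'I_m}}) (hT : ideal_triangulation T).
Variables (F : unitRingType) (omega : F) (M : {set {set 'I_m}} -> vec m -> F).
Hypothesis (hM : toric_frames omega M).

Lemma frame_free (s s' : seq (int * (int * vec m))) :
  (forall t, t \in s -> supported T t.2.2) ->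
  (forall t, t \in s' -> supported T t.2.2) ->
  seval omega (M T) s = seval omega (M T) s' ->
  forall k v, coef_of s k v = coef_of s' k v.
Proof.
move=> h h' E k v; have [c [c1 c2 c3]] := collect (s ++ sopp s').
have c0 : c = [fsfun].
  apply: (tf_free hM hT).
    move=> u /c2[t ts <-]; move: ts; rewrite mem_cat => /orP[/h//|].
    by case/mapP=> t' /h' ? ->.
  have := c3 F omega (M T); rewrite /fseval /torus_eval => <-.
  by rewrite seval_cat seval_opp E subrr.
have := c1 v k; rewrite c0 coef_of_cat coef_of_opp.
rewrite fsfun0E /laurent0 fsfun0E => /esym/eqP.
by rewrite subr_eq0 => /eqP.
Qed.

End Free.

(** * Monomials in the X's inside the torus *)

Section Monomials.

Variables (m : nat) (T : {set {set 'I_m}}).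
Hypotheses (hm : (2 < m)%N) (hT : ideal_triangulation T).
Variables (n : nat) (J : 'I_n -> {set 'I_m}).
Hypotheses (J_inj : injective J)
  (J_onto : forall e, e \in internal_edges T <-> exists i, J i = e).
Implicit Types (a b : {ffun 'I_n -> int}) (i j : 'I_n).

Definition xcomb a : vec m := \sum_(i < n) xvec T (J i) *~ a i.

(** The power of q that turns the ordered monomial X_1^a_1 ... X_n^a_n into a frame element. *)
Definition xshift a : int :=
  - \sum_(i < n) \sum_(j < n | (i < j)%N) eps T (J i) (J j) * a i * a j.

Lemma J_internal i : J i \in internal_edges T.
Proof. by apply/J_onto; exists i. Qed.

Lemma J_tri i : J i \in T.
Proof. by have := J_internal i; rewrite inE => /andP[]. Qed.

Lemma supported_xcomb a : supported T (xcomb a).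
Proof. by apply: supported_sum => i _; apply/supportedMz/supported_xvec. Qed.

(** Exponents are recovered from pairings: this gives injectivity of [xcomb] and turns lower bounds
    on pairings into upper bounds on exponents. *)
Lemma Lam_basis_xcomb i a : Lam T (basis_vec (J i)) (xcomb a) = - (4 * a i).
Proof.
have E j : Lam T (xvec T (J j)) (basis_vec (J i)) = if j == i then 4 else 0.
  rewrite (Lam_xvec_basis hm hT (J_internal j) (J_tri i)) eq_sym.
  by rewrite (inj_eq J_inj).
rewrite (Lam_anti hT) /xcomb Lam_suml; congr (- _).
transitivity (\sum_(j < n) (if j == i then 4 * a i else 0)); last first.
  by rewrite -big_mkcond big_pred1_eq.
apply: eq_bigr => j _; rewrite LamMzl E.
by case: (eqVneq j i) => [->|_]; rewrite ?mul0r.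
Qed.

Lemma xcomb_inj a b : xcomb a = xcomb b -> a = b.
Proof.
move=> E; apply/ffunP => i; have := Lam_basis_xcomb i a; rewrite E Lam_basis_xcomb.
by move=> /oppr_inj/(mulfI (isT : 4 != 0 :> int)).
Qed.

Lemma xspan_xcomb v : xspan T v -> exists a, v = xcomb a.
Proof.
move=> [b ->]; exists [ffun i => b (J i)].
have E : internal_edges T = [set J i | i in 'I_n].
  apply/setP => e; apply/idP/imsetP => [/J_onto[i <-]|[i _ ->]]; first by exists i.
  exact: J_internal.
rewrite E big_imset /=; last by move=> i j _ _; apply: J_inj.
by apply: eq_bigr => i _; rewrite ffunE.
Qed.

Lemma Lam_xspan u v : xspan T u -> supported T v -> eqm4 (Lam T u v) 0.
Proof.
move=> /xspan_xcomb[a ->] vT; rewrite /xcomb Lam_suml.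
elim/big_ind: _ => [|x y hx hy|i _]; first exact: eqm4_refl.
  by rewrite -[0]addr0; apply: eqm4D.
rewrite LamMzl Lam_xvec ?J_internal //; apply/eqm4_dvd.
by exists (v (J i) * a i); rewrite add0r mulrA.
Qed.

Variables (F : unitRingType) (w : F) (Mt : vec m -> F) (A : {set 'I_m} -> F).
Hypothesis (pm : ptolemy_model T w Mt A).

Lemma Mt_sum (I : Type) (u : I -> vec m) (r : seq I) :
  (forall k, supported T (u k)) ->
  Mt (\sum_(k <- r) u k) =
  w ^ ((fix ps r := if r is k :: r' then \sum_(l <- r') Lam T (u k) (u l) + ps r'
        else 0) r) * \prod_(k <- r) Mt (u k).
Proof.
move=> hu; elim: r => [|k r IHr]; first by rewrite !big_nil (pm_0 pm) expr0z mulr1.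
rewrite !big_cons (MtD pm) //; last exact: supported_sum.
rewrite IHr Lam_sumr (wzD pm) -mulrA; congr (_ * _).
by rewrite [LHS]mulrA -(wz_comm pm) -mulrA.
Qed.

Lemma pairs_sorted (f : 'I_n -> 'I_n -> int) (r : seq 'I_n) :
  sorted ltn [seq val i | i <- r] ->
  (fix ps r := if r is i :: r' then \sum_(j <- r') f i j + ps r' else 0) r =
  \sum_(i <- r) \sum_(j <- r | (i < j)%N) f i j.
Proof.
elim: r => [|i r IHr] sr; first by rewrite big_nil.
have lt_i j : j \in r -> (i < j)%N.
  move=> jr; have := order_path_min ltn_trans sr => /allP; apply.
  by apply: map_f.
rewrite IHr ?(path_sorted sr) // big_cons; congr (_ + _).
  rewrite big_cons ltnn [RHS]big_mkcond big_seq [RHS]big_seq.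
  by apply: eq_bigr => j /lt_i ->.
rewrite big_seq [RHS]big_seq; apply: eq_bigr => j jr.
by rewrite big_cons ltnNge ltnW ?lt_i.
Qed.

(** [Lam] of two X-exponents is -4 [eps], so merging the ordered product collects -4 [eps] a_i a_j
    over i < j. *)
Lemma Mt_xcomb a :
  Mt (xcomb a) = w ^ (4 * xshift a) * monomial (fun i => Mt (xvec T (J i))) a.
Proof.
rewrite /xcomb Mt_sum; last by move=> i; apply/supportedMz/supported_xvec.
rewrite (@pairs_sorted (fun i j => Lam T (xvec T (J i) *~ a i) (xvec T (J j) *~ a j)));
  last by rewrite /index_enum -enumT val_enum_ord iota_ltn_sorted.
congr (w ^ _ * _); last first.
  by apply: eq_bigr => i _; rewrite (MtMz hT pm) //; apply: supported_xvec.
rewrite /xshift mulrN mulr_sumr -sumrN; apply: eq_bigr => i _.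
rewrite mulr_sumr -sumrN; apply: eq_bigr => j _.
by rewrite LamMzl LamMzr Lam_xvec_xvec ?J_internal //; ring.
Qed.

End Monomials.

(** * The classical coordinates *)

Section Classical.

Variables (m : nat) (R : realType).
Local Notation C := R[i].
Implicit Types (v : 'I_m -> 'cV[C]_2) (e : {set 'I_m}) (p r : 'I_m).

Definition cross2 (x y : 'cV[C]_2) : C :=
  x ord0 ord0 * y ord_max ord0 - x ord_max ord0 * y ord0 ord0.

Lemma det_mx2 (K : comNzRingType) (B : 'M[K]_2) :
  \det B = B ord0 ord0 * B ord_max ord_max - B ord0 ord_max * B ord_max ord0.
Proof.
rewrite (expand_det_row _ ord0) !big_ord_recl big_ord0 addr0 /cofactor !det_mx11 !mxE.
have E (i : 'I_1) : lift ord0 i = ord_max :> 'I_2 by rewrite ord1; apply/val_inj.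
have E' : lift ord_max ord0 = ord0 :> 'I_2 by apply/val_inj.
by rewrite !E E' /= expr0 expr1 mul1r mulN1r mulrN.
Qed.

Lemma det_cross2 (x y : 'cV[C]_2) : \det (row_mx x y : 'M_2) = cross2 x y.
Proof.
have E0 i : (row_mx x y : 'M_2) i ord0 = x i ord0.
  by rewrite -(row_mxEl x y); congr (row_mx _ _ _ _); apply/val_inj.
have E1 i : (row_mx x y : 'M_2) i ord_max = y i ord0.
  by rewrite -(row_mxEr x y); congr (row_mx _ _ _ _); apply/val_inj.
by rewrite det_mx2 !E0 !E1 /cross2 [y ord0 ord0 * _]mulrC.
Qed.

Lemma Acoord2 v p r : (p < r)%N -> Acoord v [set p; r] = cross2 (v p) (v r).
Proof.
move=> pr; rewrite /Acoord (big_pred1 (p, r)); first exact: det_cross2.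
move=> [x y] /=; rewrite set2_eq xpair_eqE; apply/andP/andP.
  by case=> xy /orP[] /andP[/eqP E1 /eqP E2]; subst => //; move: xy pr; clear; lia.
by case=> /eqP-> /eqP->; rewrite !eqxx pr.
Qed.

Lemma quad_cases p a r b : quad p a r b ->
  [\/ (p < a < r)%N && (r < b)%N, (a < r < b)%N && (b < p)%N,
      (r < b < p)%N && (p < a)%N | (b < p < a)%N && (a < r)%N].
Proof.
move=> h; apply/or4P; move: h; rewrite /quad /cyc /=; clear; lia.
Qed.

(** The Plucker relation for 2 x 2 determinants. Their sign is fixed by the numbering, so the four
    positions of the smallest label are each reduced to an increasing quadruple. *)
Lemma classical_ptolemy v p a r b : quad p a r b ->
  Acoord v [set a; b] * Acoord v [set p; r] =
  Acoord v [set b; p] * Acoord v [set a; r] + Acoord v [set p; a] * Acoord v [set b; r].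
Proof.
have H (x y z t : 'I_m) : (x < y < z)%N && (z < t)%N ->
    Acoord v [set y; t] * Acoord v [set x; z] =
    Acoord v [set x; t] * Acoord v [set y; z] + Acoord v [set x; y] * Acoord v [set z; t].
  case/andP=> /andP[xy yz] zt.
  rewrite !Acoord2 //; try (by move: xy yz zt; clear; lia); rewrite /cross2; ring.
case/quad_cases=> /H E.
- by rewrite (setUC [set b] [set p]) (setUC [set b] [set r]) E.
- rewrite (setUC [set p] [set r]) (setUC [set p] [set a]) (setUC [set b] [set r]).
  by rewrite mulrC E; ring.
- rewrite (setUC [set a] [set b]) (setUC [set p] [set r]) (setUC [set a] [set r]).
  by rewrite (setUC [set b] [set r]) E; ring.
- by rewrite (setUC [set a] [set b]) mulrC E; ring.
Qed.

Definition Cmono (T : {set {set 'I_m}}) v (u : vec m) : C := \prod_(e in T) Acoord v e ^ u e.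

Lemma classical_model (T : {set {set 'I_m}}) v : (forall e, e \in T -> Acoord v e != 0) ->
  ptolemy_model T 1 (Cmono T v) (Acoord v).
Proof.
move=> h; split=> [|x||u u' _ _|e eT|p a r b hq].
- exact: unitr1.
- by rewrite mul1r mulr1.
- by rewrite /Cmono big1 // => e _; rewrite ffunE expr0z.
- rewrite exp1rz mul1r /Cmono -big_split; apply: eq_bigr => e eT.
  by rewrite vecD expfzDr ?h.
- rewrite /Cmono (bigD1 e) //= basis_vecE eqxx expr1z big1 ?mulr1 //.
  by move=> f /andP[_ /negbTE fe]; rewrite basis_vecE eq_sym fe expr0z.
- by rewrite !exp1rz !mul1r classical_ptolemy.
Qed.

Lemma exprz_sg (B : unitRingType) (x : B) (k : int) :
  (x ^ Num.sg k) ^+ `|k|%N = x ^ k.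
Proof.
case: k => [[|k]|k]; first by rewrite sgr0 !expr0z.
  by rewrite gtr0_sg // expr1z.
by rewrite ltr0_sg // NegzE abszN exprN1 exprVn -exprnN.
Qed.

Lemma wprod_word_of (B : comUnitRingType) (A : {set 'I_m} -> B) (u : vec m) :
  wprod A (word_of u) = \prod_(e : {set 'I_m}) A e ^ u e.
Proof.
rewrite /wprod word_of_prod; apply: eq_bigr => e _.
exact: exprz_sg.
Qed.

(** * Vectors with prescribed edge values *)

Section Realization.

Variables (T : {set {set 'I_m}}) (hm : (2 < m)%N) (hT : ideal_triangulation T).
Variable B : {set 'I_m} -> C.
Hypothesis B0 : forall e, e \in T -> B e != 0.

Lemma eq_Acoord v v' e : #|e| = 2%N -> {in e, v =1 v'} -> Acoord v e = Acoord v' e.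
Proof.
move=> ce E; apply: eq_bigr => -[x y] /andP[_ /eqP Ee] /=.
by rewrite !E ?Ee ?inE ?eqxx ?orbT.
Qed.

(** The end vectors are prescribed in advance, so that two polygons can be glued at a common
    vertex. *)
Definition realizable p r : Prop :=
  forall vp vr, cross2 vp vr = B [set p; r] -> exists v, [/\ v p = vp, v r = vr
    & forall e, e \in T -> inside p r e -> Acoord v e = B e].

Lemma realize_interval p r : (p < r)%N -> [set p; r] \in T -> realizable p r.
Proof.
apply: (tri_interval_ind hm hT) => {p r} [p r prT E|p a r pa ar paT arT prT Qpa Qar].
  move=> vp vr hB; have pr : (p < r)%N by rewrite E.
  have rp : r != p by apply: contraTneq pr => ->; rewrite ltnn.
  exists (fun x => if x == p then vp else vr); rewrite eqxx (negbTE rp); split=> // e eT.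
  have /cards2E[x [y [nxy Ee]]] := tri_card hT eT; rewrite {}Ee in eT *.
  rewrite inside2 => h; have -> : [set x; y] = [set p; r].
    apply/eqP; rewrite set2_eq -!val_eqE /=; move: nxy h; rewrite -val_eqE /= E.
    by clear; lia.
  by rewrite Acoord2 // eqxx (negbTE rp).
(* Cramer's rule for det(vp, va) = B_pa and det(va, vr) = B_ar; this is where B_pr must not
   vanish. *)
move=> vp vr hB; pose va := (B [set p; r])^-1 *: (B [set a; r] *: vp + B [set p; a] *: vr).
have nz := B0 prT.
have [v1 [v1p v1a h1]] : exists v, [/\ v p = vp, v a = va
    & forall e, e \in T -> inside p a e -> Acoord v e = B e].
  apply: Qpa; have -> : cross2 vp va = (B [set p; r])^-1 * B [set p; a] * cross2 vp vr.
    by rewrite /cross2 !mxE; ring.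
  by rewrite hB mulrAC mulVf ?mul1r.
have [v2 [v2a v2r h2]] : exists v, [/\ v a = va, v r = vr
    & forall e, e \in T -> inside a r e -> Acoord v e = B e].
  apply: Qar; have -> : cross2 va vr = (B [set p; r])^-1 * B [set a; r] * cross2 vp vr.
    by rewrite /cross2 !mxE; ring.
  by rewrite hB mulrAC mulVf ?mul1r.
exists (fun x : 'I_m => if (x <= a)%N then v1 x else v2 x).
rewrite (ltnW pa) leqNgt ar /=; split=> // e eT he.
have ce := tri_card hT eT.
case/or3P: (inside_cases hm hT pa ar paT arT eT he) => [/eqP->|h|h].
- by rewrite Acoord2 ?(ltn_trans pa ar) // (ltnW pa) leqNgt ar v1p v2r.
- rewrite -h1 //; apply: eq_Acoord => // x xe.
  by have /forall_inP/(_ x xe)/andP[_ ->] := h.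
- rewrite -h2 //; apply: eq_Acoord => // x xe.
  have /forall_inP/(_ x xe)/andP[ax _] := h; case: ifP => // xa.
  have -> : x = a by apply/val_inj/eqP; rewrite eqn_leq xa.
  by rewrite v1a v2a.
Qed.

Lemma realize : exists v, forall e, e \in T -> Acoord v e = B e.
Proof.
have m0 : (0 < m)%N by move: hm; case: (m).
have m1 : (m.-1 < m)%N by rewrite prednK.
pose p := Ordinal m0; pose r := Ordinal m1.
have prT : [set p; r] \in T.
  apply: boundary_tri => //; apply/existsP; exists r; rewrite setUC.
  apply/eqP; congr [set _; _]; apply/val_inj.
  by rewrite [RHS]ordSE /= prednK // eqxx.
have pr : (p < r)%N by rewrite /=; move: hm; clear; lia.
pose vp : 'cV[C]_2 := \col_i (if i == ord0 then 1 else 0).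
pose vr : 'cV[C]_2 := \col_i (if i == ord0 then 0 else B [set p; r]).
have [|v [_ _ h]] := realize_interval pr prT (_ : cross2 vp vr = B [set p; r]).
  by rewrite /cross2 !mxE /= mul1r mul0r subr0.
exists v => e eT; apply: h => //; apply/forall_inP => x _ /=.
by rewrite -ltnS prednK // ltn_ord.
Qed.

End Realization.

(** * Uniqueness of the classical Laurent expression *)

Section Uniqueness.

Variables (T : {set {set 'I_m}}) (hm : (2 < m)%N) (hT : ideal_triangulation T).
Variables (n : nat) (J : 'I_n -> {set 'I_m}).
Hypotheses (J_inj : injective J)
  (J_onto : forall e, e \in internal_edges T <-> exists i, J i = e).

Lemma Lam_basis_r u k : k \in T ->
  Lam T u (basis_vec k) = \sum_(s in T) u s * lam s k.
Proof.
move=> kT; apply: eq_bigr => s _; rewrite (bigD1 k kT) /= basis_vecE eqxx mulr1.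
rewrite big1 ?addr0 // => j /andP[_ /negbTE jk].
by rewrite basis_vecE eq_sym jk mulr0 mul0r.
Qed.

Lemma prod_exprz_sum (I : Type) (s : seq I) (P : pred I) (x : C) (f : I -> int) :
  x != 0 -> \prod_(i <- s | P i) x ^ f i = x ^ (\sum_(i <- s | P i) f i).
Proof.
move=> x0; elim/big_rec2: _ => [|i k y _ ->]; first by rewrite expr0z.
by rewrite expfzDr.
Qed.

Lemma prod_exprz (I : Type) (s : seq I) (P : pred I) (x : I -> C) (k : int) :
  (\prod_(i <- s | P i) x i) ^ k = \prod_(i <- s | P i) x i ^ k.
Proof.
by elim/big_rec2: _ => [|i y z _ <-]; [exact: exp1rz|exact: expfzMl].
Qed.

(* Choosing A_s as the product of the t_i ^ lam s (J i) makes X_j = t_j ^ 4. *)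
Lemma realize_X (t : 'I_n -> C) : (forall i, t i != 0) -> exists v,
  (forall e, e \in T -> Acoord v e != 0) /\
  (forall i, Xcoord v T (J i) = t i ^ (4 : int)).
Proof.
move=> t0; pose B e := \prod_(i < n) t i ^ lam e (J i).
have B0 e : e \in T -> B e != 0.
  by move=> _; apply/prodf_neq0 => i _; apply: expfz_neq0.
have [v h] := realize hm hT B0; exists v; split=> [e eT|j]; first by rewrite h // B0.
rewrite /Xcoord (eq_bigr (fun s => \prod_(i < n) t i ^ (eps T (J j) s * lam s (J i)))).
  rewrite exchange_big /= (eq_bigr (fun i => t i ^ (if i == j then 4 : int else 0))).
    rewrite (bigD1 j) //= eqxx big1 ?mulr1 // => i /negbTE->.
    exact: expr0z.
  move=> i _; rewrite prod_exprz_sum //; congr (_ ^ _).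
  have := Lam_xvec_basis hm hT (J_internal J_onto j) (J_tri J_onto i).
  rewrite (inj_eq J_inj) (Lam_basis_r _ (J_tri J_onto i)) => <-.
  by apply: eq_bigr => s sT; rewrite xvecE sT.
move=> s sT; rewrite h // prod_exprz; apply: eq_bigr => i _.
by rewrite exprz_exp mulrC.
Qed.

Let chi (a : {ffun 'I_n -> int}) (t : 'I_n -> C) : C :=
  monomial (fun i => t i ^ (4 : int)) a.

Lemma chiM (a : {ffun 'I_n -> int}) t t' : chi a (fun i => t i * t' i) = chi a t * chi a t'.
Proof.
rewrite /chi /monomial -big_split; apply: eq_bigr => i _.
transitivity ((t i ^ (4 : int) * t' i ^ (4 : int)) ^ a i); last exact: expfzMl.
by congr (_ ^ _); exact: expfzMl.
Qed.

Lemma chi_separate (a b : {ffun 'I_n -> int}) : a != b ->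
  exists t, (forall i, t i != 0) /\ chi a t != chi b t.
Proof.
move=> ab; have [/forallP h|] := boolP [forall i, a i == b i].
  by case/eqP: ab; apply/ffunP => i; apply/eqP.
(* The witness is 2 at an index where the exponents differ and 1 elsewhere; distinct powers of 2
   differ. *)
case/forallPn=> i abi; pose x : C := (2 : R)%:C%C.
have x0 : x != 0 by rewrite fmorph_eq0 pnatr_eq0.
exists (fun j => if j == i then x else 1); split=> [j|].
  by case: ifP => // _; apply: oner_neq0.
have E (c : {ffun 'I_n -> int}) : chi c (fun j => if j == i then x else 1) = x ^ (4 * c i).
  rewrite /chi /monomial (bigD1 i) //= eqxx big1 ?mulr1 -?exprz_exp // => j /negbTE->.
  by rewrite !exp1rz.
rewrite !E -!fmorphXz; apply: contra abi => /eqP/fmorph_inj/ieexprIz.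
have two : 0 < (2 : R) by rewrite ltr0n.
have two1 : (2 : R) != 1 by rewrite (eqr_nat R 2 1).
by move=> /(_ two two1)/(mulfI (isT : 4 != 0 :> int)) ->.
Qed.

(* Dedekind's argument for the independence of characters. *)
Lemma chi_free (s : seq {ffun 'I_n -> int}) (c : {ffun 'I_n -> int} -> C) : uniq s ->
  (forall t, (forall i, t i != 0) -> \sum_(a <- s) c a * chi a t = 0) ->
  forall a : {ffun 'I_n -> int}, a \in s -> c a = 0.
Proof.
elim: s c => [//|b s IHs] c /= /andP[bs us] h.
have cs (a : {ffun 'I_n -> int}) : a \in s -> c a = 0.
  move=> as_; have ab : a != b by apply: contraNneq bs => <-.
  have [t0 [t0n sep]] := chi_separate ab.
  (* Translating the relation by t0 and subtracting [chi b t0] times the original one removes the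
     term of b. *)
  have := IHs (fun a : {ffun 'I_n -> int} => c a * (chi a t0 - chi b t0)) us _ a as_.
  have H : forall t, (forall i, t i != 0) ->
      \sum_(a <- s) c a * (chi a t0 - chi b t0) * chi a t = 0.
    move=> t tn; have tt i : t0 i * t i != 0 by rewrite mulf_neq0.
    have := h _ tt; have := h _ tn; rewrite !big_cons => /(congr1 ( *%R (chi b t0))).
    rewrite mulr0 => h1 h2; have {h1 h2} := congr2 (fun x y => x - y) h2 h1.
    rewrite subrr chiM mulrDr [chi b t0 * (c b * _)]mulrCA opprD addrACA subrr add0r.
    rewrite mulr_sumr -sumrB => E; rewrite -[RHS]E; apply: eq_bigr => a' _.
    by rewrite chiM; ring.
  by move=> /(_ H)/eqP; rewrite mulf_eq0 subr_eq0 (negbTE sep) orbF => /eqP.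
move=> a; rewrite inE => /orP[/eqP->|/cs//].
have := h (fun=> 1) (fun=> oner_neq0 _); rewrite big_cons big1_seq ?addr0.
  by rewrite /chi /monomial exp1rz big1 ?mulr1 // => i _; rewrite exp1rz.
by move=> a' /andP[_ /cs->]; rewrite mul0r.
Qed.

Lemma mlaurent_eval_incl (X : 'I_n -> C) (P : mlaurent n C)
    (D : {fset {ffun 'I_n -> int}}) : (forall a : {ffun 'I_n -> int}, P a != 0 -> a \in D) ->
  mlaurent_eval X P = \sum_(a <- D) P a * monomial X a.
Proof.
move=> h; apply: big_fset_incl => [|a _]; last first.
  by rewrite memNfinsupp => /eqP->; rewrite mul0r.
by apply/fsubsetP => a; rewrite mem_finsupp; apply: h.
Qed.

(** The X's take as values all fourth powers of nonzero scalars, and on these the monomials are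
    distinct characters, hence independent. *)
Lemma classical_unique (f : ('I_m -> 'cV[C]_2) -> C) (P P' : mlaurent n C) :
  classical_expression T J f P -> classical_expression T J f P' ->
  forall a : {ffun 'I_n -> int}, P a = P' a.
Proof.
move=> hP hP' a; pose D := (finsupp P `|` finsupp P')%fset.
have inD (b : {ffun 'I_n -> int}) : (P b != 0) || (P' b != 0) -> b \in D.
  by rewrite in_fsetU !mem_finsupp.
have [aD|aD] := boolP (a \in D); last first.
  by move: aD; rewrite in_fsetU negb_or !memNfinsupp => /andP[/eqP-> /eqP->].
apply/eqP; rewrite -subr_eq0; apply/eqP.
suff H t : (forall i, t i != 0) ->
    \sum_(b <- D) (fun b => P b - P' b) b * chi b t = 0.
  exact: (chi_free (c := fun b => P b - P' b) (fset_uniq D) H aD).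
move=> tn.
have [v [vT vX]] := realize_X tn.
have := hP v vT; rewrite (hP' v vT).
rewrite (@mlaurent_eval_incl _ P D) => [|b Pb]; last by apply: inD; rewrite Pb.
rewrite (@mlaurent_eval_incl _ P' D) => [|b Pb]; last by apply: inD; rewrite Pb orbT.
move=> /esym/eqP; rewrite -subr_eq0 -sumrB => /eqP E; rewrite -[RHS]E.
apply: eq_bigr => b _; rewrite -mulrBl; congr (_ * _).
by apply: eq_bigr => i _; rewrite vX.
Qed.

End Uniqueness.

End Classical.

(** * The quantum canonical map *)

Lemma psum_rev m (k : letter m -> letter m -> int) (W : seq (letter m)) :
  (forall x y, x \in W -> y \in W -> k x y = - k y x) ->
  psum k (rev W) = - psum k W.
Proof.
elim: W => [_|x W IHW h]; first by rewrite /= oppr0.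
rewrite rev_cons -cats1 psum_cat IHW => [|y z yW zW]; last first.
  by apply: h; rewrite inE ?yW ?zW orbT.
rewrite /= big_nil !addr0 opprD addrC; congr (_ + _).
rewrite /csum -sumrN big_seq [RHS]big_seq.
rewrite (perm_big W) /=; last by rewrite perm_rev.
rewrite (eq_bigl (fun y => y \in W)) => [|y]; last by rewrite mem_rev.
apply: eq_bigr => y yW; rewrite big_seq1; apply: h; rewrite inE ?eqxx //.
by rewrite yW orbT.
Qed.

Lemma eqm4_divK k p : eqm4 k (- p) -> 4 * ((k + p) %/ 4)%Z = k + p.
Proof. by rewrite /eqm4; lia. Qed.

Lemma count_unique (K : eqType) (S : seq (int * K)) (a : K) :
  count (fun t => t.2 == a) S = 1%N ->
  exists k0, forall k, count_mem (k, a) S = (k == k0).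
Proof.
rewrite -size_filter => h.
have [[k0 a'] E] : exists t, [seq t <- S | t.2 == a] = [:: t].
  by case: [seq _ <- _ | _] h => [|t [|]] // _; exists t.
have : (k0, a') \in [seq t <- S | t.2 == a] by rewrite E mem_head.
rewrite mem_filter => /andP[/= /eqP Ea _]; exists k0 => k.
have -> : count_mem (k, a) S = count_mem (k, a) [seq t <- S | t.2 == a].
  rewrite count_filter; apply: eq_count => t /=.
  by case: eqP => [->|//]; rewrite /= eqxx.
by rewrite E /= addn0 xpair_eqE Ea eqxx andbT eq_sym.
Qed.

Lemma coef_of_count (K : choiceType) (I : eqType) (S : seq I) (f : I -> int * K) k a :
  coef_of [seq (1, f t) | t <- S] k a = (count (fun t => f t == (k, a)) S)%:Z.
Proof.
rewrite /coef_of big_map -sum1_count big_mkcond [X in X%:Z]big_mkcond /=.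
by elim/big_rec2: _ => // t y z _ ->; case: ifP => _; rewrite ?PoszD.
Qed.

Section Main.

Variables (m : nat) (hm : (2 < m)%N) (R : realType) (F : unitRingType).
Variables (omega : F) (M : {set {set 'I_m}} -> vec m -> F).
Hypothesis (hM : toric_frames omega M).
Variable Tl : lamination m -> {set {set 'I_m}}.
Hypothesis (hTl : forall l, adapted l (Tl l)).
Implicit Types (l : lamination m) (T : {set {set 'I_m}}).

Let Iq l := M (Tl l) (wvec l).
Let W l := word_of (wvec l).

Lemma Tl_tri l : ideal_triangulation (Tl l).
Proof. by have [] := hTl l. Qed.

Lemma Tl_supported l : supported (Tl l) (wvec l).
Proof. exact: (adapted_supported (hTl l)). Qed.

Lemma word_valid l : valid_word (W l).
Proof. by apply: word_of_valid; apply: wvec_balanced. Qed.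

Lemma word_tri l x : x \in W l -> x.1 \in Tl l.
Proof. by case/mem_word_of=> + _; apply: contraR => /Tl_supported->. Qed.

Lemma word_wdeg l p : wdeg (W l) p = 0.
Proof.
rewrite -vdeg_wvec_of wvec_of_word_of.
by have [_ _ _ ->] := wvec_balanced hm l.
Qed.

Lemma Iq_wval l : Iq l = wval omega M (W l).
Proof.
by rewrite (wval_noncrossing hm hM (Tl_tri l) (@word_tri l)) wvec_of_word_of.
Qed.

Lemma mu_word_anti l x y : x \in W l -> y \in W l ->
  on_letters (mu 2) x y = - on_letters (mu 2) y x.
Proof.
move=> /word_tri xT /word_tri yT; have hT := Tl_tri l.
rewrite /on_letters !mu_ncr ?(tri_ncr hT) //.
by rewrite (lam_anti (tri_card hT xT) (tri_card hT yT)) (mulrC x.2) mulrN.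
Qed.

(** Letters of one lamination do not cross, so [mu] is exactly skew on them and reversal inverts the
    normalising power. With the expansion of the reversed word this yields a second expansion with
    opposite powers. *)
Lemma Iq_wval_rev l :
  Iq l = omega ^ (- psum (on_letters (mu 2)) (W l)) * wprod (edge_elt M) (rev (W l)).
Proof.
rewrite -(psum_rev (@mu_word_anti l)) -/(wval omega M (rev (W l))).
rewrite (wval_noncrossing hm hM (Tl_tri l)); last first.
  by move=> x; rewrite mem_rev; apply: word_tri.
rewrite /Iq -{1}(wvec_of_word_of (wvec l)); congr (M _ _).
by apply: perm_big; rewrite perm_sym perm_rev.
Qed.

Lemma classical_wprod l v : classical_map (R := R) (Tl l) l v = wprod (Acoord v) (W l).
Proof.
rewrite wprod_word_of /classical_map big_mkcond /=; apply: eq_bigr => e _.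
by case: ifP => // /negbT/Tl_supported->; rewrite expr0z.
Qed.

Section Expand.

Variables (T : {set {set 'I_m}}) (hT : ideal_triangulation T).
Variables (n : nat) (J : 'I_n -> {set 'I_m}).
Hypotheses (J_inj : injective J)
  (J_onto : forall e, e \in internal_edges T <-> exists i, J i = e).
Let X i := Xvar M T (J i).
Local Notation q := (omega ^+ 4).

(** The two quantum expansions, with powers t.1 and -t.1, express invariance under the bar
    involution; the third clause is the same list at w = 1. *)
Definition lam_expansion l (S : seq (int * {ffun 'I_n -> int})) : Prop :=
  [/\ Iq l = \sum_(t <- S) omega ^ (4 * t.1) * M T (xcomb T J t.2),
      Iq l = \sum_(t <- S) omega ^ (4 * - t.1) * M T (xcomb T J t.2),
      forall v : 'I_m -> 'cV[R[i]]_2, (forall e, e \in T -> Acoord v e != 0) ->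
        classical_map (Tl l) l v =
        \sum_(t <- S) monomial (fun i => Xcoord v T (J i)) t.2
    & exists2 a0, count (fun t => t.2 == a0) S = 1%N
        & forall t, t \in S -> forall i, t.2 i <= a0 i].

Lemma Cmono_xvec (v : 'I_m -> 'cV[R[i]]_2) j : Cmono T v (xvec T j) = Xcoord v T j.
Proof. by apply: eq_bigr => s sT; rewrite xvecE sT. Qed.

Lemma lam_expansion_exists l : exists S, lam_expansion l S.
Proof.
have [L [hL cL eL]] := word_expansion_exists hm hT (@word_valid l).
set p := psum (on_letters (mu 2)) (W l) in hL.
(* Exponents are read off from the pairings -4 a_i. The powers are congruent to -p modulo 4, so
   dividing them by 4 after adding p is exact. *)
pose af (v : vec m) : {ffun 'I_n -> int} :=
  [ffun i => - (Lam T (basis_vec (J i)) v %/ 4)%Z].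
pose kf (k : int) := ((k + p) %/ 4)%Z.
have kfE t : t \in L -> 4 * kf t.1 = t.1 + p.
  by case/hL=> _; apply: eqm4_divK.
have afE t : t \in L -> t.2 = xcomb T J (af t.2).
  case/hL=> -[vT vd _ _] _.
  have [|a Ea] := xspan_xcomb J_inj J_onto (vdeg0_xspan hm hT vT _).
    by move=> x; rewrite vd word_wdeg.
  rewrite {1}Ea; congr (xcomb _ _ _); apply/ffunP => i.
  rewrite ffunE Ea (Lam_basis_xcomb hm hT J_inj J_onto).
  by move: (a i); clear; lia.
exists [seq (kf t.1, af t.2) | t <- L]; split.
- have [e1 _] := eL _ _ _ _ (quantum_model hm hM hT).
  rewrite Iq_wval /wval e1 /leval mulr_sumr big_map big_seq [RHS]big_seq.
  by apply: eq_bigr => t tL /=; rewrite kfE // -afE // addrC (omegaD hM) mulrA.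
- have [_ e2] := eL _ _ _ _ (quantum_model hm hM hT).
  rewrite Iq_wval_rev e2 /leval mulr_sumr /lbar !big_map big_seq [RHS]big_seq.
  apply: eq_bigr => t tL /=.
  by rewrite mulrN kfE // -afE // opprD addrC (omegaD hM) mulrA.
- move=> v vT; have cm := classical_model vT; have [e1 _] := eL _ _ _ _ cm.
  rewrite classical_wprod e1 /leval big_map big_seq [RHS]big_seq.
  apply: eq_bigr => t tL /=; rewrite exp1rz mul1r afE //.
  rewrite (Mt_xcomb hm hT J_onto cm) exp1rz mul1r -afE //.
  by apply: eq_bigr => i _; rewrite Cmono_xvec.
(* The lowest pairings with the internal edges give the largest exponents. *)
have /hasP[t0 t0L top0] : has (fun t => is_wtop T (W l) t.2) L by rewrite has_count cL.
have topE (t : int * vec m) i : is_wtop T (W l) t.2 ->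
    Lam T (basis_vec (J i)) t.2 = low (W l) (J i).
  by move=> /forall_inP/(_ _ (J_tri J_onto i))/eqP.
exists (af t0.2).
  rewrite count_map -[RHS]cL; apply: eq_in_count => t tL /=.
  apply/eqP/idP => [E|top]; first by rewrite (afE t tL) E -afE.
  by apply/ffunP => i; rewrite !ffunE !topE.
move=> _ /mapP[t tL ->] i /=.
have [[_ _ lo _] _] := hL t tL; have := lo _ (J_tri J_onto i).
rewrite -(topE t0 i top0) (afE t tL) {1}(afE t0 t0L).
rewrite !(Lam_basis_xcomb hm hT J_inj J_onto) -!afE //.
by rewrite lerN2 ler_pM2l.
Qed.

Lemma qz (k : int) : q ^ k = omega ^ (4 * k).
Proof. by rewrite -[q]/(omega ^ (4 : int)) exprz_exp. Qed.

Lemma M_xcomb a :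
  M T (xcomb T J a) = omega ^ (4 * xshift T J a) * monomial X a.
Proof. by rewrite (Mt_xcomb hm hT J_onto (quantum_model hm hM hT)). Qed.

Definition q_terms (S : seq (int * {ffun 'I_n -> int})) :=
  [seq (1 : int, (t.1 + xshift T J t.2, t.2)) | t <- S].

Lemma q_termsE l S : lam_expansion l S -> Iq l = seval q (monomial X) (q_terms S).
Proof.
case=> -> _ _ _; rewrite /seval big_map; apply: eq_bigr => t _ /=.
by rewrite M_xcomb mulrA -(omegaD hM) -mulrDr qz mul1r.
Qed.

(** Ordered monomials are powers of q times frame elements with distinct exponents, so freeness of
    the torus over the powers of omega determines every coefficient. *)
Lemma q_coef_unique l S (P : qlaurent n) : lam_expansion l S ->
  Iq l = qlaurent_eval q X P -> forall a k, P a k = coef_of (q_terms S) k a.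
Proof.
move=> hS hP a k; have [s [s1 _ s3]] := uncollect P.
pose conv (s : seq (int * (int * {ffun 'I_n -> int}))) :=
  [seq (t.1, (4 * (t.2.1 - xshift T J t.2.2), xcomb T J t.2.2)) | t <- s].
have convE s' : seval omega (M T) (conv s') = seval q (monomial X) s'.
  rewrite /seval big_map; apply: eq_bigr => t _ /=.
  rewrite M_xcomb mulrA -[_ * _ * omega ^ _]mulrA -(omegaD hM) -mulrDr subrK.
  by rewrite qz.
have coefE s' : coef_of (conv s') (4 * (k - xshift T J a)) (xcomb T J a) = coef_of s' k a.
  rewrite /coef_of big_map; apply: eq_bigl => -[z [k' b]] /=; rewrite !xpair_eqE.
  apply/andP/andP => [[/eqP E1 /eqP/(xcomb_inj hm hT J_inj J_onto) E2]|[/eqP-> /eqP->]] //.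
  by move: E1; rewrite E2 => /(mulfI (isT : 4 != 0 :> int))/addIr->.
rewrite -s1 -!coefE; apply: (frame_free hT hM).
- by move=> _ /mapP[t _ ->]; apply: supported_xcomb.
- by move=> _ /mapP[t _ ->]; apply: supported_xcomb.
- by rewrite !convE -(q_termsE hS) s3.
Qed.

Lemma q_laurent l : exists P : qlaurent n,
  (forall a k, 0 <= P a k) /\ Iq l = qlaurent_eval q X P.
Proof.
have [S hS] := lam_expansion_exists l; have [P [P1 _ P3]] := collect (q_terms S).
exists P; split=> [a k|]; last by rewrite (q_termsE hS) P3.
by rewrite P1 /q_terms coef_of_count.
Qed.

Lemma specializeE (P : qlaurent n) a :
  specialize_q1 R[i] P a = laurent_eval (1 : R[i]) (P a).
Proof.
rewrite fsfunE; case: ifP => // /negbT h.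
by rewrite (fsfun_dflt h) laurent_eval0.
Qed.

Lemma q_classical l (P : qlaurent n) : Iq l = qlaurent_eval q X P ->
  classical_expression T J (classical_map (Tl l) l) (specialize_q1 R[i] P).
Proof.
move=> hP v vT; have [S hS] := lam_expansion_exists l.
have PE := q_coef_unique hS hP; have [_ _ cl _] := hS; rewrite (cl v vT).
rewrite (@mlaurent_eval_incl _ _ _ _ (finsupp P)); last first.
  move=> a; rewrite specializeE; apply: contraR => h.
  by rewrite (fsfun_dflt h) laurent_eval0.
under [RHS]eq_bigr => a _ do rewrite specializeE.
rewrite -/(fseval (1 : R[i]) (monomial _) P).
have [s [s1 _ <-]] := uncollect P.
rewrite (@seval_eq _ s (q_terms S)) => [|k a]; last by rewrite s1 PE.
by rewrite /seval big_map; apply: eq_bigr => t _ /=; rewrite exp1rz !mul1r.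
Qed.

(** The highest monomial occurs once in the list, with power k0, and with -k0 in the second
    expansion. Freeness gives k0 = -k0, so k0 = 0 and only the reordering power [xshift] is left. *)
Lemma q_highest l (P : qlaurent n) (P0 : mlaurent n R[i]) :
  Iq l = qlaurent_eval q X P ->
  classical_expression T J (classical_map (Tl l) l) P0 ->
  exists a : {ffun 'I_n -> int},
    [/\ highest_exponent (finsupp P0) a, P0 a = 1, highest_exponent (finsupp P) a
      & forall k, P a k = (k == xshift T J a)%:Z].
Proof.
move=> hP hP0; have [S hS] := lam_expansion_exists l.
have PE := q_coef_unique hS hP.
have [e1 e2 _ [a0 c0 top]] := hS.
have [k0 ck] := count_unique c0.
have inj := xcomb_inj hm hT J_inj J_onto.
have k00 : k0 = 0.
  pose s (g : int) := [seq (1 : int, (4 * (g * t.1), xcomb T J t.2)) | t <- S].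
  have sE g : g = 1 \/ g = -1 -> seval omega (M T) (s g) = Iq l.
    rewrite /seval big_map; case=> ->; [rewrite e1|rewrite e2]; apply: eq_bigr => t _ /=;
    by rewrite mul1r ?mulN1r ?mul1r.
  have sS g t : t \in s g -> supported T t.2.2.
    by case/mapP=> t' _ ->; apply: supported_xcomb.
  have := frame_free hT hM (sS 1) (sS (-1))
    (etrans (sE 1 (or_introl erefl)) (esym (sE (-1) (or_intror erefl))))
    (4 * k0) (xcomb T J a0).
  have cE g k : g = 1 \/ g = -1 ->
      coef_of (s g) (4 * k) (xcomb T J a0) = (g * k == k0)%:Z.
    move=> hg; rewrite coef_of_count -ck; congr (_%:Z); apply: eq_count => -[k1 a] /=.
    rewrite !xpair_eqE (inj_eq inj) (inj_eq (mulfI (isT : 4 != 0 :> int))).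
    by congr (_ && _); case: hg => ->; move: k1 k; clear; lia.
  rewrite !cE; [|by right|by left]; rewrite mul1r mulN1r eqxx.
  by move: k0 {ck cE}; clear; lia.
have Pa0 k : P a0 k = (k == xshift T J a0)%:Z.
  rewrite PE /q_terms coef_of_count.
  have -> : (k == xshift T J a0) = (k - xshift T J a0 == k0) :> bool.
    by rewrite k00 subr_eq0.
  rewrite -ck; congr (_%:Z); apply: eq_count => -[k1 a] /=; rewrite !xpair_eqE.
  have [->|_] := eqVneq a a0; last by rewrite !andbF.
  by rewrite !andbT; move: (xshift T J a0) k k1; clear; lia.
have Ptop : highest_exponent (finsupp P) a0.
  split=> [|b].
    rewrite mem_finsupp; apply/eqP => E; have := Pa0 (xshift T J a0).
    by rewrite E /laurent0 fsfun0E eqxx.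
  rewrite mem_finsupp => Pb i.
  have [k /eqP Pbk] : exists k, P b k <> 0.
    apply: contrapT => h; case/eqP: Pb; apply/fsfunP => k; rewrite /laurent0 fsfun0E.
    by apply: contrapT => h'; apply: h; exists k.
  move: Pbk; rewrite PE => /coef_of_neq0[_ [/mapP[t tS ->] /= [_ <-]]].
  exact: top.
have P0E := classical_unique hm hT J_inj J_onto hP0 (q_classical hP).
have P0a0 : P0 a0 = 1.
  rewrite P0E specializeE (@laurent_eval_incl _ _ _ [fset xshift T J a0]%fset).
    by rewrite big_seq_fset1 Pa0 eqxx exp1rz mulr1.
  by move=> k; rewrite Pa0 in_fset1 (eqz_nat _ 0) eqb0 negbK.
exists a0; split=> //; split=> [|b]; first by rewrite mem_finsupp P0a0 oner_neq0.
rewrite mem_finsupp P0E specializeE => h i; apply: (Ptop.2 b).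
by apply: contraR h => h; rewrite (fsfun_dflt h) laurent_eval0.
Qed.

Local Notation K := (in_Xq omega M).

Lemma K0 : K 0.
Proof. by rewrite -(subrr 1); apply: in_Xq_sub; apply: in_Xq_1. Qed.

Lemma KD x y : K x -> K y -> K (x + y).
Proof.
move=> Kx Ky; rewrite -[y]opprK -[- y]add0r.
by apply: in_Xq_sub => //; apply: in_Xq_sub => //; apply: K0.
Qed.

Lemma KXz x (k : int) : K x -> K (x ^ k).
Proof.
move=> Kx; have KX j : K (x ^+ j).
  elim: j => [|j IHj]; first by rewrite expr0; apply: in_Xq_1.
  by rewrite exprS; apply: in_Xq_mul.
by case: k => k; [apply: KX|apply: in_Xq_inv; apply: KX].
Qed.

Lemma K_omega (k : int) : K (omega ^ (4 * k)).
Proof. by rewrite -qz; apply: KXz; apply: in_Xq_q. Qed.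

Lemma xcomb_ind (Q : vec m -> Prop) : Q 0 ->
  (forall u v, supported T u -> supported T v -> xspan T u ->
     Q u -> Q v -> Q (u + v)) ->
  (forall u, supported T u -> Q u -> Q (- u)) ->
  (forall i, Q (xvec T (J i))) -> forall a, Q (xcomb T J a).
Proof.
move=> Q0 QD QN QX a.
have QXn i (k : nat) : Q (xvec T (J i) *+ k).
  elim: k => [|k IHk]; first by rewrite mulr0n.
  rewrite mulrS; apply: QD => //; first exact: supported_xvec.
    by rewrite pmulrn; apply/supportedMz/supported_xvec.
  exact/xspan_xvec/J_internal.
have QXz i (k : int) : Q (xvec T (J i) *~ k).
  case: k => k; first by rewrite -pmulrn.
  rewrite NegzE mulrNz -pmulrn; apply: QN => //.
  by rewrite pmulrn; apply/supportedMz/supported_xvec.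
rewrite /xcomb; suff [] : supported T (\sum_i xvec T (J i) *~ a i) /\
    Q (\sum_i xvec T (J i) *~ a i) by [].
elim: (index_enum _) => [|i r [IHs IHr]].
  by rewrite big_nil; split=> //; apply: supported0.
have sX : supported T (xvec T (J i) *~ a i) by apply/supportedMz/supported_xvec.
rewrite big_cons; split; first exact: supportedD.
by apply: QD => //; apply/xspanMz/xspan_xvec/J_internal.
Qed.

(** As u is an X-exponent, the merging power is a power of q: it lies in the subfield, where the
    effect of [star] is known. *)
Lemma M_split u v : supported T u -> supported T v -> xspan T u ->
  exists k, Lam T u v = 4 * k /\ M T (u + v) = omega ^ (4 * k) * (M T u * M T v).
Proof.
move=> uT vT uX; have /eqm4_dvd[k] := Lam_xspan hm hT J_inj J_onto uX vT.
rewrite add0r => E; exists k; split=> //.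
by rewrite (MtD (quantum_model hm hM hT)) // E.
Qed.

Lemma K_xcomb a : K (M T (xcomb T J a)).
Proof.
apply: (xcomb_ind (Q := fun v => K (M T v))) => [|u v uT vT uX Ku Kv|u uT Ku|i].
- by rewrite (tf_0 hM hT); apply: in_Xq_1.
- have [k [_ ->]] := M_split uT vT uX.
  by apply: in_Xq_mul; [apply: K_omega|apply: in_Xq_mul].
- by rewrite (MtN hT (quantum_model hm hM hT)) //; apply: in_Xq_inv.
- exact: (in_Xq_X omega M hT (J_internal J_onto i)).
Qed.

Lemma K_Iq l : K (Iq l).
Proof.
have [S [-> _ _ _]] := lam_expansion_exists l.
elim/big_ind: _ => [|x y|t _]; [exact: K0|exact: KD|].
by apply: in_Xq_mul; [apply: K_omega|apply: K_xcomb].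
Qed.

(** * Invariance under the antiautomorphism *)

Section Star.

Variable star : F -> F.
Hypothesis (hs : canonical_star K q X star).

Lemma star_inv x : K x -> x \is a GRing.unit -> star x^-1 = (star x)^-1.
Proof.
case: hs => _ [s1 _ sM] _ _ _ Kx ux.
have Kv := in_Xq_inv Kx.
have h1 : star x * star x^-1 = 1 by rewrite -sM // mulVr.
have h2 : star x^-1 * star x = 1 by rewrite -sM // mulrV.
have us : star x \is a GRing.unit by apply/unitrP; exists (star x^-1).
by apply: (mulrI us); rewrite h1 mulrV.
Qed.

Lemma star_omega (k : int) : star (omega ^ (4 * k)) = omega ^ (4 * - k).
Proof.
case: hs => _ [s1 _ sM] _ _ sq.
have uq : q \is a GRing.unit by rewrite unitrX // (tf_omega_unit hM).
have sX (j : nat) : star (q ^+ j) = q ^- j.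
  elim: j => [|j IHj]; first by rewrite expr0 s1 invr1.
  have Kqj : K (q ^+ j) by apply: (@KXz _ j%:Z); apply: in_Xq_q.
  rewrite exprSr sM //; last exact: in_Xq_q.
  by rewrite IHj sq (invrM (unitrX j uq) uq).
rewrite -!qz; case: k => k; first by rewrite -exprnN -sX.
rewrite NegzE opprK -exprnN star_inv; [by rewrite sX invrK| |exact: unitrX].
by apply: (@KXz _ k.+1%:Z); apply: in_Xq_q.
Qed.

(** [star] exchanges the factors for u and v and inverts the power omega^Lam(u, v); since [Lam] is
    skew, the result is again the element of u + v. *)
Lemma star_xcomb a : star (M T (xcomb T J a)) = M T (xcomb T J a).
Proof.
case: (hs) => _ [s1 _ sM] _ sX _.
suff [] : K (M T (xcomb T J a)) /\ star (M T (xcomb T J a)) = M T (xcomb T J a) by [].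
have pm := quantum_model hm hM hT.
apply: (xcomb_ind (Q := fun v => K (M T v) /\ star (M T v) = M T v))
  => [|u v uT vT uX [Ku Su] [Kv Sv]|u uT [Ku Su]|i].
- by rewrite (tf_0 hM hT); split=> //; apply: in_Xq_1.
- have [k [kE ->]] := M_split uT vT uX.
  split; first by apply: in_Xq_mul; [apply: K_omega|apply: in_Xq_mul].
  rewrite sM; [|exact: K_omega|exact: in_Xq_mul].
  rewrite sM // Su Sv star_omega -(omega_comm hM) mulrN -kE.
  by rewrite -(Lam_anti hT) -(MtD pm vT uT) addrC (MtD pm uT vT) kE.
- rewrite (MtN hT pm) //; split; first exact: in_Xq_inv.
  by rewrite star_inv ?Su // (Mt_unit hT pm).
- by split; [apply: (in_Xq_X omega M hT (J_internal J_onto i))|exact: sX].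
Qed.

Lemma star_Iq l : star (Iq l) = Iq l.
Proof.
case: (hs) => _ [s1 sD sM] _ _ _.
have s0 : star 0 = 0.
  by have := sD 0 0 K0 K0; rewrite addr0 => /eqP; rewrite -subr_eq subrr eq_sym => /eqP.
have [S [e1 e2 _ _]] := lam_expansion_exists l; rewrite {1}e1 e2.
suff [] : K (\sum_(t <- S) omega ^ (4 * t.1) * M T (xcomb T J t.2)) /\
  star (\sum_(t <- S) omega ^ (4 * t.1) * M T (xcomb T J t.2)) =
  \sum_(t <- S) omega ^ (4 * - t.1) * M T (xcomb T J t.2) by [].
elim/big_rec2: _ => [|t x y _ [Ky Sy]]; first by rewrite s0; split=> //; apply: K0.
have Kt : K (omega ^ (4 * t.1) * M T (xcomb T J t.2)).
  by apply: in_Xq_mul; [apply: K_omega|apply: K_xcomb].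
split; first exact: KD.
rewrite sD // Sy sM; [|exact: K_omega|exact: K_xcomb].
by rewrite star_xcomb star_omega (omega_comm hM).
Qed.

End Star.
End Expand.

(** The exponent vector of a crossing-free word of degree zero is balanced, hence comes from a
    lamination; its frame element may be taken in the triangulation that [Tl] chooses. *)
Lemma terminal_lamination u : terminal omega M (fun=> 0) u -> exists l, u = Iq l.
Proof.
case=> V [vV nc dV ->]; have [T hT VT] := noncrossing_word vV nc.
have supV : supported T (wvec_of V).
  rewrite /wvec_of big_seq; apply: supported_sum => x /VT xT.
  exact/supportedMz/supported_basis.
have inT e : wvec_of V e != 0 -> e \in T by apply: contraR => /supV->.
have bal : balanced (wvec_of V).
  split=> [e /inT|e f /inT eT /inT fT|e ne|p].
  - exact: (tri_card hT).
  - exact: (tri_ncr hT).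
  - rewrite /wvec_of sum_ffunE big_seq; apply: sumr_ge0 => x /vV[_ sx].
    rewrite vecMz basis_vecE; case: eqP => [E|]; last by rewrite mul0r.
    by case: sx => [->//|[_]]; rewrite E (negbTE ne).
  - by rewrite vdeg_wvec_of dV.
have [l El] := balanced_lamination hm bal; exists l.
rewrite (wval_noncrossing hm hM hT VT) -El; apply: (frame_indep hm hM hT (Tl_tri l)).
  by rewrite El.
exact: Tl_supported.
Qed.

(** The rule modulo 4, applied to a term of l' and then to a term of l, identifies this sum with
    [Lam] of their exponents. The first exponent has degree zero, hence is an X-exponent and pairs
    in multiples of 4; so normalising the concatenated words costs a power of q. *)
Lemma csum_words l l' : eqm4 (csum (on_letters (mu 2)) (W l) (W l')) 0.
Proof.
have hT := Tl_tri l; set T := Tl l in hT.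
have [L [hL cL _]] := word_expansion_exists hm hT (@word_valid l).
have [L' [hL' cL' _]] := word_expansion_exists hm hT (@word_valid l').
have /hasP[t tL _] : has (fun t => is_wtop T (W l) t.2) L by rewrite has_count cL.
have /hasP[t' tL' _] : has (fun t => is_wtop T (W l') t.2) L' by rewrite has_count cL'.
have [[u1 u2 _ u4] _] := hL t tL; have [[v1 v2 _ v4] _] := hL' t' tL'.
pose g e := \sum_(y <- W l') y.2 * mu 2 e y.1.
have gq : quad_additive g.
  apply: quad_additive_sum => y /word_valid[cy _]; exact: mu_quad_additive.
have H := u4 g t'.2 gq v1 _.
have hx : xspan T t.2 by apply: vdeg0_xspan => // x; rewrite u2 word_wdeg.
pose J (i : 'I_#|internal_edges T|) := enum_val i.
have Jo e : e \in internal_edges T <-> exists i, J i = e.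
  split=> [eI|[i <-]]; last exact: enum_valP.
  by exists (enum_rank_in eI e); rewrite /J enum_rankK_in.
have := Lam_xspan hm hT (@enum_val_inj _ _) Jo hx v1.
move/eqm4_sym => h0; apply: eqm4_sym; apply: eqm4_trans h0 _.
have -> : csum (on_letters (mu 2)) (W l) (W l') = \sum_(x <- W l) x.2 * g x.1.
  apply: eq_bigr => x _; rewrite /g mulr_sumr; apply: eq_bigr => y _.
  by rewrite /on_letters mulrA.
apply: H => j jT; have cj := tri_card hT jT.
rewrite (Lam_anti hT).
have := v4 (fun e => 1 * mu 2 e j) _ (mu_quad_additive 1 cj) (supported_basis jT).
move=> h; apply: eqm4_trans (eqm4N (h _)) _.
  move=> i iT; rewrite Lam_basis // mul1r mu_ncr ?(tri_ncr hT) //; exact: eqm4_refl.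
rewrite -sumrN /g big_seq [X in eqm4 _ X]big_seq.
apply: (big_ind2 eqm4) => [||y /word_valid[cy _]]; first exact: eqm4_refl.
  by move=> *; apply: eqm4D.
rewrite mul1r -mulrN; apply: eqm4M; have := mu_anti cj cy; rewrite /eqm4.
by move: (mu 2 j _) (mu 2 _ j); clear; lia.
Qed.

Lemma Iq_mul l l' : exists s : seq (int * lamination m),
  Iq l * Iq l' = \sum_(t <- s) omega ^ (4 * t.1) * Iq t.2.
Proof.
have span u : qspan omega (terminal omega M (fun=> 0)) u ->
    exists s : seq (int * lamination m), u = \sum_(t <- s) omega ^ (4 * t.1) * Iq t.2.
  elim=> [|x y _ [s ->] _ [s' ->]|k x /terminal_lamination[l0 ->]].
  - by exists [::]; rewrite big_nil.
  - by exists (s ++ s'); rewrite big_cat.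
  - by exists [:: (k, l0)]; rewrite big_seq1.
apply: span.
have vW : valid_word (W l ++ W l').
  by move=> x; rewrite mem_cat => /orP[]; apply: word_valid.
have := resolve hm hM vW.
have -> : wdeg (W l ++ W l') = fun=> 0.
  by apply/funext => p; rewrite wdeg_cat !word_wdeg addr0.
rewrite (wval_cat hM) -!Iq_wval => h.
rewrite -[Iq l * Iq l']mul1r -(expr0z omega).
exact: (qspan_eqm4 hM (eqm4_sym (csum_words l l')) h).
Qed.

End Main.

Theorem theorem7p3p6 (m : nat) (hm : (2 < m)%N) (R : realType)
    (F : unitRingType) (hF : skew_field F) (omega : F)
    (M : {set {set 'I_m}} -> vec m -> F) (hM : toric_frames omega M)
    (Tl : lamination m -> {set {set 'I_m}}) (hTl : forall l, adapted l (Tl l)) :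
  let q := omega ^+ 4 in
  let Iq := fun l => M (Tl l) (wvec l) in
  let I := fun l => @classical_map m R (Tl l) l in
  (forall l, in_Xq omega M (Iq l)) /\
  (forall (T : {set {set 'I_m}}) (n : nat) (J : 'I_n -> {set 'I_m}),
    ideal_triangulation T -> injective J ->
    (forall e, e \in internal_edges T <-> exists i, J i = e) ->
    let X := fun i => Xvar M T (J i) in
    [/\ forall l, exists P : qlaurent n,
          (forall a k, 0 <= P a k) /\ Iq l = qlaurent_eval q X P,
        forall l (P : qlaurent n), Iq l = qlaurent_eval q X P ->
          classical_expression T J (I l) (specialize_q1 R[i] P),
        forall star, canonical_star (in_Xq omega M) q X star ->
          forall l, star (Iq l) = Iq l
      & forall l (P : qlaurent n) (P0 : mlaurent n R[i]),
          Iq l = qlaurent_eval q X P -> classical_expression T J (I l) P0 ->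
          exists a : {ffun 'I_n -> int},
            [/\ highest_exponent (finsupp P0) a,
                P0 a = 1,
                highest_exponent (finsupp P) a
              & forall k, P a k =
                  (k == - \sum_(i < n) \sum_(j < n | (i < j)%N)
                            eps T (J i) (J j) * a i * a j)%:Z]]) /\
  (forall l l', exists c : {fsfun lamination m -> laurent with laurent0},
    Iq l * Iq l' =
      \sum_(l'' <- finsupp c) laurent_eval q (c l'') * Iq l'').
Proof.
move=> q Iq I; split; [|split].
- move=> l; have hT := Tl_tri hTl l.
  pose J (i : 'I_#|internal_edges (Tl l)|) := enum_val i.
  have Jo e : e \in internal_edges (Tl l) <-> exists i, J i = e.
    split=> [eI|[i <-]]; last exact: enum_valP.
    by exists (enum_rank_in eI e); rewrite /J enum_rankK_in.
  exact: (K_Iq hm R hM hTl hT (@enum_val_inj _ _) Jo l).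
- move=> T n J hT J_inj J_onto X; split.
  + exact: (q_laurent hm R hM hTl hT J_inj J_onto).
  + exact: (q_classical hm hM hTl hT J_inj J_onto).
  + by move=> star hs l; apply: (star_Iq hm R hM hTl hT J_inj J_onto hs).
  + exact: (q_highest hm hM hTl hT J_inj J_onto).
- move=> l l'; have [s E] := Iq_mul hm hM hTl l l'.
  (* The resolution may produce the same lamination several times; collecting adds up its
     coefficients. *)
  have [c [_ _ cE]] := collect [seq (1 : int, t) | t <- s]; exists c.
  have := cE F q Iq; rewrite /fseval => <-; rewrite /seval big_map [LHS]E.
  by apply: eq_bigr => t _ /=; rewrite mul1r qz.
Qed.
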